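(* Let $F$ be a field of characteristic zero, $G$ a finite group, and let $A$ be a finite-dimensional unitary $(G,* )$-algebra over $F$. Then there is a constant $\alpha$ with $c_n^\sharp(A)\leq \alpha n^2$ for all $n\ge 1$ if and only if $A$ is $T_G^*$-equivalent to a finite direct sum of $(G,* )$-algebras each generating a minimal variety with at most quadratic codimension growth.
   Context: A $(G,* )$-algebra is an associative $G$-graded $F$-algebra $A=\bigoplus_{g\in G}A_g$ with an ($F$-linear) involution $*$ such that $A_g^*=A_g$ for all $g$. Put $A_g^{\pm}=\{a\in A_g: a^*=\pm a\}$. Unitary means having a unit element. The free $(G,* )$-algebra is the free associative algebra on variables $x_{i,g}^+$ (symmetric of degree $g$) and $x_{i,g}^-$ (skew of degree $g$), $i\ge1$, $g\in G$. $\mathrm{Id}^\sharp(A)$ is the set of its elements vanishing under all evaluations $x_{i,g}^{\epsilon}\mapsto a\in A_g^\epsilon$. $A$ and $B$ are $T_G^*$-equivalent if $\mathrm{Id}^\sharp(A)=\mathrm{Id}^\sharp(B)$. The variety $\mathrm{var}^\sharp(A)$ is the class of all $(G,* )$-algebras $B$ with $\mathrm{Id}^\sharp(A)\subseteq\mathrm{Id}^\sharp(B)$. $P_n^\sharp$ is the span of all $w_{\sigma(1)}\cdots w_{\sigma(n)}$, $\sigma\in S_n$, $w_i\in\{x_{i,g}^+,x_{i,g}^-:g\in G\}$, and $c_n^\sharp(A)=\dim_FP_n^\sharp/(P_n^\sharp\cap\mathrm{Id}^\sharp(A))$; for a variety $\mathcal{U}=\mathrm{var}^\sharp(B)$ put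 $c_n^\sharp(\mathcal{U})=c_n^\sharp(B)$. An algebra $A$ generates a minimal variety of polynomial growth $n^t$ if $c_n^\sharp(A)\approx qn^t$ for some $q>0$ and every proper subvariety $\mathcal{U}\subsetneq\mathrm{var}^\sharp(A)$ satisfies $c_n^\sharp(\mathcal{U})\approx q'n^p$ with $p<t$ (for $t=0$: $c_n^\sharp(\mathcal{U})=0$ for all large $n$). It has at most quadratic growth if $t\le2$. *)

(* Defs.v *)
From HB Require Import structures.
From mathcomp Require Import all_boot all_order all_algebra all_fingroup.
From mathcomp Require Import finmap boolp classical_sets functions reals topology normedtype.
From mathcomp Require Import landau.
(* The notations of monalg are incompatible with those of MathComp-Analysis. *)
From mathcomp Require Import -(notations) monalg.
Import GRing.Theory Num.Theory numFieldNormedType.Exports.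

Set Implicit Arguments.
Unset Strict Implicit.
Unset Printing Implicit Defensive.

Local Open Scope classical_set_scope.
Local Open Scope ring_scope.

(* The (G, * )-algebras are not assumed to have a unit, so that the ring
   structures of MathComp do not apply: the product is an explicit operation
   on a module. *)
Record gsalg_axioms (F : fieldType) (G : finGroupType) (A : lmodType F)
    (mul : A -> A -> A) (star : A -> A) (comp : G -> set A) : Prop :=
  GSAlgAxioms {
  gs_mulA : associative mul;
  gs_mulDl : left_distributive mul +%R;
  gs_mulDr : right_distributive mul +%R;
  gs_mulZl : forall (c : F) x y, mul (c *: x) y = c *: mul x y;
  gs_mulZr : forall (c : F) x y, mul x (c *: y) = c *: mul x y;
  gs_comp0 : forall g, comp g 0;
  gs_compP : forall g (c : F) x y, comp g x -> comp g y -> comp g (c *: x + y);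
  gs_comp_sum : forall x, exists2 f : G -> A,
    (forall g, comp g (f g)) & x = \sum_g f g;
  gs_comp_direct : forall f : G -> A,
    (forall g, comp g (f g)) -> \sum_g f g = 0 -> forall g, f g = 0;
  gs_compM : forall g h x y,
    comp g x -> comp h y -> comp (g * h)%g (mul x y);
  gs_star_linear : linear star;
  gs_starK : involutive star;
  gs_starM : forall x y, star (mul x y) = mul (star y) (star x);
  gs_star_comp : forall g, star @` comp g = comp g }.

Record gsalg (F : fieldType) (G : finGroupType) := GSAlg {
  gs_sort :> lmodType F;
  gs_mul : gs_sort -> gs_sort -> gs_sort;
  gs_star : gs_sort -> gs_sort;
  gs_comp : G -> set gs_sort;
  gsalgP : gsalg_axioms gs_mul gs_star gs_comp }.

Definition unitary (F : fieldType) (G : finGroupType) (A : gsalg F G) : Prop :=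
  exists e : A, forall x : A, gs_mul e x = x /\ gs_mul x e = x.

Definition finite_dimensional (F : fieldType) (V : lmodType F) : Prop :=
  exists n, inhabited (Vector.axiom n V).

(* A_g^+ for eps = true, A_g^- for eps = false *)
Definition gs_scomp (F : fieldType) (G : finGroupType) (A : gsalg F G)
    (g : G) (eps : bool) : set A :=
  [set a | gs_comp g a /\ gs_star a = if eps then a else - a].

(* (i, (g, true)) is x_{i,g}^+ and (i, (g, false)) is x_{i,g}^- *)
Definition gsvar (G : finGroupType) : choiceType := (nat * (G * bool))%type.

(* This is the free algebra with unit; the free (G, * )-algebra, in which
   identities live, consists of its elements without constant term. *)
Definition freealg (F : fieldType) (G : finGroupType) : lalgType F :=
  malg (fmonom (gsvar G)) F.

Definition fvar (F : fieldType) (G : finGroupType) (x : gsvar G) :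
  freealg F G := mkmalgU (fmu x) 1.

Definition admissible (F : fieldType) (G : finGroupType) (A : gsalg F G)
    (phi : gsvar G -> A) : Prop :=
  forall i g eps, gs_scomp g eps (phi (i, (g, eps))).

(* The value 0 on the empty word is junk. *)
Definition eval_word (F : fieldType) (G : finGroupType) (A : gsalg F G)
    (phi : gsvar G -> A) (w : seq (gsvar G)) : A :=
  if w is x :: w' then foldl (fun a y => gs_mul a (phi y)) (phi x) w' else 0.

Definition eval_free (F : fieldType) (G : finGroupType) (A : gsalg F G)
    (phi : gsvar G -> A) (f : freealg F G) : A :=
  \sum_(w <- msupp f) mcoeff w f *: eval_word phi w.

Definition Id (F : fieldType) (G : finGroupType) (A : gsalg F G) :
    set (freealg F G) :=
  [set f | mcoeff mone f = 0 /\
           forall phi : gsvar G -> A, admissible phi -> eval_free phi f = 0].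

Definition T_equiv (F : fieldType) (G : finGroupType) (A B : gsalg F G) : Prop :=
  Id A = Id B.

(* The variety generated by A. It is a predicate and not a set, because of
   the universe level of the type of algebras. *)
Definition var (F : fieldType) (G : finGroupType) (A B : gsalg F G) : Prop :=
  Id A `<=` Id B.

Definition proper_subvar (F : fieldType) (G : finGroupType) (B A : gsalg F G) :
    Prop :=
  (forall C, var B C -> var A C) /\ ~ (forall C, var A C -> var B C).

(* P_n, with the indices 1..n shifted to 0..n-1: the span of the products
   w_{s 0} ... w_{s (n-1)}, where w_i is the variable of index i whose degree
   and sign are given by d i. *)
Definition multilin (F : fieldType) (G : finGroupType) (n : nat) :
    set (freealg F G) :=
  [set f | exists c : 'S_n -> {ffun 'I_n -> G * bool} -> F,
    f = \sum_(s : 'S_n) \sum_(d : {ffun 'I_n -> G * bool})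
          c s d *: \prod_(i < n) fvar F (nat_of_ord (s i), d (s i))].

(* For subspaces P and I of V: dim P / (P `&` I) = d, that is, some
   b_1, ..., b_d in P are a basis of P modulo I. *)
Definition is_quot_dim (F : fieldType) (V : lmodType F) (P I : set V) (d : nat) :
    Prop :=
  exists b : 'I_d -> V,
    [/\ forall i, P (b i),
        forall c : 'I_d -> F, I (\sum_i c i *: b i) -> forall i, c i = 0
      & forall v, P v -> exists c : 'I_d -> F, I (v - \sum_i c i *: b i)].

Definition codim (F : fieldType) (G : finGroupType) (A : gsalg F G) (n : nat) :
    nat :=
  xget 0%N (is_quot_dim (@multilin F G n) (Id A)).

(* The relation ~_\oo is asymptotic equivalence. For q = 0 it says that the
   codimensions vanish for all large n. *)
Definition codim_growth (R : realType) (F : fieldType) (G : finGroupType)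
    (A : gsalg F G) (q : R) (t : nat) : Prop :=
  (fun n => (codim A n)%:R : R^o) ~_\oo (fun n => q * n%:R ^+ t : R^o).

(* Proper subvarieties may be nilpotent, hence q' = 0 is allowed below. *)
Definition minimal_growth (R : realType) (F : fieldType) (G : finGroupType)
    (A : gsalg F G) (t : nat) : Prop :=
  (exists2 q : R, 0 < q & codim_growth A q t) /\
  forall B : gsalg F G, proper_subvar B A ->
    if t is 0%N then \forall n \near \oo, codim B n = 0%N
    else exists (q' : R) (p : nat), (p < t)%N /\ codim_growth B q' p.

Section DirectSum.
Variables (F : fieldType) (G : finGroupType) (I : finType) (B : I -> gsalg F G).

Definition dsum : Type := {dffun forall i, B i}.
HB.instance Definition _ := Choice.on dsum.

Definition dsum_zero : dsum := finfun (fun i => 0 : B i).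
Definition dsum_opp (x : dsum) : dsum := finfun (fun i => - x i).
Definition dsum_add (x y : dsum) : dsum := finfun (fun i => x i + y i).
Definition dsum_scale (c : F) (x : dsum) : dsum := finfun (fun i => c *: x i).

Fact dsum_addA : associative dsum_add.
Proof. by move=> x y z; apply/ffunP=> i; rewrite !ffunE addrA. Qed.
Fact dsum_addC : commutative dsum_add.
Proof. by move=> x y; apply/ffunP=> i; rewrite !ffunE addrC. Qed.
Fact dsum_add0 : left_id dsum_zero dsum_add.
Proof. by move=> x; apply/ffunP=> i; rewrite !ffunE add0r. Qed.
Fact dsum_addN : left_inverse dsum_zero dsum_opp dsum_add.
Proof. by move=> x; apply/ffunP=> i; rewrite !ffunE addNr. Qed.
HB.instance Definition _ :=
  GRing.isZmodule.Build dsum dsum_addA dsum_addC dsum_add0 dsum_addN.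

Fact dsum_scaleA a b (x : dsum) :
  dsum_scale a (dsum_scale b x) = dsum_scale (a * b) x.
Proof. by apply/ffunP=> i; rewrite !ffunE scalerA. Qed.
Fact dsum_scale1 : left_id 1 dsum_scale.
Proof. by move=> x; apply/ffunP=> i; rewrite !ffunE scale1r. Qed.
Fact dsum_scaleDr : right_distributive dsum_scale +%R.
Proof. by move=> a x y; apply/ffunP=> i; rewrite !ffunE scalerDr. Qed.
Fact dsum_scaleDl (x : dsum) : {morph dsum_scale^~ x : a b / a + b}.
Proof. by move=> a b; apply/ffunP=> i; rewrite !ffunE scalerDl. Qed.
HB.instance Definition _ := GRing.Zmodule_isLmodule.Build F dsum
  dsum_scaleA dsum_scale1 dsum_scaleDr dsum_scaleDl.

Definition dsum_mul (x y : dsum) : dsum := finfun (fun i => gs_mul (x i) (y i)).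
Definition dsum_star (x : dsum) : dsum := finfun (fun i => gs_star (x i)).
Definition dsum_comp (g : G) : set dsum := [set x | forall i, gs_comp g (x i)].

Fact dsum_sumE (J : finType) (f : J -> dsum) i : (\sum_j f j) i = \sum_j f j i.
Proof.
apply: (big_morph (fun x : dsum => x i)) => [x y|]; by rewrite ffunE.
Qed.

Fact dsum_axioms : gsalg_axioms dsum_mul dsum_star dsum_comp.
Proof.
split.
- by move=> x y z; apply/ffunP=> i; rewrite !ffunE (gs_mulA (gsalgP (B i))).
- by move=> x y z; apply/ffunP=> i; rewrite !ffunE (gs_mulDl (gsalgP (B i))).
- by move=> x y z; apply/ffunP=> i; rewrite !ffunE (gs_mulDr (gsalgP (B i))).
- by move=> c x y; apply/ffunP=> i; rewrite !ffunE (gs_mulZl (gsalgP (B i))).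
- by move=> c x y; apply/ffunP=> i; rewrite !ffunE (gs_mulZr (gsalgP (B i))).
- by move=> g i; rewrite ffunE; apply: gs_comp0 (gsalgP (B i)) g.
- move=> g c x y xg yg i; rewrite !ffunE.
  exact: (gs_compP (gsalgP (B i))).
- move=> x.
  pose P i (f : G -> B i) :=
    (forall g, gs_comp g (f g)) /\ x i = \sum_g f g.
  have /(_ _)/cid h i : exists f, P i f.
    by have [f fP fE] := gs_comp_sum (gsalgP (B i)) (x i); exists f.
  exists (fun g => finfun (fun i => sval (h i) g)) => [g i|].
    by rewrite ffunE; have [] := svalP (h i).
  apply/ffunP=> i; rewrite dsum_sumE; have [_ ->] := svalP (h i).
  by apply: eq_bigr => g _; rewrite ffunE.
- move=> f fP f0 g; apply/ffunP=> i; rewrite [RHS]ffunE.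
  apply: (gs_comp_direct (gsalgP (B i)) (f := fun g => f g i)).
    by move=> h; apply: fP.
  by rewrite -dsum_sumE f0 ffunE.
- move=> g h x y xg yh i; rewrite ffunE.
  exact: (gs_compM (gsalgP (B i))).
- move=> c x y; apply/ffunP=> i.
  by rewrite !ffunE (gs_star_linear (gsalgP (B i))).
- by move=> x; apply/ffunP=> i; rewrite !ffunE (gs_starK (gsalgP (B i))).
- by move=> x y; apply/ffunP=> i; rewrite !ffunE (gs_starM (gsalgP (B i))).
- have starP g x : dsum_comp g x -> dsum_comp g (dsum_star x).
    move=> xg i; rewrite ffunE -(gs_star_comp (gsalgP (B i)) g).
    by exists (x i).
  move=> g; apply/seteqP; split=> [_ [x xg <-]|x xg]; first exact: starP.
  exists (dsum_star x); first exact: starP.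
  by apply/ffunP=> i; rewrite !ffunE (gs_starK (gsalgP (B i))).
Qed.

(* The sum of the empty family is the zero algebra. *)
Definition direct_sum : gsalg F G := GSAlg dsum_axioms.

End DirectSum.

(* Main.v *)
(* Substituting 1 for the symmetric variables of degree 1 turns a proper
   polynomial of degree k which is not an identity of the unitary algebra A
   into binomial(n, k) independent elements of P_n. Quadratic growth therefore
   makes every proper polynomial of degree at least 3 an identity, and the
   identities of A are determined by the degrees s, t and signs e for which
   x^s y^t + e y^t x^s vanishes on A. Each (s, t, e) for which it does not
   vanish is realized by an algebra with basis 1, u, v, w and u v = kappa w =
   e v u whose identities contain those of A, and A is equivalent to the direct
   sum of these algebras.
   It remains to see that such an algebra generates a minimal variety. Its
   subvarieties may be generated by nonunitary algebras, but for large n their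
   identities are again described by the nonvanishing binary polynomials, now
   multiplied by a word in symmetric variables of degree 1: the step from p to
   p(x_j o z) - p o z, where o is the Jordan product, isolates a single one of
   them inside an arbitrary multilinear identity. Hence the codimensions are
   eventually a0 + a1 n + a2 binomial(n, 2), where a0, a1, a2 count the
   surviving binary polynomials by the number of variables other than the
   symmetric ones of degree 1. *)
Require Import Defs.
From HB Require Import structures.
From mathcomp Require Import all_boot all_order zify ring lra all_algebra all_fingroup.
From mathcomp Require Import finmap boolp classical_sets functions reals topology
  normedtype.
From mathcomp Require Import landau.
From mathcomp Require Import -(notations) monalg.
Set Implicit Arguments.
Unset Strict Implicit.
Unset Printing Implicit Defensive.
Import Order.TTheory GRing.Theory Num.Theory.
Local Open Scope ring_scope.

(** The involution is the reason why two functionals for each pair of letters suffice. It reverses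
    words, up to a sign shared by all words of a multilinear polynomial, so multilinear identities
    are stable under reversal and, 2 being invertible, split into a part of sign + and one of sign
    -. With the letters other than x_i and x_j set to 1, each part becomes a multiple of x_i x_j +
    x_j x_i or x_i x_j - x_j x_i. The functional of sign + is the sum of all coefficients, whatever
    the pair; those of sign - vary with the pair, and one polynomial may carry several of them. A
    unit separates them by specialization; without a unit this is impossible, whence the Jordan
    step. Its product has to be symmetrized, since only then is it again symmetric of degree 1.
    Minimality rests on absorption: if a type of element dies, so does every pair containing it, and
    if the type of w dies, so does the pair (u, v). Losing any functional thus loses the dominant
    one. The case kappa = 0 gives growth 0 and 1. Equality of all identities, not only multilinear
    ones, is obtained by polarization, where n! is inverted. *)

Section Unitization.
Variables (F : fieldType) (G : finGroupType) (B : gsalg F G).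
Implicit Types x y z : (F^o * B)%type.

(* [B] need not have a unit; [F + B] is a ring, in which the product over an
   empty word makes sense. *)
Definition unitization : Type := (F^o * B)%type.
HB.instance Definition _ := GRing.Lmodule.copy unitization (F^o * B)%type.

Definition umul (x y : unitization) : unitization :=
  (x.1 * y.1 : F^o, x.1 *: y.2 + y.1 *: x.2 + gs_mul x.2 y.2).
Definition uone : unitization := (1 : F^o, 0).
Definition emb (b : B) : unitization := (0 : F^o, b).
Definition ustar (x : unitization) : unitization := (x.1, gs_star x.2).

Lemma gs_mul0l (x : B) : gs_mul 0 x = 0.
Proof. by have := gs_mulZl (gsalgP B) 0 0 x; rewrite !scale0r. Qed.

Lemma gs_mul0r (x : B) : gs_mul x 0 = 0.
Proof. by have := gs_mulZr (gsalgP B) 0 x 0; rewrite !scale0r. Qed.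

Let mulDl := gs_mulDl (gsalgP B).
Let mulDr := gs_mulDr (gsalgP B).
Let mulZl := gs_mulZl (gsalgP B).
Let mulZr := gs_mulZr (gsalgP B).

Fact umulA : associative umul.
Proof.
move=> [a x] [b y] [c z]; rewrite /umul /=; congr pair; first by rewrite mulrA.
rewrite !scalerDr !mulDl !mulDr !mulZl !mulZr !scalerA (gs_mulA (gsalgP B)).
by rewrite [c * a]mulrC [c * b]mulrC [LHS](AC (4*3) (1*((2*4)*6)*((3*5)*7))).
Qed.

Fact umul1l : left_id uone umul.
Proof.
case=> a x; rewrite /umul /= mul1r scale1r scaler0 addr0 gs_mul0l addr0.
by [].
Qed.

Fact umul1r : right_id uone umul.
Proof.
by case=> a x; rewrite /umul /= mulr1 scale1r scaler0 add0r gs_mul0r addr0.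
Qed.

Fact umulDl : left_distributive umul +%R.
Proof.
move=> [a x] [b y] [c z]; apply/pair_equal_spec; split=> /=.
  by rewrite mulrDl.
by rewrite scalerDl scalerDr mulDl [LHS](AC (2*2*2) ((1*3)*5*((2*4)*6))).
Qed.

Fact umulDr : right_distributive umul +%R.
Proof.
move=> [a x] [b y] [c z]; apply/pair_equal_spec; split=> /=.
  by rewrite mulrDr.
by rewrite scalerDl scalerDr mulDr [LHS](AC (2*2*2) ((1*3)*5*((2*4)*6))).
Qed.

Fact uone_neq0 : uone != 0.
Proof. by apply/eqP=> -[] /eqP; rewrite oner_eq0. Qed.

HB.instance Definition _ := GRing.Zmodule_isNzRing.Build unitization
  umulA umul1l umul1r umulDl umulDr uone_neq0.

Fact uscaleAl (c : F) (x y : unitization) : c *: (x * y) = c *: x * y.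
Proof.
case: x y => [a x] [b y]; apply/pair_equal_spec; split=> /=.
  by rewrite /GRing.scale /= mulrA.
by rewrite !scalerDr !scalerA mulZl; congr (_ + _ *: _ + _); rewrite mulrC.
Qed.

HB.instance Definition _ := GRing.Lmodule_isLalgebra.Build F unitization uscaleAl.

Fact uscaleAr (c : F) (x y : unitization) : c *: (x * y) = x * (c *: y).
Proof.
case: x y => [a x] [b y]; apply/pair_equal_spec; split=> /=.
  by rewrite /GRing.scale /= mulrCA.
by rewrite !scalerDr !scalerA mulZr; congr (_ *: _ + _ + _); rewrite mulrC.
Qed.

HB.instance Definition _ := GRing.Lalgebra_isAlgebra.Build F unitization uscaleAr.

Lemma emb_is_linear : linear emb.
Proof.
by move=> c x y; apply/pair_equal_spec; split=> //=; rewrite scaler0 addr0.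
Qed.
HB.instance Definition _ := GRing.isLinear.Build F B unitization *:%R emb
  emb_is_linear.

Lemma embM (x y : B) : emb (gs_mul x y) = emb x * emb y.
Proof.
apply/pair_equal_spec; split=> /=; first by rewrite mulr0.
by rewrite !scale0r add0r add0r.
Qed.

Lemma emb_inj : injective emb.
Proof. by move=> x y []. Qed.

Lemma ustarM (x y : unitization) : ustar (x * y) = ustar y * ustar x.
Proof.
have starL := gs_star_linear (gsalgP B).
have starD u v : gs_star (u + v : B) = gs_star u + gs_star v.
  by have := starL 1 u v; rewrite !scale1r.
have starZ c u : gs_star (c *: u : B) = c *: gs_star u.
  have s0 : gs_star (0 : B) = 0.
    by have := starL (-1) 0 0; rewrite scaler0 addr0 scaleN1r addNr.
  by have := starL c u 0; rewrite !addr0 s0 addr0.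
case: x y => [a x] [b y]; apply/pair_equal_spec; split=> /=; first exact: mulrC.
by rewrite !starD !starZ (gs_starM (gsalgP B)) [b *: _ + _]addrC.
Qed.

Lemma ustar_is_linear : linear ustar.
Proof.
move=> c [a x] [b y]; apply/pair_equal_spec; split=> //=.
exact: (gs_star_linear (gsalgP B)).
Qed.
HB.instance Definition _ := GRing.isLinear.Build F unitization unitization *:%R
  ustar ustar_is_linear.

Lemma ustar1 : ustar 1 = 1.
Proof.
apply/pair_equal_spec; split=> //=.
have := gs_star_linear (gsalgP B) (-1) 0 0.
by rewrite scaler0 addr0 scaleN1r addNr.
Qed.

End Unitization.

(** The type of a unit element, hence of the letters that may be specialized to 1. *)
Definition one_t (G : finGroupType) : G * bool := (1%g, true).
Arguments one_t {G}.

Definition ghom (F : fieldType) (G : finGroupType) (B : gsalg F G)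
  (t : G * bool) (b : B) : Prop := gs_scomp t.1 t.2 b.

Definition sgn (F : fieldType) (eta : bool) : F := if eta then 1 else -1.
Arguments sgn {F} eta.

Lemma sgn_sqr (F : fieldType) eta : sgn eta * sgn eta = 1 :> F.
Proof. by case: eta; rewrite /= ?mulr1 // mulrNN mulr1. Qed.

Definition upd (T : Type) (b : nat -> T) (i : nat) (x : T) : nat -> T :=
  fun k => if k == i then x else b k.

Lemma upd_eq (T : Type) (b : nat -> T) i x : upd b i x i = x.
Proof. by rewrite /upd eqxx. Qed.

Lemma upd_neq (T : Type) (b : nat -> T) i x k : k != i -> upd b i x k = b k.
Proof. by rewrite /upd => /negPf ->. Qed.

(** * Multilinear polynomials and their evaluation *)

Section Polynomials.
Variable F : fieldType.

(* The letters carry no degree: the same list is evaluated at different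
   assignments of degrees. *)
Definition mpol := seq (F * seq nat).
Implicit Types (p q : mpol) (L w u : seq nat) (i j k l : nat).

Definition pev (R : algType F) (b : nat -> R) p : R :=
  \sum_(cw <- p) cw.1 *: \prod_(i <- cw.2) b i.

Definition mapw (f : seq nat -> seq nat) p : mpol :=
  [seq (cw.1, f cw.2) | cw <- p].
Definition scalep (a : F) p : mpol := [seq (a * cw.1, cw.2) | cw <- p].
Definition wf L p := all (fun cw => perm_eq cw.2 L) p.
(** The specialization x_i = 1 in a unitary algebra, as long as every word keeps another letter
    ([pev_unit]). *)
Definition delp i p := mapw (seq.filter (predC1 i)) p.

(* Setting [x_k = 1] for [k] other than [i] and [j] turns a multilinear [p] into
   [pij i j p x_i x_j + pij j i p x_j x_i], and [ell eta i j p] is the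
   coefficient of [x_i x_j + eta x_j x_i] in the sum of the latter and [eta]
   times its reversal. *)
Definition before i j w := seq.filter (pred2 i j) w == [:: i; j].
Definition pij i j p : F := \sum_(cw <- p) cw.1 *+ before i j cw.2.
Definition ell eta i j p : F := pij i j p + sgn eta * pij j i p.

Section Evaluation.
Variable R : algType F.
Implicit Types b : nat -> R.

Lemma pev_cat b p q : pev b (p ++ q) = pev b p + pev b q.
Proof. by rewrite /pev big_cat. Qed.

Lemma pev_scale b a p : pev b (scalep a p) = a *: pev b p.
Proof.
by rewrite /pev big_map scaler_sumr; apply: eq_bigr => cw _; rewrite scalerA.
Qed.

Lemma pev_mull b u p :
  pev b (mapw (cat u) p) = (\prod_(i <- u) b i) * pev b p.
Proof.
rewrite /pev big_map mulr_sumr; apply: eq_bigr => cw _ /=.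
by rewrite big_cat /= scalerAr.
Qed.

Lemma pev_mulr b u p :
  pev b (mapw (cat^~ u) p) = pev b p * (\prod_(i <- u) b i).
Proof.
rewrite /pev big_map mulr_suml; apply: eq_bigr => cw _ /=.
by rewrite big_cat /= scalerAl.
Qed.

Lemma pev_ext L b b' p : wf L p -> {in L, b =1 b'} -> pev b p = pev b' p.
Proof.
move=> /allP wfp e; apply: eq_big_seq => cw /wfp pe; congr (_ *: _).
by apply: eq_big_seq => i iw; apply: e; rewrite -(perm_mem pe).
Qed.

Lemma prod_upd_notin b i x w :
  i \notin w -> \prod_(k <- w) upd b i x k = \prod_(k <- w) b k.
Proof.
move=> iw; apply: eq_big_seq => k kw; rewrite upd_neq //.
by apply: contraNneq iw => <-.
Qed.

Lemma prod_upd_lin b i a x y w : uniq w -> i \in w ->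
  \prod_(k <- w) upd b i (a *: x + y) k =
  a *: \prod_(k <- w) upd b i x k + \prod_(k <- w) upd b i y k.
Proof.
move=> uw /splitPr iw; case: iw uw => w1 w2.
rewrite cat_uniq /= => /and3P[_ /norP[iw1 _] /andP[iw2 _]].
rewrite !big_cat !big_cons /= !upd_eq !prod_upd_notin //.
by rewrite mulrDl mulrDr -scalerAl -scalerAr.
Qed.

Lemma pev_lin L b i a x y p : uniq L -> i \in L -> wf L p ->
  pev (upd b i (a *: x + y)) p = a *: pev (upd b i x) p + pev (upd b i y) p.
Proof.
move=> uL iL /allP wfp; rewrite /pev scaler_sumr -big_split /=.
apply: eq_big_seq => cw /wfp pe; rewrite prod_upd_lin ?(perm_uniq pe) //.
  by rewrite scalerDr !scalerA mulrC.
by rewrite (perm_mem pe).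
Qed.

End Evaluation.

Lemma wf_cat L p q : wf L (p ++ q) = wf L p && wf L q.
Proof. by rewrite /wf all_cat. Qed.

Lemma wf_scale L a p : wf L (scalep a p) = wf L p.
Proof. by rewrite /wf all_map. Qed.

Lemma wf_mapw L L' f p :
  (forall w, perm_eq w L -> perm_eq (f w) L') -> wf L p -> wf L' (mapw f p).
Proof.
move=> fP /allP wfp; rewrite /wf all_map; apply/allP => cw /wfp /=.
exact: fP.
Qed.

Lemma wf_perm L L' p : perm_eq L L' -> wf L p -> wf L' p.
Proof.
move=> LL' /allP wfp; apply/allP => cw /wfp /= pe; exact: perm_trans LL'.
Qed.

Lemma wf_del L i p : uniq L -> wf L p -> wf (rem i L) (delp i p).
Proof.
move=> uL; apply: wf_mapw => w pe; rewrite rem_filter //.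
exact: perm_filter.
Qed.

Lemma pij_cat i j p q : pij i j (p ++ q) = pij i j p + pij i j q.
Proof. by rewrite /pij big_cat. Qed.

Lemma pij_scale i j a p : pij i j (scalep a p) = a * pij i j p.
Proof.
by rewrite /pij big_map mulr_sumr; apply: eq_bigr => cw _; rewrite mulrnAr.
Qed.

Lemma ell_cat eta i j p q : ell eta i j (p ++ q) = ell eta i j p + ell eta i j q.
Proof. by rewrite /ell !pij_cat mulrDr addrACA. Qed.

Lemma ell_scale eta i j a p : ell eta i j (scalep a p) = a * ell eta i j p.
Proof. by rewrite /ell !pij_scale mulrDr mulrCA. Qed.

Lemma ell_sym eta i j p : ell eta j i p = sgn eta * ell eta i j p.
Proof. by rewrite /ell mulrDr mulrA sgn_sqr mul1r addrC. Qed.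

Lemma pij_mapw i j i' j' f p L : wf L p ->
  (forall w, perm_eq w L -> before i j (f w) = before i' j' w) ->
  pij i j (mapw f p) = pij i' j' p.
Proof.
move=> /allP wfp fP; rewrite /pij big_map; apply: eq_big_seq => cw /wfp /= pe.
by rewrite fP.
Qed.

Lemma before_rev i j w : before i j (rev w) = before j i w.
Proof.
rewrite /before filter_rev -[[:: i; j]]/(rev [:: j; i]) (inj_eq (can_inj revK)).
by congr (_ == _); apply: eq_filter => k; rewrite /= orbC.
Qed.

Lemma before_sum L i j w : uniq L -> i \in L -> j \in L -> i != j ->
  perm_eq w L -> before j i w = ~~ before i j w.
Proof.
move=> uL iL jL ij pe.
have pw : perm_eq (seq.filter (pred2 i j) w) [:: i; j].
  apply: uniq_perm; first by rewrite filter_uniq // (perm_uniq pe).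
    by rewrite /= inE ij.
  move=> k; rewrite mem_filter !inE (perm_mem pe).
  by apply: andb_idr => /orP[] /eqP ->.
rewrite /before; have -> : seq.filter (pred2 j i) w = seq.filter (pred2 i j) w.
  by apply: eq_filter => k; rewrite /= orbC.
case: (seq.filter (pred2 i j) w) pw => [|x [|y [|? ?]]] pw;
  try by have := perm_size pw.
have xin := perm_mem pw x; have yin := perm_mem pw y.
have := perm_uniq pw.
rewrite !inE ?eqxx ?orbT /= in xin yin *; rewrite !inE ij andbT => xy.
case/esym/orP: xin => /eqP ex; case/esym/orP: yin => /eqP ey; subst x y.
- by rewrite eqxx in xy.
- by rewrite eqxx !eqseq_cons [j == i]eq_sym (negPf ij).
- by rewrite eqxx !eqseq_cons [j == i]eq_sym (negPf ij).
- by rewrite eqxx in xy.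
Qed.

(** Every word has exactly one of the two orders of [i] and [j], so each coefficient is counted
    once. In particular the value does not depend on the pair. *)
Lemma ell_true L i j p : uniq L -> wf L p -> i \in L -> j \in L -> i != j ->
  ell true i j p = \sum_(cw <- p) cw.1.
Proof.
move=> uL /allP wfp iL jL ij; rewrite /ell /= mul1r /pij -big_split /=.
apply: eq_big_seq => cw /wfp /= pe.
by rewrite (before_sum uL iL jL ij pe) -mulrnDr; case: before.
Qed.

Lemma pij_rev i j p : pij i j (mapw rev p) = pij j i p.
Proof.
by rewrite /pij big_map; apply: eq_bigr => cw _ /=; rewrite before_rev.
Qed.

(** Reversal of words acts on [ell eta] by the scalar [sgn eta]; this is what allows the two signs
    to be treated separately. *)
Lemma ell_rev eta i j p : ell eta i j (mapw rev p) = sgn eta * ell eta i j p.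
Proof. by rewrite -ell_sym /ell !pij_rev. Qed.

Lemma before_filter (P : pred nat) i j w : P i -> P j ->
  before i j (seq.filter P w) = before i j w.
Proof.
move=> Pi Pj; rewrite /before -filter_predI; congr (_ == _).
by apply: eq_filter => k /=; case: eqP => [->|_]; case: eqP => [->|_]; rewrite ?Pi ?Pj.
Qed.

Lemma ell_del eta i j k p : k != i -> k != j ->
  ell eta i j (delp k p) = ell eta i j p.
Proof.
by move=> ki kj; rewrite /ell /pij !big_map; congr (_ + _ * _);
  apply: eq_bigr => cw _ /=; rewrite before_filter //= eq_sym.
Qed.

End Polynomials.

(** * Evaluation of the free algebra; identities of multilinear polynomials *)

Section FreeAlgebra.
Variables (F : fieldType) (G : finGroupType).
Implicit Types (B C : gsalg F G) (d : nat -> G * bool) (p q : mpol F).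

(** Unlike [eval_free], it has a true value on the empty word, so that the additivity of [mmap] and
    products in a ring are available. Both agree on elements without constant term
    ([evalu_free]). *)
Definition evalu B (phi : gsvar G -> B) : freealg F G -> unitization B :=
  mmap (in_alg (unitization B))
    (fun w : fmonom (gsvar G) => \prod_(x <- fmonom_val w) emb (phi x)).

Lemma evaluE B (phi : gsvar G -> B) f :
  evalu phi f = \sum_(w <- msupp f) mcoeff w f *: \prod_(x <- fmonom_val w) emb (phi x).
Proof. by rewrite /evalu mmapE; apply: eq_bigr => w _; rewrite mulr_algl. Qed.

Lemma emb_eval_word B (phi : gsvar G -> B) w : w != [::] ->
  \prod_(x <- w) emb (phi x) = emb (eval_word phi w).
Proof.
case: w => // x w _; rewrite big_cons /=.
elim: w (phi x) => [|y w IH] a; first by rewrite big_nil mulr1.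
by rewrite big_cons mulrA -embM IH.
Qed.

Lemma evalu_free B (phi : gsvar G -> B) f :
  mcoeff mone f = 0 -> evalu phi f = emb (eval_free phi f).
Proof.
move=> f0; rewrite evaluE /eval_free linear_sum; apply: eq_big_seq => w wf.
rewrite linearZ /= emb_eval_word //; apply: contraTneq wf => w0.
have -> : w = mone by apply/val_inj; rewrite /= w0 fm1.
by rewrite -mcoeff_neq0 f0 eqxx.
Qed.

Lemma IdP B f : Id B f <-> mcoeff mone f = 0 /\
  forall phi : gsvar G -> B, admissible phi -> evalu phi f = 0.
Proof.
split=> -[f0 If]; split=> // phi /If.
  by rewrite evalu_free // => ->; rewrite linear0.
by rewrite evalu_free // => e; apply: (@emb_inj F G B); rewrite e linear0.
Qed.

Lemma evaluD B (phi : gsvar G -> B) : {morph evalu phi : f g / f + g}.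
Proof. exact: mmapD. Qed.

Lemma evalu0 B (phi : gsvar G -> B) : evalu phi 0 = 0.
Proof. exact: mmap0. Qed.

Lemma evaluZ B (phi : gsvar G -> B) c f : evalu phi (c *: f) = c *: evalu phi f.
Proof.
rewrite /evalu (mmapEw (msuppZ_le _ _)) mmapE scaler_sumr.
by apply: eq_bigr => w _; rewrite !mulr_algl mcoeffZ scalerA.
Qed.

Lemma Id_lin B c f g : Id B f -> Id B g -> Id B (c *: f + g).
Proof.
move=> /IdP[f0 If] /IdP[g0 Ig]; apply/IdP; split.
  by rewrite mcoeffD mcoeffZ f0 g0 mulr0 addr0.
by move=> phi aphi; rewrite evaluD evaluZ If // Ig // scaler0 addr0.
Qed.

Lemma Id0 B : Id B 0.
Proof. by apply/IdP; split=> [|phi _]; rewrite ?mcoeff0 ?evalu0. Qed.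

Lemma IdZ B c f : Id B f -> Id B (c *: f).
Proof. by move=> If; rewrite -[_ *: _]addr0; apply: Id_lin => //; exact: Id0. Qed.

Lemma IdD B f g : Id B f -> Id B g -> Id B (f + g).
Proof. by move=> If Ig; rewrite -[f]scale1r; apply: Id_lin. Qed.

Lemma Id_sum B (I : Type) (r : seq I) (P : pred I) f :
  (forall i, P i -> Id B (f i)) -> Id B (\sum_(i <- r | P i) f i).
Proof. by move=> fP; elim/big_ind: _ => //; [exact: Id0 | exact: IdD]. Qed.

Definition fmon (w : seq (gsvar G)) : freealg F G := mkmalgU (FMonom w) 1.

Lemma prod_fvar w : \prod_(x <- w) fvar F x = fmon w.
Proof.
elim: w => [|x w IH].
  by rewrite big_nil /fmon -fmoneE.
rewrite big_cons IH /fvar /fmon [LHS]malgM_def fgmulUU mulr1 /= fmuE.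
by rewrite [mmul _ _]fmmulE.
Qed.

Lemma mcoeff_fmon w : w != [::] -> mcoeff mone (fmon w) = 0.
Proof.
move=> w0; rewrite mcoeffU; case: eqP => // e.
by case/negP: w0; rewrite -[w]/(fmonom_val (FMonom w)) e fm1.
Qed.

Lemma evalu_fmon B (phi : gsvar G -> B) w :
  evalu phi (fmon w) = \prod_(x <- w) emb (phi x).
Proof. by rewrite /evalu mmapU /= scale1r mul1r. Qed.

Definition fr d p : freealg F G :=
  \sum_(cw <- p) cw.1 *: \prod_(i <- cw.2) fvar F (i, d i).

Lemma evalu_fr B (phi : gsvar G -> B) d p :
  evalu phi (fr d p) = pev (fun i => emb (phi (i, d i))) p.
Proof.
rewrite /fr /pev (big_morph _ (evaluD phi) (evalu0 phi)).
apply: eq_bigr => cw _; rewrite evaluZ -(big_map (fun i => (i, d i)) xpredT).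
by rewrite prod_fvar evalu_fmon big_map.
Qed.

Definition ident B d p := forall b : nat -> B,
  (forall i, ghom (d i) (b i)) -> pev (fun i => emb (b i)) p = 0.

(** Zero has every type, so it is always an admissible value for the letters that are to be
    discarded. *)
Lemma ghom0 B t : ghom t (0 : B).
Proof.
split; first exact: gs_comp0 (gsalgP B) _.
have := gs_star_linear (gsalgP B) (-1) 0 0.
by rewrite scaler0 addr0 scaleN1r addNr oppr0 => ->; rewrite if_same.
Qed.

Lemma Id_fr B d p : all (fun cw => cw.2 != [::]) p ->
  Id B (fr d p) <-> ident B d p.
Proof.
move=> pn; split=> [/IdP[_ Ip] b hb | Ip].
  (* For each index only the variable of type [d] keeps its value; the variables of the other types
     go to 0, which makes [phi] admissible. *)
  pose phi (x : gsvar G) : B := if x.2 == d x.1 then b x.1 else 0.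
  have /Ip : admissible phi.
    move=> i g e; rewrite /phi /=; case: eqP => [e'|_]; last exact: (ghom0 B (g, e)).
    by have := hb i; rewrite -e'.
  rewrite evalu_fr => <-; congr (pev _ _); apply/funext => i /=.
  by rewrite /phi /= eqxx.
apply/IdP; split=> [|phi aphi].
  rewrite /fr raddf_sum /= big1_seq // => cw /andP[_ /(allP pn) cwn].
  rewrite mcoeffZ -(big_map (fun i => (i, d i)) xpredT) prod_fvar mcoeff_fmon.
    by rewrite mulr0.
  by case: cw.2 cwn.
rewrite evalu_fr; apply: Ip => i; have := aphi i (d i).1 (d i).2.
by rewrite -surjective_pairing.
Qed.

Lemma wf_nonempty L p : (0 < size L)%N -> wf L p -> all (fun cw => cw.2 != [::]) p.
Proof.
move=> L0 /allP wfp; apply/allP => cw /wfp /perm_size s.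
by rewrite -size_eq0 s -lt0n.
Qed.

Lemma var_ident B C d p L : (0 < size L)%N -> wf L p -> var C B ->
  ident C d p -> ident B d p.
Proof.
by move=> L0 /(wf_nonempty L0) pn CB /(Id_fr C d pn) /CB /(Id_fr B d pn).
Qed.

End FreeAlgebra.

(** * Closure properties of multilinear identities *)

Section IdentOps.
Variables (F : fieldType) (G : finGroupType) (B : gsalg F G).
Implicit Types (d : nat -> G * bool) (p q : mpol F) (L w u : seq nat)
  (i j k l z : nat) (t : G * bool).

Lemma ghom_lin t c (x y : B) : ghom t x -> ghom t y -> ghom t (c *: x + y).
Proof.
move=> [xt xs] [yt ys]; split; first exact: gs_compP (gsalgP B) _ _ _ _ xt yt.
rewrite (gs_star_linear (gsalgP B)) xs ys.
by case: t.2 => //; rewrite scalerN opprD.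
Qed.

Lemma ghom_sum t (I : Type) (r : seq I) (P : pred I) (f : I -> B) :
  (forall k : I, P k -> ghom t (f k)) -> ghom t (\sum_(k <- r | P k) f k).
Proof.
move=> fP; elim/big_ind: _ => //; first exact: ghom0.
by move=> x y xt yt; rewrite -[x]scale1r; apply: ghom_lin.
Qed.

Lemma ghomZ t c (x : B) : ghom t x -> ghom t (c *: x).
Proof. by move=> xt; rewrite -[_ *: _]addr0; apply: ghom_lin => //; exact: ghom0. Qed.

Lemma ghom_star t (x : B) : ghom t x -> gs_star x = sgn t.2 *: x.
Proof. by case=> _ ->; case: t.2; rewrite /= ?scale1r ?scaleN1r. Qed.

Lemma identL L d p (b : nat -> B) : wf L p -> ident B d p ->
  (forall i, i \in L -> ghom (d i) (b i)) -> pev (fun i => emb (b i)) p = 0.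
Proof.
move=> wfp Ip hb.
rewrite -(Ip (fun i => if i \in L then b i else 0)).
  by apply: pev_ext wfp _ => i iL; rewrite iL.
by move=> i; case: ifP => [/hb //|_]; exact: ghom0.
Qed.

Lemma ident_ext L d d' p : wf L p -> {in L, d =1 d'} ->
  ident B d p -> ident B d' p.
Proof.
by move=> wfp e Ip b hb; apply: (identL wfp Ip) => i iL; rewrite e.
Qed.

Lemma ident_cat d p q : ident B d p -> ident B d q -> ident B d (p ++ q).
Proof. by move=> Ip Iq b hb; rewrite pev_cat Ip // Iq // addr0. Qed.

Lemma ident_scale d a p : ident B d p -> ident B d (scalep a p).
Proof. by move=> Ip b hb; rewrite pev_scale Ip // scaler0. Qed.

Lemma ident_scaleV d a p : a != 0 -> ident B d (scalep a p) -> ident B d p.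
Proof.
move=> a0 Ip b hb; have /eqP := Ip b hb.
by rewrite pev_scale scaler_eq0 (negPf a0) => /eqP.
Qed.

Lemma ident_mull d p u : ident B d p -> ident B d (mapw (cat u) p).
Proof. by move=> Ip b hb; rewrite pev_mull Ip // mulr0. Qed.

Lemma ident_mulr d p u : ident B d p -> ident B d (mapw (cat^~ u) p).
Proof. by move=> Ip b hb; rewrite pev_mulr Ip // mul0r. Qed.

Lemma ustar_prod (b : nat -> B) d w : (forall i, ghom (d i) (b i)) ->
  ustar (\prod_(i <- w) emb (b i)) =
  (\prod_(i <- w) sgn (d i).2) *: \prod_(i <- rev w) emb (b i).
Proof.
move=> hb; elim: w => [|i w IH]; first by rewrite !big_nil ustar1 scale1r.
rewrite rev_cons -cats1 big_cat big_seq1 !big_cons ustarM IH /=.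
have -> : ustar (emb (b i)) = sgn (d i).2 *: emb (b i).
  by rewrite -linearZ -(ghom_star (hb i)).
by rewrite -scalerAl -scalerAr scalerA mulrC.
Qed.

(** The involution sends the value of a word to that of the reversed word times the product of the
    signs of its letters. By multilinearity this sign [s] is common to all words and can be divided
    out. *)
Lemma ident_rev L d p : wf L p -> ident B d p -> ident B d (mapw rev p).
Proof.
move=> /allP wfp Ip b hb.
pose s : F := \prod_(i <- L) sgn (d i).2.
have s0 : s != 0.
  rewrite prodf_seq_neq0; apply/allP => i _ /=.
  by case: (d i).2; rewrite /= ?oppr_eq0 oner_eq0.
suff /eqP : s *: pev (fun i => emb (b i)) (mapw rev p) = 0.
  by rewrite scaler_eq0 (negPf s0) => /eqP.
transitivity (ustar (pev (fun i => emb (b i)) p)); last by rewrite Ip // linear0.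
rewrite /pev big_map scaler_sumr linear_sum; apply: eq_big_seq => cw /wfp /= pe.
rewrite [RHS]linearZ /= (ustar_prod _ hb) !scalerA mulrC; congr (_ * _ *: _); rewrite /s.
by rewrite -(perm_big L pe).
Qed.

End IdentOps.

(** * Substitution of a word for a letter *)

Section Substitution.
Variable F : fieldType.
Implicit Types (p q : mpol F) (L w u : seq nat) (i j k l z : nat).

Definition subw j u w := flatten [seq if k == j then u else [:: k] | k <- w].

(* The polynomial [p(x_j o x_z) - x_z o p], where [o] is the Jordan product. It
   vanishes at [x_z = 1], so that only the functionals [ell] at pairs containing
   [z] survive. *)
Definition jdiff j z p : mpol F :=
  scalep 2^-1 (mapw (subw j [:: j; z]) p ++ mapw (subw j [:: z; j]) p) ++
  scalep (- 2^-1) (mapw (cat [:: z]) p ++ mapw (cat^~ [:: z]) p).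

Lemma subw_cat j u w1 w2 : subw j u (w1 ++ w2) = subw j u w1 ++ subw j u w2.
Proof. by rewrite /subw map_cat flatten_cat. Qed.

Lemma subw_notin j u w : j \notin w -> subw j u w = w.
Proof.
elim: w => // k w IH; rewrite inE negb_or eq_sym => /andP[kj jw].
by rewrite /subw /= (negPf kj) /= -/(subw j u w) IH.
Qed.

Lemma subw_split j u w1 w2 : uniq (w1 ++ j :: w2) ->
  subw j u (w1 ++ j :: w2) = w1 ++ u ++ w2.
Proof.
rewrite cat_uniq /= => /and3P[_ /norP[jw1 _] /andP[jw2 _]].
rewrite subw_cat subw_notin // -cat1s subw_cat.
by rewrite [subw j u w2]subw_notin // /subw /= eqxx cats0.
Qed.

Lemma prod_subw (R : algType F) (b : nat -> R) j u w : uniq w -> j \in w ->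
  \prod_(k <- subw j u w) b k =
  \prod_(k <- w) upd b j (\prod_(k <- u) b k) k.
Proof.
move=> uw jw; case/splitPr: jw uw => w1 w2 uw; rewrite subw_split //.
move: uw; rewrite cat_uniq /= => /and3P[_ /norP[jw1 _] /andP[jw2 _]].
by rewrite !big_cat big_cons /= upd_eq !prod_upd_notin.
Qed.

Lemma pev_subw (R : algType F) (b : nat -> R) L j u p :
  uniq L -> j \in L -> wf L p ->
  pev b (mapw (subw j u) p) = pev (upd b j (\prod_(k <- u) b k)) p.
Proof.
move=> uL jL /allP wfp; rewrite /pev big_map; apply: eq_big_seq => cw /wfp pe.
by rewrite prod_subw // ?(perm_uniq pe) // (perm_mem pe).
Qed.

Lemma perm_subw L j z u w : uniq L -> j \in L -> perm_eq u [:: j; z] ->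
  perm_eq w L -> perm_eq (subw j u w) (z :: L).
Proof.
move=> uL jL pu pe.
have uw : uniq w by rewrite (perm_uniq pe).
have jw : j \in w by rewrite (perm_mem pe).
rewrite -(perm_cons z) in pe; apply: (perm_trans _ pe).
case/splitPr: jw uw => w1 w2 uw; rewrite subw_split //.
by apply/seq.permP => P; rewrite !count_cat (seq.permP pu) /= count_cat /=; lia.
Qed.

Lemma wf_jdiff L j z p : uniq L -> j \in L -> wf L p -> wf (z :: L) (jdiff j z p).
Proof.
move=> uL jL wfp; rewrite /jdiff !(wf_cat, wf_scale) -!andbA; apply/and4P; split.
- by apply: wf_mapw wfp => w; apply: perm_subw.
- apply: wf_mapw wfp => w; apply: perm_subw => //.
  by apply/seq.permP => P /=; rewrite addnCA.
- by apply: wf_mapw wfp => w; rewrite perm_cons.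
- by apply: wf_mapw wfp => w pe; rewrite perm_catC /= perm_cons.
Qed.

(** Deleting [z] from the new word gives back the old one, and [z] is neither [k] nor [l]. *)
Lemma before_subw L j z k l u w : uniq L -> j \in L -> z \notin L ->
  k \in L -> l \in L -> u = [:: j; z] \/ u = [:: z; j] -> perm_eq w L ->
  before k l (subw j u w) = before k l w.
Proof.
move=> uL jL zL kL lL pu pe.
have uw : uniq w by rewrite (perm_uniq pe).
have jw : j \in w by rewrite (perm_mem pe).
have kz : k != z by apply: contraNneq zL => <-.
have lz : l != z by apply: contraNneq zL => <-.
rewrite -(@before_filter (predC1 z)) // -[RHS](@before_filter (predC1 z)) //.
congr before; case/splitPr: jw uw => w1 w2 uw; rewrite subw_split //.
rewrite !filter_cat /=; congr (_ ++ _).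
have jz : j != z by apply: contraNneq zL => <-.
rewrite jz -cat1s; congr (_ ++ _).
by case: pu => -> /=; rewrite jz eqxx.
Qed.

Definition swapn j z k := if k == j then z else if k == z then j else k.

Lemma swapn_inj j z : injective (swapn j z).
Proof.
apply: (@inv_inj _ _) => k; rewrite /swapn.
have [->|kj] := eqVneq k j; first by rewrite eqxx; case: eqVneq => [->|].
have [->|kz] := eqVneq k z; first by rewrite eqxx.
by rewrite (negPf kj) (negPf kz).
Qed.

Lemma filter_notin2 k l w : k \notin w -> l \notin w ->
  seq.filter (pred2 k l) w = [::].
Proof.
move=> kw lw; rewrite -(filter_pred0 w); apply: eq_in_filter => x xw /=.
by apply/norP; split; apply: contraTneq xw => ->.
Qed.

(** The letter [z] is inserted next to [j], so it stands to [l] as [j] does; [swapn] exchanges the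
    two names. *)
Lemma filter_subw_new L j z l u w : uniq L -> j \in L -> z \notin L ->
  l \in L -> l != j -> u = [:: j; z] \/ u = [:: z; j] -> perm_eq w L ->
  seq.filter (pred2 z l) (subw j u w) =
  map (swapn j z) (seq.filter (pred2 j l) w).
Proof.
move=> uL jL zL lL lj pu pe.
have uw : uniq w by rewrite (perm_uniq pe).
have jw : j \in w by rewrite (perm_mem pe).
have zw : z \notin w by rewrite (perm_mem pe).
have lz : l != z by apply: contraNneq zL => <-.
have jz : j != z by apply: contraNneq zL => <-.
have fE v : j \notin v -> z \notin v ->
    seq.filter (pred2 z l) v = map (swapn j z) (seq.filter (pred2 j l) v).
  elim: v => //= k v IH; rewrite !inE !negb_or => /andP[jk jv] /andP[zk zv].
  rewrite IH // ![k == _]eq_sym (negPf jk) (negPf zk) /=; case: eqP => //= <-.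
  by rewrite /swapn (negPf lj) (negPf lz).
case/splitPr: jw uw zw => w1 w2 uw; rewrite mem_cat inE !negb_or subw_split //.
move: uw; rewrite cat_uniq /= => /and3P[_ /norP[jw1 _] /andP[jw2 _]].
move=> /and3P[zw1 _ zw2]; rewrite !filter_cat /= eqxx map_cat /=.
rewrite -!fE // /swapn eqxx; congr (_ ++ _); rewrite -cat1s; congr (_ ++ _).
by case: pu => -> /=; rewrite (negPf jz) eqxx [j == l]eq_sym (negPf lj).
Qed.

End Substitution.

(** * The functionals of the Jordan difference *)

Section JordanDifference.
Variable F : fieldType.
Hypothesis charF : [pchar F] =i pred0.
Implicit Types (p q : mpol F) (L w u : seq nat) (i j k l z : nat).

Lemma two_neq0 : 2 != 0 :> F.
Proof.
by rewrite ((pcharf0P F).1 charF).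
Qed.

Lemma pij_jdiff k l j z p : pij k l (jdiff j z p) =
  2^-1 * (pij k l (mapw (subw j [:: j; z]) p) + pij k l (mapw (subw j [:: z; j]) p))
  - 2^-1 * (pij k l (mapw (cat [:: z]) p) + pij k l (mapw (cat^~ [:: z]) p)).
Proof. by rewrite /jdiff pij_cat !pij_scale !pij_cat mulNr. Qed.

Lemma before_consl k l z w : z != k -> z != l ->
  before k l (z :: w) = before k l w.
Proof. by move=> zk zl; rewrite /before /= (negPf zk) (negPf zl). Qed.

Lemma before_rconsl k l z w : z != k -> z != l ->
  before k l (w ++ [:: z]) = before k l w.
Proof.
by move=> zk zl; rewrite /before filter_cat /= (negPf zk) (negPf zl) cats0.
Qed.

Lemma tot_jdiff j z p : \sum_(cw <- jdiff j z p) cw.1 = 0.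
Proof.
rewrite /jdiff /scalep /mapw !(map_cat, big_cat, big_map) /= -!mulr_sumr !mulNr.
by rewrite -opprD subrr.
Qed.

Variables (L : seq nat) (j z : nat) (p : mpol F).
Hypotheses (uL : uniq L) (jL : j \in L) (zL : z \notin L) (wfp : wf L p).

Let neqz k : k \in L -> z != k.
Proof. by move=> kL; apply: contraNneq zL => ->. Qed.

Lemma pij_const k l f (b : bool) :
  (forall w, perm_eq w L -> before k l (f w) = b) ->
  pij k l (mapw f p) = (\sum_(cw <- p) cw.1) *+ b.
Proof.
move=> fb; rewrite /pij big_map -sumrMnl; apply: eq_big_seq => cw /(allP wfp) pe.
by rewrite fb.
Qed.

(** Inserting [z] does not alter the order of old letters, so the four terms agree, with weights
    1/2, 1/2, -1/2, -1/2. *)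
Lemma pij_jdiff_old k l : k \in L -> l \in L -> pij k l (jdiff j z p) = 0.
Proof.
move=> kL lL; rewrite pij_jdiff.
rewrite !(@pij_mapw _ k l k l _ p L) ?subrr // => w pe.
- by apply: before_rconsl; exact: neqz.
- by apply: before_consl; exact: neqz.
- by apply: (before_subw (z := z) uL) => //; right.
- by apply: (before_subw (z := z) uL) => //; left.
Qed.

Lemma ell_jdiff_true k l : k \in z :: L -> l \in z :: L -> k != l ->
  ell true k l (jdiff j z p) = 0.
Proof.
move=> kL lL kl; rewrite (@ell_true _ (z :: L)) ?tot_jdiff //.
  by rewrite /= zL.
exact: wf_jdiff.
Qed.

Lemma ell_jdiff_old eta k l : k \in L -> l \in L ->
  ell eta k l (jdiff j z p) = 0.
Proof. by move=> kL lL; rewrite /ell !pij_jdiff_old // mulr0 addr0. Qed.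

Lemma half2 (x : F) : 2^-1 * (x + x) = x.
Proof. by rewrite -mulr2n -[x *+ 2]mulr_natl mulKf // two_neq0. Qed.

Lemma before_subw_new l u w : l \in L -> l != j ->
  u = [:: j; z] \/ u = [:: z; j] -> perm_eq w L ->
  before z l (subw j u w) = before j l w.
Proof.
move=> lL lj pu pe; rewrite /before (filter_subw_new uL) //.
have -> : [:: z; l] = map (swapn j z) [:: j; l].
  by rewrite /= /swapn eqxx (negPf lj) eq_sym (negPf (neqz lL)).
by rewrite (inj_eq (inj_map (@swapn_inj j z))).
Qed.

Lemma before_subw_new' l u w : l \in L -> l != j ->
  u = [:: j; z] \/ u = [:: z; j] -> perm_eq w L ->
  before l z (subw j u w) = before l j w.
Proof.
move=> lL lj pu pe; rewrite /before.
have sym x y v : seq.filter (pred2 x y) v = seq.filter (pred2 y x) v :> seq nat.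
  by apply: eq_filter => k; rewrite /= orbC.
rewrite sym (filter_subw_new uL) // [X in _ = (X == _)]sym.
have -> : [:: l; z] = map (swapn j z) [:: l; j].
  by rewrite /= /swapn eqxx (negPf lj) eq_sym (negPf (neqz lL)).
by rewrite (inj_eq (inj_map (@swapn_inj j z))).
Qed.

(** In the substituted words [z] takes the place of [j]. The products with [z] in front and behind
    contribute half the sum of the coefficients to each of the two orders, which cancels for the
    sign -. *)
Lemma ell_jdiff_new l : l \in L -> l != j ->
  ell false z l (jdiff j z p) = ell false j l p.
Proof.
move=> lL lj; rewrite /ell !pij_jdiff.
rewrite !(@pij_mapw _ z l j l (subw j _) p L) //; last first.
- by move=> w pe; apply: before_subw_new => //; left.
- by move=> w pe; apply: before_subw_new => //; right.
rewrite !(@pij_mapw _ l z l j (subw j _) p L) //; last first.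
- by move=> w pe; apply: before_subw_new' => //; left.
- by move=> w pe; apply: before_subw_new' => //; right.
have zn w : perm_eq w L -> z \notin w by move=> pe; rewrite (perm_mem pe).
have fl w : perm_eq w L -> seq.filter (pred2 z l) w = [:: l].
  move=> pe; have uw : uniq w by rewrite (perm_uniq pe).
  rewrite -(filter_pred1_uniq uw) ?(perm_mem pe) //; apply: eq_in_filter => k kw /=.
  by case: (k == l); rewrite ?orbT // orbF; apply: contraNF (zn _ pe) => /eqP <-.
have fl' w : perm_eq w L -> seq.filter (pred2 l z) w = [:: l].
  by move=> /fl <-; apply: eq_filter => k; rewrite /= orbC.
have bz w : perm_eq w L -> [/\ before z l (z :: w), before z l (w ++ [:: z]) = false,
    before l z (z :: w) = false & before l z (w ++ [:: z])].
  move=> pe; rewrite /before !filter_cat /= !eqxx ?orbT fl // fl' //= .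
  by rewrite !eqseq_cons eq_sym (negPf (neqz lL)) !eqxx.
pose T := \sum_(cw <- p) cw.1.
have e1 : pij z l (mapw (cat [:: z]) p) = T *+ true by apply: pij_const => w /bz[].
have e2 : pij z l (mapw (cat^~ [:: z]) p) = T *+ false by apply: pij_const => w /bz[].
have e3 : pij l z (mapw (cat [:: z]) p) = T *+ false by apply: pij_const => w /bz[].
have e4 : pij l z (mapw (cat^~ [:: z]) p) = T *+ true by apply: pij_const => w /bz[].
by rewrite e1 e2 e3 e4 !half2 !mulr0n addr0 add0r /= !mulN1r opprB addrA subrK.
Qed.

(** For this pair all four terms are constant: each order of [z] and [j] receives half the sum of
    the coefficients from the substitution and loses as much from the outer products. *)
Lemma ell_jdiff_zj : ell false z j (jdiff j z p) = 0.
Proof.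
have jz := neqz jL.
have f2 k l w1 w2 v : k \notin w1 -> l \notin w1 -> k \notin w2 -> l \notin w2 ->
    seq.filter (pred2 k l) (w1 ++ v ++ w2) = seq.filter (pred2 k l) v.
  by move=> k1 l1 k2 l2; rewrite !filter_cat (filter_notin2 k1 l1) (filter_notin2 k2
    l2) cats0.
have bP w : perm_eq w L -> exists w1 w2, [/\ w = w1 ++ j :: w2,
    j \notin w1, z \notin w1, j \notin w2 & z \notin w2] /\ uniq w.
  move=> pe; have uw : uniq w by rewrite (perm_uniq pe).
  have zw : z \notin w by rewrite (perm_mem pe).
  have jw : j \in w by rewrite (perm_mem pe).
  case/splitPr: jw uw zw => w1 w2 uw; rewrite mem_cat inE !negb_or.
  move=> /and3P[zw1 _ zw2]; exists w1, w2; split=> //; split=> //.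
    by move: uw; rewrite cat_uniq /= => /and3P[_ /norP[jw1 _] _].
  by move: uw; rewrite cat_uniq /= => /and3P[_ _ /andP[]].
have bE w : perm_eq w L ->
  [/\ before z j (subw j [:: j; z] w) = false, before z j (subw j [:: z; j] w),
      before z j (z :: w) & before z j (w ++ [:: z]) = false] /\
  [/\ before j z (subw j [:: j; z] w), before j z (subw j [:: z; j] w) = false,
      before j z (z :: w) = false & before j z (w ++ [:: z])].
  move=> /bP [w1 [w2 [[-> j1 z1 j2 z2] uw]]]; rewrite !subw_split // /before.
  rewrite !f2 //.
  have fzj : seq.filter (pred2 z j) (w1 ++ j :: w2) = [:: j].
    by rewrite -[j :: w2]/([:: j] ++ w2) f2 //= eqxx orbT.
  have fjz : seq.filter (pred2 j z) (w1 ++ j :: w2) = [:: j].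
    by rewrite -[j :: w2]/([:: j] ++ w2) f2 //= eqxx.
  have zj : j != z by rewrite eq_sym.
  have -> v : seq.filter (pred2 z j) (v ++ [:: z]) = seq.filter (pred2 z j) v ++ [:: z].
    by rewrite filter_cat /= eqxx.
  have -> v : seq.filter (pred2 j z) (v ++ [:: z]) = seq.filter (pred2 j z) v ++ [:: z].
    by rewrite filter_cat /= eqxx orbT.
  have -> v : seq.filter (pred2 z j) (z :: v) = z :: seq.filter (pred2 z j) v.
    by rewrite /= eqxx.
  have -> v : seq.filter (pred2 j z) (z :: v) = z :: seq.filter (pred2 j z) v.
    by rewrite /= eqxx orbT.
  rewrite fzj fjz /= !eqxx ?orbT /= !eqseq_cons ?eqxx (negPf jz) ?(negPf zj)
    ?fzj ?fjz ?eqxx; do !split.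
rewrite /ell !pij_jdiff.
rewrite (@pij_const z j (subw j [:: j; z]) false); last by move=> w /bE[[]].
rewrite (@pij_const z j (subw j [:: z; j]) true); last by move=> w /bE[[]].
rewrite (@pij_const z j (cat [:: z]) true); last by move=> w /bE[[]].
rewrite (@pij_const z j (cat^~ [:: z]) false); last by move=> w /bE[[]].
rewrite (@pij_const j z (subw j [:: j; z]) true); last by move=> w /bE[_ []].
rewrite (@pij_const j z (subw j [:: z; j]) false); last by move=> w /bE[_ []].
rewrite (@pij_const j z (cat [:: z]) false); last by move=> w /bE[_ []].
rewrite (@pij_const j z (cat^~ [:: z]) true); last by move=> w /bE[_ []].
by rewrite !mulr0n !addr0 !add0r !subrr mulr0 addr0.
Qed.

End JordanDifference.

Section IdentJordanDifference.
Variables (F : fieldType) (G : finGroupType) (B : gsalg F G).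
Hypothesis charF : [pchar F] =i pred0.
Implicit Types (d : nat -> G * bool) (p : mpol F) (L : seq nat) (j z : nat).

(** The involution exchanges the two products of symmetric elements; hence the symmetrization,
    without which a letter of type [one_t] could not be replaced. *)
Lemma ghom_jordan (x y : B) : ghom one_t x -> ghom one_t y ->
  ghom one_t (2^-1 *: (gs_mul x y + gs_mul y x)).
Proof.
move=> [x1 xs] [y1 ys]; apply: ghomZ; split; last first.
  have starD u v : gs_star (u + v : B) = gs_star u + gs_star v.
    by have := gs_star_linear (gsalgP B) 1 u v; rewrite !scale1r.
  by rewrite starD !(gs_starM (gsalgP B)) xs ys /= addrC.
rewrite -[gs_mul x y]scale1r; apply: gs_compP (gsalgP B) _ _ _ _ _ _.
  by have := gs_compM (gsalgP B) x1 y1; rewrite mulg1.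
by have := gs_compM (gsalgP B) y1 x1; rewrite mulg1.
Qed.

Lemma ident_jdiff L d j z p : uniq L -> j \in L -> wf L p ->
  d j = one_t -> d z = one_t -> ident B d p -> ident B d (jdiff j z p).
Proof.
move=> uL jL wfp dj dz Ip b hb.
have pev0 : pev (upd (fun i => emb (b i)) j 0) p = 0.
  have := pev_lin (fun i => emb (b i)) (-1) 0 0 uL jL wfp.
  by rewrite scaler0 addr0 scaleN1r addNr.
pose x : B := 2^-1 *: (gs_mul (b j) (b z) + gs_mul (b z) (b j)).
have /Ip : forall i, ghom (d i) (upd b j x i).
  move=> i; rewrite /upd; case: eqP => // ->; rewrite dj.
  by apply: ghom_jordan; [rewrite -dj; exact: hb | rewrite -dz; exact: hb].
(* The summand 0 gives the second term the shape required by [pev_lin], which is then applied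
   twice. *)
have -> : (fun i => emb (upd b j x i)) = upd (fun i => emb (b i)) j
    (2^-1 *: (emb (b j) * emb (b z)) + (2^-1 *: (emb (b z) * emb (b j)) + 0)).
  apply/funext => i; rewrite /upd; case: eqP => // _.
  by rewrite addr0 -scalerDr -!embM linearZ linearD.
rewrite !(pev_lin _ _ _ _ uL jL wfp) pev0 addr0 => e.
rewrite /jdiff pev_cat !pev_scale !pev_cat !(pev_subw _ _ uL jL wfp).
rewrite pev_mull pev_mulr !(Ip b hb) mulr0 mul0r addr0 scaler0 addr0.
by rewrite scalerDr !big_cons !big_nil !mulr1.
Qed.

End IdentJordanDifference.

(** * The unit is symmetric of degree 1 *)

Section Unit.
Variables (F : fieldType) (G : finGroupType) (A : gsalg F G).

Lemma gs_comp_uniq g h (x : A) : g != h -> gs_comp g x -> gs_comp h x -> x = 0.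
Proof.
move=> gh xg xh.
pose f k : A := if k == g then x else if k == h then - x else 0.
have fP k : gs_comp k (f k).
  rewrite /f; case: eqP => [->|_] //; case: eqP => [->|_];
    last exact: gs_comp0 (gsalgP A) _.
  rewrite -[- x]addr0 -scaleN1r; apply: gs_compP (gsalgP A) _ _ _ _ xh _.
  exact: gs_comp0 (gsalgP A) _.
have := gs_comp_direct (gsalgP A) fP _ g; rewrite /f eqxx; apply.
rewrite (bigD1 g) //= eqxx (bigD1 h) /=; last by rewrite eq_sym.
rewrite eq_sym (negPf gh) eqxx big1 ?addr0 ?subrr //.
by move=> k /andP[/negPf -> /negPf ->].
Qed.

(** The image of [e] under the involution is again a unit, hence equals [e]. For the degree, the
    component of [e] of degree 1 is shown to be a left unit as well, so that it equals [e]. *)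
Lemma unit_ghom : unitary A ->
  exists e : A, ghom one_t e /\ forall x, gs_mul e x = x /\ gs_mul x e = x.
Proof.
case=> e eP; exists e; split=> //; split; last first.
  have h : gs_mul e (gs_star e) = gs_star e := (eP _).1.
  by rewrite /= -[RHS](gs_starK (gsalgP A)) -{2}h (gs_starM (gsalgP A))
    (gs_starK (gsalgP A)) h.
have [f fP ef] := gs_comp_sum (gsalgP A) e.
suff fe x : gs_mul (f 1%g) x = x.
  by rewrite -(fe e) (eP _).2; exact: fP.
have mulDl := gs_mulDl (gsalgP A); have mulDr := gs_mulDr (gsalgP A).
have suml (J : finType) (h : J -> A) y : gs_mul (\sum_j h j) y = \sum_j gs_mul (h j) y.
  by apply: (big_morph (fun u : A => gs_mul u y)) => [u v|]; rewrite ?mulDl ?gs_mul0l.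
have sumr (J : finType) (h : J -> A) y : gs_mul y (\sum_j h j) = \sum_j gs_mul y (h j).
  by apply: (big_morph (fun u : A => gs_mul y u)) => [u v|]; rewrite ?mulDr ?gs_mul0r.
have fh h y : gs_comp h y -> gs_mul (f 1%g) y = y.
  move=> yh.
  (* The [u k] are the homogeneous components of [e y - y], which is 0; the component of degree [h]
     says that [f 1] fixes [y]. *)
  pose u k : A := gs_mul (f (k * h^-1)%g) y - (if k == h then y else 0).
  have uP k : gs_comp k (u k).
    have yk : gs_comp k (if k == h then y else 0 : A).
      by case: eqP => [->|_] //; exact: gs_comp0 (gsalgP A) _.
    rewrite /u addrC -scaleN1r; apply: gs_compP (gsalgP A) _ _ _ _ yk _.
    by have := gs_compM (gsalgP A) (fP (k * h^-1)%g) yh; rewrite mulgKV.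
  have /(_ _ h) := gs_comp_direct (gsalgP A) uP.
  rewrite /u eqxx mulgV => /(_ _)/eqP; rewrite subr_eq0 => H; apply/eqP/H.
  rewrite sumrB -big_mkcond big_pred1_eq.
  rewrite (reindex_inj (mulIg h)) /=.
  under eq_bigr do rewrite mulgK.
  by rewrite -suml -ef (eP _).1 subrr.
have [k kP ->] := gs_comp_sum (gsalgP A) x.
by rewrite sumr; apply: eq_bigr => g _; apply: fh (kP g).
Qed.

End Unit.

(** * Multilinear identities of unitary algebras *)

Section Criterion.
Variables (F : fieldType) (G : finGroupType).
Hypothesis charF : [pchar F] =i pred0.
Implicit Types (A B C : gsalg F G) (d : nat -> G * bool) (p q : mpol F)
  (L w u : seq nat) (i j k l z : nat) (s t : G * bool) (eta : bool).

Definition bident A s t eta := forall x y : A, ghom s x -> ghom t y ->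
  gs_mul x y + sgn eta *: gs_mul y x = 0.

(** All letters other than [i] and [j] may be specialized to 1. Only such pairs are tested by the
    functionals [ell]. *)
Definition nonunit_in d L i j :=
  forall k, k \in L -> d k != one_t -> k = i \/ k = j.

(* If all the specializations [x_i = 1] are identities, then [p] is a proper
   polynomial modulo the identities of [A]. *)
Definition proper3_trivial A := forall d L p, uniq L -> wf L p ->
  (2 < size L)%N -> (forall i, i \in L -> d i = one_t -> ident A d (delp i p)) ->
  ident A d p.

Lemma pev_two (R : algType F) (b : nat -> R) L i j p :
  uniq L -> wf L p -> i \in L -> j \in L -> i != j ->
  pev b (mapw (seq.filter (pred2 i j)) p) =
  pij i j p *: (b i * b j) + pij j i p *: (b j * b i).
Proof.
move=> uL /allP wfp iL jL ij; rewrite /pev /pij big_map !scaler_suml -big_split.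
apply: eq_big_seq => cw /wfp pe /=.
have := before_sum uL iL jL ij pe.
case: (boolP (before i j cw.2)) => [/eqP -> -> | _ bji].
  by rewrite mulr1n mulr0n scale0r addr0 !big_cons big_nil mulr1.
rewrite bji mulr1n mulr0n scale0r add0r.
have -> : seq.filter (pred2 i j) cw.2 = seq.filter (pred2 j i) cw.2.
  by apply: eq_filter => k; rewrite /= orbC.
by move/eqP: bji => ->; rewrite !big_cons big_nil mulr1.
Qed.

(** Each word must keep a letter of [S]: the empty product is the unit of [unitization A], which
    differs from [emb e]. *)
Lemma pev_unit A (e : A) (b : nat -> A) (S : pred nat) p :
  (forall x, gs_mul e x = x /\ gs_mul x e = x) ->
  (forall k, ~~ S k -> b k = e) ->
  all (fun cw => has S cw.2) p ->
  pev (fun i => emb (b i)) p = pev (fun i => emb (b i)) (mapw (seq.filter S) p).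
Proof.
move=> eP bS /allP pS; rewrite /pev big_map; apply: eq_big_seq => cw /pS /= hS.
have e1 x : emb e * emb x = emb x by rewrite -embM (eP x).1.
have e2 x : emb x * emb e = emb x by rewrite -embM (eP x).2.
have fw w : emb e * \prod_(i <- w) emb (b i) = emb e * \prod_(i <- seq.filter S w) emb
  (b i).
  elim: w => //= k w IH; rewrite big_cons; case: (boolP (S k)) => Sk.
    by rewrite big_cons -[emb (b k)]e2 -!mulrA IH.
  by rewrite bS // mulrA e1 IH.
have ne w : w != [::] -> \prod_(i <- w) emb (b i) = emb e * \prod_(i <- w) emb (b i).
  by case: w => // k w _; rewrite big_cons mulrA e1.
congr (_ *: _); rewrite ne; last by case: cw.2 hS.
by rewrite fw -ne // -has_filter.
Qed.

(** Specializing the other letters to the unit leaves a xy + b yx = 0, where a and b are the two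
    [pij]. The reversed identity gives b xy + a yx = 0, and the sum with weight [sgn eta] is
    [ell eta i j p] times xy + eta yx. *)
Lemma ident_bident L A d p i j eta : unitary A -> uniq L -> wf L p ->
  i \in L -> j \in L -> i != j -> nonunit_in d L i j -> ident A d p ->
  ell eta i j p != 0 -> bident A (d i) (d j) eta.
Proof.
move=> /unit_ghom[e [eh eP]] uL wfp iL jL ij dij Ip ellp x y hx hy.
pose b k := if k == i then x else if k == j then y else e.
have hb k : k \in L -> ghom (d k) (b k).
  rewrite /b => kL; case: eqP => [-> //|/eqP ki]; case: eqP => [-> //|/eqP kj].
  case: (eqVneq (d k) one_t) => [-> //|dk].
  by case: (dij k kL dk) => e'; rewrite e' eqxx in ki kj.
have be k : ~~ pred2 i j k -> b k = e.
  by rewrite /= /b negb_or => /andP[/negPf -> /negPf ->].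
have bi : b i = x by rewrite /b eqxx.
have bj : b j = y by rewrite /b eq_sym (negPf ij) eqxx.
have key q : wf L q -> ident A d q ->
    pij i j q *: gs_mul x y + pij j i q *: gs_mul y x = 0.
  move=> wfq Iq; apply: (@emb_inj F G A).
  rewrite linear0 -(identL wfq Iq hb) (pev_unit eP be).
    by rewrite (pev_two _ uL wfq iL jL ij) bi bj -!embM linearD !linearZ.
  apply/allP => cw /(allP wfq) pe; apply/hasP; exists i; last by rewrite /= eqxx.
  by rewrite (perm_mem pe).
have e1 := key _ wfp Ip.
have wfr : wf L (mapw rev p).
  by apply: wf_mapw wfp => w; rewrite perm_rev.
have := key _ wfr (ident_rev wfp Ip); rewrite !pij_rev => e2.
have : pij i j p *: gs_mul x y + pij j i p *: gs_mul y x +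
  sgn eta *: (pij j i p *: gs_mul x y + pij i j p *: gs_mul y x) = 0.
  by rewrite e1 e2 scaler0 addr0.
suff -> : pij i j p *: gs_mul x y + pij j i p *: gs_mul y x +
  sgn eta *: (pij j i p *: gs_mul x y + pij i j p *: gs_mul y x) =
  ell eta i j p *: (gs_mul x y + sgn eta *: gs_mul y x).
  by move/eqP; rewrite scaler_eq0 (negPf ellp) => /eqP.
rewrite !scalerDr !scalerA /ell !scalerDl mulrDl mulrAC sgn_sqr mul1r.
by rewrite [pij i j p * _]mulrC scalerDl [LHS](AC (2*2) (1*3*(4*2))).
Qed.

(* The converse of [ident_bident], by descending to specializations of degree 2. *)
Lemma bident_ident L A d p : proper3_trivial A -> uniq L -> wf L p ->
  (1 < size L)%N ->
  (forall i j eta, i \in L -> j \in L -> i != j -> nonunit_in d L i j ->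
    ell eta i j p != 0 -> bident A (d i) (d j) eta) ->
  ident A d p.
Proof.
move=> QA; have [n] := ubnP (size L); elim: n => // n IH in L p *.
rewrite ltnS => sL uL wfp L2 H.
have [L3|L3] := ltnP 2 (size L).
  apply: (QA _ L) => // i iL di; apply: (IH (rem i L)).
  - by rewrite size_rem //; case: size sL L2 => // m; rewrite /= ltnS.
  - exact: rem_uniq.
  - exact: wf_del.
  - by rewrite size_rem //; case: size L3.
  move=> k l eta; rewrite !mem_rem_uniq // !inE => /andP[ki kL] /andP[li lL] kl dkl.
  rewrite ell_del ?[i == _]eq_sym //; apply: H => // m mL dm; apply: dkl => //.
  by rewrite mem_rem_uniq // !inE mL andbT; apply: contraNneq dm => ->; rewrite di.
have : size L = 2 by apply/eqP; rewrite eqn_leq L3 L2.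
case: L uL wfp H {sL L2 L3} => [|i [|j []]] // uL wfp H _ b hb.
have ij : i != j by move: uL; rewrite /= inE; case/andP.
have iL : i \in [:: i; j] by rewrite inE eqxx.
have jL : j \in [:: i; j] by rewrite !inE eqxx orbT.
have -> : p = mapw (seq.filter (pred2 i j)) p.
  rewrite /mapw -[LHS]map_id; apply/eq_in_map => cw /(allP wfp) pe.
  rewrite (_ : seq.filter _ _ = cw.2) -?surjective_pairing //.
  by apply/all_filterP/allP => k; rewrite (perm_mem pe) !inE.
rewrite (pev_two _ uL wfp iL jL ij) -!embM -!linearZ -linearD.
suff -> : pij i j p *: gs_mul (b i) (b j) + pij j i p *: gs_mul (b j) (b i) = 0 by
  exact: linear0.
have Ht eta : ell eta i j p *: (gs_mul (b i) (b j) + sgn eta *: gs_mul (b j) (b i)) = 0.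
  case: (eqVneq (ell eta i j p) 0) => [->|e]; first by rewrite scale0r.
  rewrite (H i j eta iL jL ij _ e) ?scaler0 // => k.
  by rewrite !inE => /orP[] /eqP -> _; [left | right].
(* Twice the value is the sum of its parts of sign + and -, both of which vanish by [Ht]. *)
apply: (scalerI (two_neq0 charF)); rewrite scaler0.
have := congr2 +%R (Ht true) (Ht false); rewrite addr0 => <-.
rewrite /ell /= mul1r mulN1r scale1r scaleN1r !scalerDr !scalerN !scalerA.
set a := pij i j p; set b' := pij j i p.
rewrite [RHS](AC (2*2) ((1*3)*(2*4))) /= -scalerDl -scalerBl; congr (_ *: _ + _ *: _).
  by rewrite addrACA subrr addr0 mulr_natl mulr2n.
by rewrite opprB addrC addrA subrK mulr_natl mulr2n.
Qed.

End Criterion.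

(** * Identities of nonunitary subvarieties *)

Section Detection.
Variables (F : fieldType) (G : finGroupType).
Hypothesis charF : [pchar F] =i pred0.
Implicit Types (A B C : gsalg F G) (d : nat -> G * bool) (p q : mpol F)
  (L X w u : seq nat) (i j k l z m : nat) (s t : G * bool) (eta : bool).

(** Twice the projection to the part of sign [eta] under reversal: it preserves identities and kills
    the functionals of the opposite sign. *)
Definition symp eta p : mpol F := p ++ scalep (sgn eta) (mapw rev p).

(* When the letters of [X] are 1, this is a multiple of [x_i x_j + eta x_j x_i];
   the word [X] serves the algebras without unit. *)
Definition spoly X i j eta : mpol F :=
  symp eta [:: (1, X ++ [:: i; j]); (sgn eta, X ++ [:: j; i])].

Lemma wf_symp L eta p : wf L p -> wf L (symp eta p).
Proof.
move=> wfp; rewrite /symp wf_cat wf_scale wfp /=.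
by apply: wf_mapw wfp => w; rewrite perm_rev.
Qed.

Lemma ident_symp B L d eta p : wf L p -> ident B d p -> ident B d (symp eta p).
Proof.
move=> wfp Ip; apply: ident_cat => //; apply: ident_scale.
exact: ident_rev wfp Ip.
Qed.

Lemma ell_symp e eta i j p :
  ell e i j (symp eta p) = if e == eta then 2 * ell e i j p else 0.
Proof.
rewrite /symp ell_cat ell_scale ell_rev mulrA.
case: eqP => [->|]; first by rewrite sgn_sqr mul1r mulr_natl mulr2n.
by case: e; case: eta => // _; rewrite /= ?mulr1 ?mul1r mulN1r subrr.
Qed.

Lemma wf_spoly X i j eta : wf (i :: j :: X) (spoly X i j eta).
Proof.
apply: wf_symp; rewrite /wf /= andbT; apply/andP; split.
  by rewrite perm_catC.
by rewrite perm_catC /=; apply/seq.permP => P /=; rewrite addnCA.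
Qed.

(** The two words contribute 1 each, and the symmetrization doubles the result. *)
Lemma ell_spoly X i j eta : uniq (i :: j :: X) ->
  ell eta i j (spoly X i j eta) = 4.
Proof.
rewrite /= inE negb_or => /and3P[/andP[ij iX] jX uX].
rewrite ell_symp eqxx /ell /pij !big_cons !big_nil !addr0 /= /before.
rewrite !filter_cat (filter_notin2 iX jX) (filter_notin2 jX iX) /=.
rewrite !eqxx ?orbT /= !eqseq_cons !eqxx [j == i]eq_sym (negPf ij) /=.
rewrite !mulr1n !mulr0n addr0 add0r sgn_sqr -mulr2n -natrM.
by [].
Qed.

Lemma ell_spoly_neq X i j eta k l :
  ell (~~ eta) k l (spoly X i j eta) = 0.
Proof. by rewrite ell_symp; case: eta. Qed.

(** The two words with opposite coefficients differ only in the order of [i] and [j], so for any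
    other pair they cancel. *)
Lemma ell_spoly_false X i j k l : uniq (i :: j :: X) -> k != l ->
  (k, l) != (i, j) -> (k, l) != (j, i) ->
  ell false k l (spoly X i j false) = 0.
Proof.
rewrite /= inE negb_or => /and3P[/andP[ij iX] jX uX] kl kl1 kl2.
rewrite ell_symp eqxx /ell /pij !big_cons !big_nil !addr0 /= /before.
have swap (P : pred nat) : ~~ (P i && P j) ->
    seq.filter P (X ++ [:: j; i]) = seq.filter P (X ++ [:: i; j]).
  by rewrite !filter_cat /=; case: (P i); case: (P j).
have nij : ~~ (pred2 k l i && pred2 k l j).
  apply/negP => /andP[/orP[] /eqP e1 /orP[] /eqP e2]; subst.
  - by rewrite eqxx in ij.
  - by rewrite eqxx in kl1.
  - by rewrite eqxx in kl2.
  - by rewrite eqxx in ij.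
rewrite !swap //; last by move: nij; rewrite /= ![(_ == l) || _]orbC.
move: (_ == [:: k; l]) (_ == [:: l; k]) => [] [];
  by rewrite /= ?mulr1n ?mulr0n ?addr0 ?subrr ?mulr0 ?addr0 ?mulr0.
Qed.

Lemma ident_rename B L d d' (f : nat -> nat) p : wf L p ->
  (forall k, k \in L -> d' (f k) = d k) ->
  ident B d p -> ident B d' (mapw (map f) p).
Proof.
move=> wfp df Ip b hb.
have -> : pev (fun i => emb (b i)) (mapw (map f) p) = pev (fun i => emb (b (f i))) p.
  by rewrite /pev big_map; apply: eq_bigr => cw _; rewrite big_map.
by apply: (identL wfp Ip) => k kL; rewrite -df.
Qed.

Lemma mapw_spoly (f : nat -> nat) X i j eta :
  mapw (map f) (spoly X i j eta) = spoly (map f X) (f i) (f j) eta.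
Proof. by rewrite /spoly /symp /mapw /scalep /= !map_rev !map_cat. Qed.

Definition dtwo s t k := if k == 0%N then s else if k == 1%N then t else @one_t G.

Definition sident B m s t eta := ident B (dtwo s t) (spoly (iota 2 m) 0 1 eta).

(** The form that [bident] takes without a unit: the binary polynomial vanishes once padded by
    enough letters of type [one_t]. In the presence of a unit the padding can be removed
    ([nullat_bident]). *)
Definition nullat B s t eta := exists m, sident B m s t eta.

Lemma sident_spoly B d X i j eta : uniq (i :: j :: X) ->
  (forall k, k \in X -> d k = one_t) ->
  sident B (size X) (d i) (d j) eta <-> ident B d (spoly X i j eta).
Proof.
move=> uX dX; split=> I.
  have := ident_rename (d' := d) (f := nth 0%N (i :: j :: X)) (wf_spoly _ _ _ _) _ I.
  rewrite mapw_spoly /= -[map _ _]/(map (nth 0%N (i :: j :: X)) (iota 2 (size X))).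
  have -> : map (nth 0%N (i :: j :: X)) (iota 2 (size X)) = X.
    apply: (@eq_from_nth _ 0%N) => [|k]; first by rewrite size_map size_iota.
    by rewrite size_map size_iota => kX; rewrite (nth_map 0%N) ?size_iota // nth_iota.
  apply=> k; rewrite !inE mem_iota => /or3P[/eqP -> //|/eqP -> //|/andP[k2 kX]].
  case: k k2 kX => [|[|k]] //= _; rewrite /dtwo /= => kX.
  by rewrite dX // mem_nth.
move: uX; rewrite /= inE negb_or => /and3P[/andP[ij iX] jX uX].
have := ident_rename (d' := dtwo (d i) (d j)) (f := index^~ (i :: j :: X)) (wf_spoly _
  _ _ _) _ I.
rewrite mapw_spoly /= !eqxx (negPf ij).
have iE x : x \in X -> index x (i :: j :: X) = (index x X).+2.
  move=> xX /=; case: eqP => [e|_]; first by rewrite e xX in iX.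
  by case: eqP => [e|_] //; rewrite e xX in jX.
have -> : map (index^~ (i :: j :: X)) X = iota 2 (size X).
  apply: (@eq_from_nth _ 0%N) => [|k]; first by rewrite size_map size_iota.
  rewrite size_map => kX; rewrite (nth_map 0%N) // nth_iota // iE ?mem_nth //.
  by rewrite index_uniq.
apply=> k; rewrite !inE => /or3P[/eqP -> |/eqP -> |kX].
- by rewrite /= eqxx.
- by rewrite /= (negPf ij) eqxx.
by change (dtwo (d i) (d j) (index k (i :: j :: X)) = d k); rewrite iE // (dX k kX).
Qed.

Lemma pev_spoly_swap (R : algType F) (b : nat -> R) X i j eta :
  pev b (spoly X i j eta) = sgn eta *: pev b (spoly X j i eta).
Proof.
have sw (A A' : R) : A + sgn eta *: A' = sgn eta *: (A' + sgn eta *: A).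
  by rewrite scalerDr scalerA sgn_sqr scale1r addrC.
rewrite /spoly /symp !pev_cat !pev_scale /pev /= !big_cons !big_nil /= !addr0.
by rewrite !scale1r [RHS]scalerDr -!sw.
Qed.

Lemma nullat_sym B s t eta : nullat B s t eta -> nullat B t s eta.
Proof.
case=> m I; exists m.
pose f k := if k == 0%N then 1%N else if k == 1%N then 0%N else k.
have := ident_rename (d' := dtwo t s) (f := f) (wf_spoly _ _ _ _) _ I.
rewrite mapw_spoly /= (_ : map f (iota 2 m) = iota 2 m); last first.
  rewrite -[RHS]map_id; apply/eq_in_map => k; rewrite mem_iota /f.
  by case: k => [|[|k]].
move=> I'; suff : ident B (dtwo t s) (spoly (iota 2 m) 1 0 eta).
  move=> I2 b hb; have := I2 b hb; rewrite pev_spoly_swap => /eqP.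
  rewrite scaler_eq0 => /orP[|/eqP //].
  by case: (eta); rewrite /= ?oppr_eq0 oner_eq0.
apply: I' => k; rewrite !inE mem_iota => /or3P[/eqP -> //|/eqP -> //|].
by case: k => [|[|k]].
Qed.

Section Subvariety.
Variables (B C : gsalg F G).
Hypotheses (uC : unitary C) (QC : proper3_trivial C) (CB : var C B).

(** Such a polynomial is an identity of [C] by [bident_ident], hence of [B]. Modulo the identities
    of [B] only the values of the functionals therefore matter. *)
Lemma ident_ell0 L d p : uniq L -> wf L p -> (1 < size L)%N ->
  (forall i j eta, i \in L -> j \in L -> i != j -> nonunit_in d L i j ->
    ell eta i j p = 0) -> ident B d p.
Proof.
move=> uL wfp L2 H; apply: (var_ident (L := L) _ wfp CB); first exact: ltnW.
apply: (bident_ident charF QC uL wfp L2) => i j eta iL jL ij dij.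
by rewrite H // eqxx.
Qed.

(** The hypotheses leave no functional other than that of [i], [j] and [eta], which determines [q]
    modulo identities up to a scalar: [q] can be replaced by a multiple of [spoly]. *)
Lemma detect_pure L d q i j eta : uniq L -> wf L q -> i \in L -> j \in L ->
  i != j -> nonunit_in d L i j -> ident B d q -> ell eta i j q != 0 ->
  (forall k l, k \in L -> l \in L -> k != l -> ell (~~ eta) k l q = 0) ->
  (eta = false -> forall k l, k \in L -> l \in L -> k != l ->
    nonunit_in d L k l -> (k, l) != (i, j) -> (k, l) != (j, i) ->
    ell false k l q = 0) ->
  sident B (size L - 2) (d i) (d j) eta.
Proof.
move=> uL wfq iL jL ij dij Iq nz H0 H1.
pose X := rem j (rem i L).
have jr : j \in rem i L by rewrite mem_rem_uniq // !inE jL eq_sym ij.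
have pL : perm_eq L (i :: j :: X).
  apply: perm_trans (perm_to_rem iL) _; rewrite perm_cons.
  exact: perm_to_rem.
have uX : uniq (i :: j :: X) by rewrite -(perm_uniq pL).
have dX k : k \in X -> d k = one_t.
  move=> kX; case: (eqVneq (d k) one_t) => // dk.
  have kL : k \in L by rewrite (perm_mem pL) !inE kX !orbT.
  move: uX; rewrite /= inE negb_or => /and3P[/andP[_ iX] jX _].
  by case: (dij k kL dk) => e; rewrite e in kX; rewrite kX in iX jX.
have -> : (size L - 2)%N = size X by rewrite (perm_size pL) /= subn2.
apply/(sident_spoly _ _ uX dX).
set a := ell eta i j q in nz *.
have wfs : wf L (spoly X i j eta).
  by apply: wf_perm (wf_spoly _ _ _ _); rewrite perm_sym.
have four : (4 : F) != 0 by rewrite ((pcharf0P F).1 charF).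
(* The weights 4 and -a balance the values 4 of [spoly] and a of [q], so that all functionals of the
   combination vanish. *)
have Ir : ident B d (scalep 4 q ++ scalep (- a) (spoly X i j eta)).
  apply: (ident_ell0 uL); first by rewrite wf_cat !wf_scale wfq wfs.
    by rewrite (perm_size pL).
  move=> k l e kL lL kl dkl; rewrite ell_cat !ell_scale.
  have [->|ne] := eqVneq e (~~ eta); first by rewrite H0 // ell_spoly_neq !mulr0 addr0.
  have {ne} -> : e = eta by move: ne; case: (e); case: (eta).
  have [[-> ->]|kl1] := eqVneq (k, l) (i, j).
    by rewrite ell_spoly // -/a mulNr [a * _]mulrC subrr.
  have [[-> ->]|kl2] := eqVneq (k, l) (j, i).
    by rewrite ell_sym [ell _ j i (spoly _ _ _ _)]ell_sym ell_spoly // -/a mulrCA [- a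
      * _]mulrCA
      mulNr mulrN [a * _]mulrC subrr.
  have totE q' : wf L q' -> ell true k l q' = ell true i j q'.
    by move=> wfq'; rewrite (ell_true uL wfq' kL lL kl) (ell_true uL wfq' iL jL ij).
  case: eta @a nz H0 H1 wfs => a nz H0 H1 wfs; last first.
    by rewrite H1 // ell_spoly_false // !mulr0 addr0.
  by rewrite !totE // ell_spoly // -/a mulNr [a * _]mulrC subrr.
have Is : ident B d (scalep (- a) (spoly X i j eta)).
  move=> b hb; have := Ir b hb; rewrite pev_cat pev_scale Iq // scaler0 add0r.
  by [].
by apply: ident_scaleV Is; rewrite oppr_eq0.
Qed.

(** Multiplication by a letter [z] of type [one_t] destroys the shape of [spoly]. Symmetrization
    under reversal and [detect_pure] restore it with one more padding letter. *)
Lemma sident_succ m s t eta : sident B m s t eta -> sident B m.+1 s t eta.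
Proof.
move=> I; pose z := m.+2; pose X := iota 2 m.
have uX : uniq [:: 0, 1 & X]%N by rewrite /= !inE !mem_iota iota_uniq.
have zX : z \notin [:: 0, 1 & X]%N by rewrite !inE mem_iota /z add2n ltnn andbF.
pose p := spoly X 0 1 eta.
pose q0 := mapw (cat [:: z]) p; pose q := symp eta q0.
have wfp : wf [:: 0, 1 & X]%N p := wf_spoly _ _ _ _.
have wfq0 : wf (z :: [:: 0, 1 & X])%N q0.
  by apply: wf_mapw wfp => w pe; rewrite perm_cons.
have wfq : wf (z :: [:: 0, 1 & X])%N q by exact: wf_symp.
have Iq : ident B (dtwo s t) q by apply: (ident_symp _ wfq0); exact: ident_mull.
have uL : uniq (z :: [:: 0, 1 & X])%N by rewrite cons_uniq zX.
have ellq e k l : z != k -> z != l -> ell e k l q0 = ell e k l p.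
  move=> zk zl; rewrite /ell (@pij_mapw _ k l k l _ _ _ wfp).
    rewrite (@pij_mapw _ l k l k _ _ _ wfp) // => w _.
    by rewrite before_consl.
  by move=> w _; rewrite before_consl.
have d01 k : dtwo s t k != one_t -> k = 0%N \/ k = 1%N.
  by case: k => [|[|k]]; [left | right | rewrite /dtwo /= eqxx].
have -> : m.+1 = (size (z :: [:: 0, 1 & X])%N - 2)%N by rewrite /= size_iota.
apply: (@detect_pure _ (dtwo s t) q 0 1 eta uL wfq) => //.
- by move=> k _; exact: d01.
- rewrite ell_symp eqxx ellq // ell_spoly //.
  by rewrite -natrM ((pcharf0P F).1 charF).
- by move=> k l _ _ _; rewrite ell_symp; case: (eta).
move=> e0 k l kL lL kl _ kl1 kl2; rewrite ell_symp e0 eqxx.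
suff -> : ell false k l q0 = 0 by rewrite mulr0.
(* As [z] comes first in every word of [q0], its functional with [x] is the sum of the coefficients,
   which is 0 for the sign -. *)
have new x : x \in z :: [:: 0, 1 & X]%N -> z != x -> ell false z x q0 = 0.
  move=> xL zx; have zL : z \in z :: [:: 0, 1 & X]%N by rewrite inE eqxx.
  have e1 : pij x z q0 = 0.
    rewrite /pij big_map big1 // => cw _; rewrite /before /= eqxx orbT.
    by rewrite eqseq_cons (negPf zx).
  have := ell_true uL wfq0 zL xL zx; rewrite /ell /= e1 !mulr0 !addr0 => ->.
  rewrite big_map /= -(@ell_true _ _ 0%N 1%N _ uX wfp) //;
    first by rewrite /p e0 (ell_spoly_neq X 0 1 false).
have [zk|zk] := eqVneq z k; first by rewrite -zk new // zk.
have [zl|zl] := eqVneq z l; first by rewrite -zl ell_sym new ?mulr0 // .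
by rewrite ellq // /p e0 ell_spoly_false.
Qed.

Lemma sident_le m m' s t eta : (m <= m')%N -> sident B m s t eta -> sident B m' s t eta.
Proof.
by move=> /subnK <-; elim: (m' - m)%N => // n IH /IH; exact: sident_succ.
Qed.

Definition isolated d L j p := forall k l, k \in L -> l \in L -> k != l ->
  nonunit_in d L k l -> k != j -> l != j -> ell false k l p = 0.

(** The letter [z] takes over the role of [j], and afterwards no functional of sign - avoids it. By
    the last conclusion an isolation reached earlier at [i] survives, so both letters of a pair can
    be treated in turn. *)
Lemma isolate L d p i j : uniq L -> wf L p -> i \in L -> j \in L -> i != j ->
  nonunit_in d L i j -> ident B d p -> ell false i j p != 0 ->
  (forall k l, k \in L -> l \in L -> k != l -> ell true k l p = 0) ->
  exists L' d' p' z, [/\ uniq L', wf L' p', i \in L', z \in L' & i != z] /\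
    [/\ d' i = d i, d' z = d j, nonunit_in d' L' i z, ident B d' p' &
        ell false i z p' != 0] /\
    [/\ forall k l, k \in L' -> l \in L' -> k != l -> ell true k l p' = 0,
        isolated d' L' z p' & isolated d L i p -> isolated d' L' i p'].
Proof.
move=> uL wfp iL jL ij dij Ip nz H0.
(* If [j] is not of type [one_t], every pair to be tested contains it, and [p] is already isolated
   at [j]. *)
have [dj|dj] := eqVneq (d j) one_t; last first.
  exists L, d, p, j; do !split=> //.
  by move=> k l kL lL kl dkl kj lj; case: (dkl j jL dj) => e; rewrite e eqxx in kj lj.
pose z := (\max_(x <- L) x).+1.
have zL : z \notin L.
  apply/negP => zL; have := leq_bigmax_seq (P := xpredT) (F := id) z zL isT.
  by rewrite ltnn.
have iz : i != z by apply: contraNneq zL => <-.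
have neqz k : k \in L -> k != z by move=> kL; apply: contraNneq zL => <-.
pose d' := upd d z one_t.
have dd' k : k \in L -> d' k = d k by move=> /neqz kz; rewrite /d' upd_neq.
have dz : d' z = one_t by rewrite /d' upd_eq.
have Ip' : ident B d' p.
  by apply: ident_ext wfp _ Ip => k kL; rewrite dd'.
have uL' : uniq (z :: L) by rewrite /= zL.
exists (z :: L), d', (jdiff j z p), z; split; [split | split; split] => //.
- exact: wf_jdiff.
- by rewrite inE iL orbT.
- by rewrite inE eqxx.
- by rewrite dd'.
- by rewrite dz dj.
- move=> k; rewrite inE => /orP[/eqP ->|kL]; first by rewrite dz eqxx.
  rewrite dd' // => dk; case: (dij k kL dk) => e; [by left|].
  by rewrite e dj eqxx in dk.
- by apply: (ident_jdiff uL jL wfp) => //; rewrite dd'.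
- by rewrite ell_sym (ell_jdiff_new charF uL jL zL wfp) // -ell_sym.
- move=> k l kL lL kl; exact: (ell_jdiff_true uL jL zL wfp).
- move=> k l; rewrite !inE => /orP[/eqP ->|kL] /orP[/eqP ->|lL] _ _;
    rewrite ?eqxx // => _ _; exact: (ell_jdiff_old uL jL zL wfp).
move=> Hi.
have new l : l \in L -> nonunit_in d' (z :: L) z l -> l != i -> ell false z l (jdiff j
  z p) = 0.
  move=> lL dzl li; have [->|lj] := eqVneq l j; first exact: (ell_jdiff_zj uL jL zL wfp).
  rewrite (ell_jdiff_new charF uL jL zL wfp) //; apply: Hi => //; rewrite 1?eq_sym //.
  move=> k kL dk; right; have kL' : k \in z :: L by rewrite inE kL orbT.
  case: (dzl k kL'); rewrite ?dd' // => e.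
  by have := neqz k kL; rewrite e eqxx.
move=> k l; rewrite !inE => /orP[/eqP ->|kL] /orP[/eqP ->|lL] kl dkl ki li.
- by rewrite eqxx in kl.
- exact: new.
- rewrite ell_sym new ?mulr0 // => x xL dx; case: (dkl x xL dx); by [right | left].
- exact: (ell_jdiff_old uL jL zL wfp).
Qed.

(** The substitute for [ident_bident] when [B] has no unit. For the sign + there is a single
    functional and [detect_pure] applies directly; for the sign - the pair is first isolated at both
    of its letters. *)
Lemma detect L d p i j eta : uniq L -> wf L p -> i \in L -> j \in L ->
  i != j -> nonunit_in d L i j -> ident B d p -> ell eta i j p != 0 ->
  nullat B (d i) (d j) eta.
Proof.
move=> uL wfp0 iL jL ij dij Ip0 nz0.
pose q := symp eta p.
have wfp : wf L q by exact: wf_symp.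
have Ip : ident B d q := ident_symp _ wfp0 Ip0.
have nz : ell eta i j q != 0 by rewrite ell_symp eqxx mulf_neq0 // two_neq0.
have H0 k l : k \in L -> l \in L -> k != l -> ell (~~ eta) k l q = 0.
  by move=> _ _ _; rewrite ell_symp; case: (eta).
clearbody q; move: p wfp0 Ip0 nz0 => _ _ _ _.
case: eta nz H0 => nz H0.
  by exists (size L - 2)%N; apply: (detect_pure uL wfp).
have [L1 [d1 [p1 [z [[uL1 wf1 iL1 zL1 iz] [[di1 dz1 n1 I1 nz1] [H1 s1 _]]]]]]] :=
  isolate uL wfp iL jL ij dij Ip nz H0.
have n1' : nonunit_in d1 L1 z i by move=> k kL dk; case: (n1 k kL dk); by [right|left].
have nz1' : ell false z i p1 != 0.
  by rewrite ell_sym mulf_neq0 //= oppr_eq0 oner_eq0.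
have zi : z != i by rewrite eq_sym.
have [L2 [d2 [p2 [y [[uL2 wf2 zL2 yL2 zy] [[dz2 dy2 n2 I2 nz2] [H2 s2 s2']]]]]]] :=
  isolate uL1 wf1 zL1 iL1 zi n1' I1 nz1' H1.
(* The letter [z] replaced [j] and then [y] replaced [i], so the surviving pair appears in the
   opposite order. *)
rewrite -di1 -dz1 -dz2 -dy2; apply: nullat_sym.
exists (size L2 - 2)%N; apply: (detect_pure uL2 wf2) => // _ k l kL lL kl dkl kl1 kl2.
have [kz|kz] := eqVneq k z; last first.
  have [lz|lz] := eqVneq l z; last by apply: (s2' s1).
  apply: s2 => //; last by rewrite lz.
  by apply: contraNneq kl2 => ->; rewrite lz.
apply: s2 => //; first by rewrite kz.
by apply: contraNneq kl1 => ->; rewrite kz.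
Qed.

End Subvariety.
End Detection.

(** * Codimensions *)

Section QuotientDimension.
Variables (F : fieldType) (V : lmodType F) (P I : set V).
Hypothesis I0 : I 0.
Hypothesis Ilin : forall c x y, I x -> I y -> I (c *: x + y).

Lemma quotI_sum (J : Type) (r : seq J) (Q : pred J) (c : J -> F) (f : J -> V) :
  (forall j, Q j -> I (f j)) -> I (\sum_(j <- r | Q j) c j *: f j).
Proof.
move=> fI; elim: r => [|j r IH]; first by rewrite big_nil.
by rewrite big_cons; case: ifP => // Qj; apply: Ilin => //; exact: fI.
Qed.

Lemma quotIZ c x : I x -> I (c *: x).
Proof. by move=> Ix; rewrite -[_ *: _]addr0; exact: Ilin. Qed.

(** Exchange lemma modulo [I]: if m > n, the matrix of coordinates has a nonzero row vector in its
    left kernel, which is a dependency among the [b i]. *)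
Lemma indep_le_span m n (b : 'I_m -> V) (a : 'I_n -> V) :
  (forall c : 'I_m -> F, I (\sum_i c i *: b i) -> forall i, c i = 0) ->
  (forall i, exists c : 'I_n -> F, I (b i - \sum_j c j *: a j)) ->
  (m <= n)%N.
Proof.
move=> bfree /(_ _)/cid bspan; rewrite leqNgt; apply/negP => nm.
pose M := \matrix_(i < m, j < n) sval (bspan i) j.
have : kermx M != 0.
  by rewrite -mxrank_eq0 mxrank_ker subn_eq0 -ltnNge; apply: leq_ltn_trans nm;
    exact: rank_leq_col.
case/rowV0Pn => u /sub_kermxP uM; apply/negP; rewrite negbK.
apply/eqP/rowP => i; rewrite mxE; apply: (bfree (fun i => u 0 i)).
have -> : \sum_i u 0 i *: b i = \sum_i u 0 i *: (b i - \sum_j M i j *: a j).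
  apply/eqP; rewrite -subr_eq0 -sumrB.
  under eq_bigr do rewrite -scalerBr opprB addrCA subrr addr0 scaler_sumr.
  rewrite exchange_big big1 // => j _.
  under eq_bigr do rewrite scalerA.
  rewrite -scaler_suml; have /rowP/(_ j) := uM.
  by rewrite !mxE => ->; rewrite scale0r.
apply: quotI_sum => j _; have := svalP (bspan j).
by congr (I (_ - _)); apply: eq_bigr => k _; rewrite mxE.
Qed.

Lemma is_quot_dim_uniq d d' : is_quot_dim P I d -> is_quot_dim P I d' -> d = d'.
Proof.
move=> [b [bP bf bs]] [b' [bP' bf' bs']]; apply/eqP; rewrite eqn_leq.
by rewrite (indep_le_span bf (fun i => bs' _ (bP i)))
  (indep_le_span bf' (fun i => bs _ (bP' i))).
Qed.

Lemma quot_basis_exists (s : seq V) : exists (d : nat) (b : 'I_d -> V),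
  [/\ forall i, b i \in s,
      forall c : 'I_d -> F, I (\sum_i c i *: b i) -> forall i, c i = 0
    & forall v, v \in s -> exists c : 'I_d -> F, I (v - \sum_i c i *: b i)].
Proof.
elim: s => [|x s [d [b [bs bfree bspan]]]].
  by exists 0%N, (fun=> 0); split=> [[]|c _ []|v].
have [[c cx]|nx] := pselect (exists c : 'I_d -> F, I (x - \sum_i c i *: b i)).
  exists d, b; split=> // [i|v]; first by rewrite inE bs orbT.
  by rewrite inE => /orP[/eqP ->|/bspan //]; exists c.
pose b' (i : 'I_d.+1) := if unlift ord0 i is Some j then b j else x.
have sumE (c : 'I_d.+1 -> F) : \sum_i c i *: b' i =
    c ord0 *: x + \sum_i c (lift ord0 i) *: b i.
  rewrite big_ord_recl /b' unlift_none; congr (_ + _).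
  by apply: eq_bigr => i _; rewrite liftK.
exists d.+1, b'; split=> [i|c cI|v].
- by rewrite /b' inE; case: unliftP => [j _|_]; rewrite ?bs ?orbT ?eqxx.
- rewrite sumE in cI.
  have c0 : c ord0 = 0.
    apply/eqP/negP => /negP c0; apply: nx.
    exists (fun i => - (c ord0)^-1 * c (lift ord0 i)).
    have := quotIZ (c ord0)^-1 cI; rewrite scalerDr scalerA mulVf // scale1r.
    rewrite scaler_sumr -sumrN; congr (I (_ + _)); apply: eq_bigr => i _.
    by rewrite scalerA mulNr scaleNr opprK.
  rewrite c0 scale0r add0r in cI.
  move=> i; case: (unliftP ord0 i) => [j ->|-> //].
  exact: (bfree (fun j => c (lift ord0 j)) cI).
rewrite inE => /orP[/eqP ->|/bspan[c cI]].
  exists (fun i => if i == ord0 then 1 else 0).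
  rewrite sumE /= scale1r big1 ?addr0 ?subrr // => i _.
  by rewrite scale0r.
exists (fun i => if unlift ord0 i is Some j then c j else 0).
rewrite sumE unlift_none scale0r add0r.
by under eq_bigr do rewrite liftK.
Qed.

Lemma is_quot_dim_exists (J : finType) (g : J -> V) :
  (forall j, P (g j)) ->
  (forall v, P v -> exists c : J -> F, v = \sum_j c j *: g j) ->
  exists d, is_quot_dim P I d.
Proof.
move=> gP Pg; have [d [b [bs bf bspan]]] := quot_basis_exists (map g (enum J)).
exists d, b; split=> // [i|v /Pg[c ->]].
  by have /mapP[j _ ->] := bs i; exact: gP.
have /(_ _)/cid h : forall j, exists c : 'I_d -> F, I (g j - \sum_i c i *: b i).
  by move=> j; apply: bspan; apply: map_f; rewrite mem_enum.
exists (fun i => \sum_j c j * sval (h j) i).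
have -> : \sum_j c j *: g j - \sum_i (\sum_j c j * sval (h j) i) *: b i =
    \sum_j c j *: (g j - \sum_i sval (h j) i *: b i).
  under [in RHS]eq_bigr do rewrite scalerBr scaler_sumr.
  rewrite sumrB exchange_big /=; congr (_ - _); apply: eq_bigr => i _.
  by rewrite scaler_suml; apply: eq_bigr => k _; rewrite scalerA.
by apply: quotI_sum => j _; exact: svalP (h j).
Qed.

Lemma is_quot_dim_pred (T : finType) (Q : pred T) (b : T -> V) :
  (forall x, Q x -> P (b x)) ->
  (forall c : T -> F, I (\sum_(x | Q x) c x *: b x) -> forall x, Q x -> c x = 0) ->
  (forall v, P v -> exists c : T -> F, I (v - \sum_(x | Q x) c x *: b x)) ->
  is_quot_dim P I #|Q|.
Proof.
have sumE (c : T -> F) :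
    \sum_(x | Q x) c x *: b x = \sum_(k < #|Q|) c (enum_val k) *: b (enum_val k).
  by rewrite -(big_enum_val (fun x => c x *: b x)).
move=> bP bf bs; exists (fun k => b (enum_val k)); split=> [k|c Ic k|v Pv].
- exact: bP (enum_valP k).
- pose c' x := \sum_(l < #|Q| | enum_val l == x) c l.
  have cval l : c' (enum_val l) = c l.
    by rewrite /c' (big_pred1 l) // => l'; rewrite (inj_eq enum_val_inj).
  rewrite -cval; apply: bf (enum_valP k).
  by rewrite sumE; under eq_bigr do rewrite cval.
by have [c cP] := bs v Pv; exists (fun k => c (enum_val k)); rewrite -sumE.
Qed.

End QuotientDimension.

(** Used to subtract an interpolation over all valid indices [Q'] rather than over the surviving
    ones [Q]; the remaining terms are then shown separately to be identities. *)
Lemma sum_scale_split (K : pzRingType) (V : lmodType K) (T : finType)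
  (Q Q' : pred T) (c : T -> K) (f : T -> V) : (forall x, Q x -> Q' x) ->
  - \sum_(x | Q x) c x *: f x = \sum_(x | Q' x) (- c x) *: f x
    + \sum_(x | Q' x && ~~ Q x) c x *: f x.
Proof.
move=> QQ'; rewrite [in RHS](bigID Q) /=.
under [X in _ = X + _ + _]eq_bigr do rewrite scaleNr.
under [X in _ = _ + X + _]eq_bigr do rewrite scaleNr.
rewrite !sumrN -addrA addNr addr0; congr (- _); apply: eq_bigl => x.
by case: (boolP (Q x)) => [/QQ' ->|]; rewrite ?andbF.
Qed.

(** * The space P_n and its components by types of the variables *)

Section Multilinear.
Variables (F : fieldType) (G : finGroupType).
Implicit Types (A B C : gsalg F G) (p q : mpol F) (n : nat).

Definition dfun n (d : {ffun 'I_n -> G * bool}) (k : nat) : G * bool :=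
  if insub k is Some i then d i else one_t.

Lemma dfunE n (d : {ffun 'I_n -> G * bool}) (i : 'I_n) : dfun d i = d i.
Proof. by rewrite /dfun valK. Qed.

Definition wperm n (s : 'S_n) : seq nat := [seq nat_of_ord (s i) | i <- enum 'I_n].

Lemma wperm_perm n (s : 'S_n) : perm_eq (wperm s) (iota 0 n).
Proof.
rewrite -val_enum_ord /wperm (map_comp val s); apply: perm_map.
apply: uniq_perm.
- by rewrite map_inj_uniq ?enum_uniq //; exact: perm_inj.
- exact: enum_uniq.
by move=> i; rewrite mem_enum; apply/mapP; exists ((s^-1)%g i); rewrite ?mem_enum ?permKV.
Qed.

Lemma perm_wperm n w : perm_eq w (iota 0 n) -> exists s : 'S_n, w = wperm s.
Proof.
move=> pe; have sw : size w = n by rewrite (perm_size pe) size_iota.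
have uw : uniq w by rewrite (perm_uniq pe) iota_uniq.
have wn (i : 'I_n) : (nth 0%N w i < n)%N.
  have : nth 0%N w i \in w by rewrite mem_nth // sw.
  by rewrite (perm_mem pe) mem_iota.
have finj : injective (fun i : 'I_n => Ordinal (wn i)).
  move=> i j /(congr1 val) /= /eqP; rewrite nth_uniq ?sw // => /eqP.
  exact: val_inj.
exists (perm finj); apply: (@eq_from_nth _ 0%N).
  by rewrite size_map size_enum_ord.
move=> k; rewrite sw => kn; rewrite (nth_map (Ordinal kn)) ?size_enum_ord //.
by rewrite permE /= nth_enum_ord.
Qed.

Lemma prod_wperm n (s : 'S_n) (d : {ffun 'I_n -> G * bool}) :
  \prod_(i < n) fvar F (nat_of_ord (s i), d (s i)) =
  \prod_(k <- wperm s) fvar F (k, dfun d k).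
Proof.
rewrite /wperm big_map enumT [index_enum _]unlock.
by apply: eq_bigr => i _; rewrite dfunE.
Qed.

Lemma multilin_lin n (c : F) (f g : freealg F G) :
  @multilin F G n f -> @multilin F G n g -> @multilin F G n (c *: f + g).
Proof.
move=> [a ->] [b ->]; exists (fun s d => c * a s d + b s d).
rewrite scaler_sumr -big_split; apply: eq_bigr => s _ /=.
rewrite scaler_sumr -big_split; apply: eq_bigr => d _ /=.
by rewrite scalerDl scalerA.
Qed.

Lemma multilin0 n : @multilin F G n 0.
Proof.
exists (fun _ _ => 0); symmetry; apply: big1 => s _; apply: big1 => d _.
by rewrite scale0r.
Qed.

Lemma multilin_sum n (J : Type) (r : seq J) (Q : pred J) (c : J -> F)
  (f : J -> freealg F G) : (forall j, Q j -> @multilin F G n (f j)) ->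
  @multilin F G n (\sum_(j <- r | Q j) c j *: f j).
Proof.
move=> fP; elim: r => [|j r IH]; first by rewrite big_nil; exact: multilin0.
by rewrite big_cons; case: ifP => // Qj; apply: multilin_lin => //; exact: fP.
Qed.

Definition mono n (x : 'S_n * {ffun 'I_n -> G * bool}) : freealg F G :=
  \prod_(i < n) fvar F (nat_of_ord (x.1 i), x.2 (x.1 i)).

Lemma multilin_mono n x : @multilin F G n (@mono n x).
Proof.
exists (fun s d => ((s, d) == x)%:R).
rewrite pair_big (bigD1 x) //= [X in _ + X]big1 => [|y /negPf yx].
  by rewrite addr0 -surjective_pairing eqxx scale1r.
by rewrite -surjective_pairing yx scale0r.
Qed.

Lemma multilin_span n (f : freealg F G) : @multilin F G n f ->
  exists c : 'S_n * {ffun 'I_n -> G * bool} -> F, f = \sum_x c x *: @mono n x.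
Proof.
by case=> c ->; exists (fun x => c x.1 x.2); rewrite pair_big.
Qed.

Lemma multilin_fr n (d : nat -> G * bool) p : wf (iota 0 n) p ->
  @multilin F G n (fr d p).
Proof.
move=> /allP wfp; rewrite /fr big_seq; apply: multilin_sum => cw /wfp /perm_wperm[s ->].
have -> : \prod_(i <- wperm s) fvar F (i, d i) = mono (s, [ffun i : 'I_n => d i]).
  rewrite /mono (prod_wperm s) big_seq [RHS]big_seq; apply: eq_bigr => k.
  rewrite (perm_mem (wperm_perm s)) mem_iota => /andP[_ kn].
  by rewrite -[k]/(nat_of_ord (Ordinal kn)) dfunE ffunE.
exact: multilin_mono.
Qed.

Lemma multilinP n (f : freealg F G) : @multilin F G n f ->
  exists p : {ffun 'I_n -> G * bool} -> mpol F,
    (forall d, wf (iota 0 n) (p d)) /\ f = \sum_d fr (dfun d) (p d).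
Proof.
case=> c ->; exists (fun d => [seq (c s d, wperm s) | s <- enum 'S_n]).
split=> [d|]; first by rewrite /wf all_map; apply/allP => s _; exact: wperm_perm.
rewrite exchange_big; apply: eq_bigr => d _; rewrite /fr big_map big_enum /=.
by apply: eq_bigr => s _; rewrite prod_wperm.
Qed.

(** Sending to 0 every variable whose type differs from the one prescribed by [d0] kills the other
    components: each of their words contains such a variable. *)
Lemma ident_component B n (p : {ffun 'I_n -> G * bool} -> mpol F) :
  (0 < n)%N -> (forall d, wf (iota 0 n) (p d)) ->
  Id B (\sum_d fr (dfun d) (p d)) -> forall d, ident B (dfun d) (p d).
Proof.
move=> n0 wfp /IdP[_ Ip] d0 b hb.
pose phi (x : gsvar G) : B :=
  if (x.1 < n)%N && (x.2 == dfun d0 x.1) then b x.1 else 0.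
have /Ip : admissible phi.
  move=> i g e; rewrite /phi /=; case: andP => [[_ /eqP ge]|_];
    last exact: (ghom0 B (g, e)).
  by have := hb i; rewrite -ge.
rewrite (big_morph _ (evaluD phi) (evalu0 phi)) (bigD1 d0) //= big1.
  rewrite addr0 evalu_fr => <-; apply: pev_ext (wfp d0) _ => k.
  by rewrite mem_iota /= /phi => kn; rewrite /= kn eqxx.
move=> d dd0; rewrite evalu_fr /pev big1_seq // => cw /andP[_ /(allP (wfp d)) pe].
have /existsP[i di] : [exists i, d i != d0 i].
  apply: contraNT dd0 => /existsPn di; apply/eqP/ffunP => i.
  by have := di i; rewrite negbK => /eqP.
have iw : nat_of_ord i \in cw.2 by rewrite (perm_mem pe) mem_iota /=.
case/splitPr: iw => w1 w2; rewrite big_cat big_cons /= /phi /= !dfunE (negPf di) andbF.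
by rewrite linear0 mul0r mulr0 scaler0.
Qed.

Lemma codim_exists B n : exists d, is_quot_dim (@multilin F G n) (Id B) d.
Proof.
exact: (is_quot_dim_exists (Id0 B) (@Id_lin _ _ B) (@multilin_mono n)
  (@multilin_span n)).
Qed.

Lemma codimP B n : is_quot_dim (@multilin F G n) (Id B) (codim B n).
Proof. by apply: (@xgetPex _ 0%N); exact: codim_exists. Qed.

Lemma codim_eq B n d : is_quot_dim (@multilin F G n) (Id B) d -> codim B n = d.
Proof.
move=> h; apply: (is_quot_dim_uniq (Id0 B) (@Id_lin _ _ B) _ h).
exact: codimP.
Qed.

Lemma indep_codim B n m (b : 'I_m -> freealg F G) :
  (forall i, @multilin F G n (b i)) ->
  (forall c : 'I_m -> F, Id B (\sum_i c i *: b i) -> forall i, c i = 0) ->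
  (m <= codim B n)%N.
Proof.
move=> bP bf; have [a [aP af asp]] := codimP B n.
by apply: (indep_le_span (Id0 B) (@Id_lin _ _ B) bf) => i; apply: asp.
Qed.

(** P_n modulo the intersection of the [Id (B i)] embeds in the sum of the quotients, and modulo
    [Id A] it can only be smaller. *)
Lemma codim_sub A (k : nat) (B : 'I_k -> gsalg F G) n :
  (forall f, mcoeff mone f = 0 -> (forall i, Id (B i) f) -> Id A f) ->
  (0 < n)%N -> (codim A n <= \sum_(i < k) codim (B i) n)%N.
Proof.
move=> BA n0; have [b [bP bf _]] := codimP A n.
have /(_ _)/cid a i : exists a : 'I_(codim (B i) n) -> freealg F G,
    forall v, @multilin F G n v -> exists c, Id (B i) (v - \sum_j c j *: a j).
  by have [a [_ _ asp]] := codimP (B i) n; exists a.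
have /(_ _ _)/cid c i j := svalP (a i) (b j) (bP j).
pose J : finType := {i : 'I_k & 'I_(codim (B i) n)}.
have cJ : #|J| = (\sum_(i < k) codim (B i) n)%N.
  rewrite card_tagged sumnE big_map enumT [index_enum _]unlock.
  by apply: eq_bigr => i _; rewrite card_ord.
rewrite -cJ leqNgt; apply/negP => lt.
(* Each row lists the coordinates of one [b j] in all the quotients side by side. A vector of the
   left kernel gives a combination lying in every [Id (B i)], hence in [Id A]. *)
pose M := \matrix_(j < codim A n, x < #|J|)
  sval (c (tag (enum_val x)) j) (tagged (enum_val x)).
have : kermx M != 0.
  rewrite -mxrank_eq0 mxrank_ker subn_eq0 -ltnNge; apply: leq_ltn_trans lt.
  exact: rank_leq_col.
case/rowV0Pn => u /sub_kermxP uM; apply/negP; rewrite negbK.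
apply/eqP/rowP => j; rewrite mxE; apply: (bf (fun j => u 0 j)).
apply: BA => [|i].
  rewrite raddf_sum big1 //= => l _; rewrite mcoeffZ.
  have [p [wfp ->]] := multilinP (bP l).
  rewrite raddf_sum big1 ?mulr0 //= => d _; rewrite raddf_sum /=.
  apply: big1_seq => cw /andP[_ /(allP (wfp d)) /perm_size].
  rewrite size_iota => sw; rewrite mcoeffZ -(big_map (fun i => (i, dfun d i)) xpredT).
  rewrite prod_fvar mcoeff_fmon ?mulr0 // -size_eq0 size_map sw.
  by rewrite -lt0n.
have -> : \sum_j u 0 j *: b j =
    \sum_j u 0 j *: (b j - \sum_x sval (c i j) x *: sval (a i) x).
  apply/eqP; rewrite -subr_eq0 -sumrB.
  under eq_bigr do rewrite -scalerBr opprB addrCA subrr addr0 scaler_sumr.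
  rewrite exchange_big big1 // => x _.
  under eq_bigr do rewrite scalerA.
  rewrite -scaler_suml.
  have /rowP/(_ (enum_rank (Tagged (fun i => 'I_(codim (B i) n)) x : J))) := uM.
  rewrite !mxE => e; rewrite (_ : \sum_i0 _ = 0) ?scale0r // -[RHS]e.
  by apply: eq_bigr => l _; rewrite mxE enum_rankK.
apply: (quotI_sum (I := Id (B i))); [exact: Id0 | exact: Id_lin |].
by move=> l _; exact: svalP (c i l).
Qed.

End Multilinear.

(** * A basis of P_n dual to the functionals *)

Section CodimensionFormula.
Variables (F : fieldType) (G : finGroupType).
Hypothesis charF : [pchar F] =i pred0.
Implicit Types (p q : mpol F).

Lemma wf_flatten L (ps : seq (mpol F)) : wf L (flatten ps) = all (wf L) ps.
Proof. by elim: ps => //= p ps IH; rewrite wf_cat IH. Qed.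

Lemma fr_cat (d : nat -> G * bool) p q : fr d (p ++ q) = fr d p + fr d q.
Proof. by rewrite /fr big_cat. Qed.

Lemma fr_scale (d : nat -> G * bool) a p : fr d (scalep a p) = a *: fr d p.
Proof.
by rewrite /fr big_map scaler_sumr; apply: eq_bigr => cw _; rewrite scalerA.
Qed.

Lemma fr_flatten (d : nat -> G * bool) (ps : seq (mpol F)) :
  fr d (flatten ps) = \sum_(p <- ps) fr d p.
Proof.
by elim: ps => [|p ps IH]; rewrite /= ?fr_cat ?IH ?big_cons // /fr !big_nil.
Qed.

Lemma ell_flatten e i j (ps : seq (mpol F)) :
  ell e i j (flatten ps) = \sum_(p <- ps) ell e i j p.
Proof.
elim: ps => [|p ps IH]; rewrite /= ?ell_cat ?IH ?big_cons //.
by rewrite /ell /pij !big_nil mulr0 addr0.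
Qed.

Section Index.
Variable m : nat.
Local Notation n := m.+2.

(* The functionals [ell] on P_n are indexed by the variables that are not
   symmetric of degree 1: none, one, or two of them. In the first two cases, and
   generally for the sign [+] and a symmetric variable of degree 1,
   the functional is the sum of the coefficients; [bvalid] keeps one index for
   each functional. *)
Definition bindex : finType :=
  ((unit + 'I_n * (G * bool)) + ('I_n * 'I_n) * ((G * bool) * (G * bool) * bool))%type.
Implicit Types o : bindex.

(** In the first two cases [ord0] and [ord_max] are arbitrary partners, distinct because n = m + 2;
    the functional of sign + does not depend on them. *)
Definition bcode o : {ffun 'I_n -> G * bool} * ('I_n * 'I_n) * bool :=
  match o with
  | inl (inl _) => ([ffun=> one_t], (ord0, ord_max), true)
  | inl (inr (k, t)) => ([ffun x => if x == k then t else one_t],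
      (k, if k == ord0 then ord_max else ord0), true)
  | inr ((i, j), (s, t, e)) =>
      ([ffun x => if x == i then s else if x == j then t else one_t], (i, j), e)
  end.

Definition bvalid o : bool :=
  match o with
  | inl (inl _) => true
  | inl (inr (k, t)) => t != one_t
  | inr ((i, j), (s, t, e)) => (i < j)%N && (e ==> (s != one_t) && (t != one_t))
  end.

Definition bdeg o := (bcode o).1.1.
Definition bi o := (bcode o).1.2.1.
Definition bj o := (bcode o).1.2.2.
Definition bsgn o := (bcode o).2.

(** The factor 1/4 normalizes the functional of [o] to 1, see [ell_spoly]. *)
Definition bpoly o : mpol F :=
  scalep 4^-1 (spoly F (rem (val (bj o)) (rem (val (bi o)) (iota 0 n)))
    (bi o) (bj o) (bsgn o)).

Lemma bi_neq_bj o : bvalid o -> bi o != bj o.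
Proof.
case: o => [[u|[k t]]|[[i j] [[s t] e]]] //=.
  by move=> _; rewrite /bi /bj /=; case: (eqVneq k ord0) => [->|].
by case/andP => ij _; rewrite /bi /bj /= -val_eqE neq_ltn ij.
Qed.

Lemma bval_neq o : bvalid o -> nat_of_ord (bi o) != bj o.
Proof. by move=> /bi_neq_bj; rewrite -val_eqE. Qed.

Lemma bdeg_nonunit o : nonunit_in (dfun (bdeg o)) (iota 0 n) (bi o) (bj o).
Proof.
move=> k; rewrite mem_iota => /= kn.
rewrite -[k]/(nat_of_ord (Ordinal kn)) dfunE.
case: o => [[u|[l t]]|[[i j] [[s t] e]]]; rewrite /bdeg /bi /bj /= ffunE.
- by rewrite eqxx.
- by case: (eqVneq (Ordinal kn) l) => [<- _|_]; [left | rewrite eqxx].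
case: (eqVneq (Ordinal kn) i) => [<- _|_]; first by left.
by case: (eqVneq (Ordinal kn) j) => [<- _|_]; [right | rewrite eqxx].
Qed.

Lemma bpoly_perm o : bvalid o -> perm_eq (iota 0 n)
  [:: val (bi o), val (bj o) & rem (val (bj o)) (rem (val (bi o)) (iota 0 n))].
Proof.
move=> vo.
have ii : val (bi o) \in iota 0 n by rewrite mem_iota /=.
have iL (x : 'I_n) : val x \in iota 0 n by rewrite mem_iota /=.
have jj : val (bj o) \in rem (val (bi o)) (iota 0 n).
  rewrite mem_rem_uniq ?iota_uniq //; apply/andP; split; last exact: iL.
  by rewrite /= eq_sym bval_neq.
apply: perm_trans (perm_to_rem ii) _; rewrite perm_cons.
exact: perm_to_rem.
Qed.

Lemma wf_bpoly o : bvalid o -> wf (iota 0 n) (bpoly o).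
Proof.
move=> vo; rewrite wf_scale; apply: wf_perm (wf_spoly _ _ _ _ _).
by rewrite perm_sym bpoly_perm.
Qed.

Lemma four_neq0 : 4 != 0 :> F.
Proof. by rewrite ((pcharf0P F).1 charF). Qed.

(** For the sign + the letters that are not of type [one_t] determine the index: none, one or two of
    them for the three kinds. *)
Lemma btrue_inj o o' : bvalid o -> bvalid o' -> bsgn o -> bsgn o' ->
  bdeg o = bdeg o' -> o = o'.
Proof.
case: o => [[[]|[k t]]|[[i j] [[s t] e]]];
  case: o' => [[[]|[k' t']]|[[i' j'] [[s' t'] e']]] //=; rewrite /bsgn /bdeg /=.
- by move=> _ /negPf t1 _ _ /ffunP/(_ k'); rewrite !ffunE eqxx => /eqP; rewrite eq_sym t1.
- by move=> _ /andP[_ /implyP h] _ /h /andP[/negPf s1 _] /ffunP/(_ i');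
    rewrite !ffunE eqxx => /eqP; rewrite eq_sym s1.
- by move=> /negPf t1 _ _ _ /ffunP/(_ k); rewrite !ffunE eqxx => /eqP; rewrite t1.
- move=> t1 _ _ _ /ffunP/(_ k); rewrite !ffunE eqxx.
  by case: eqP => [-> ->|_ e] //; rewrite e eqxx in t1.
- move=> _ /andP[ij /implyP h] _ /h /andP[s1 t1] /ffunP ed.
  have := ed i'; rewrite !ffunE eqxx; case: (eqVneq i' k) => [ik _|_ e1];
    last by rewrite -e1 eqxx in s1.
  have := ed j'; rewrite !ffunE eqxx (_ : (j' == i') = false);
    last by rewrite -val_eqE gtn_eqF.
  case: (eqVneq j' k) => [jk _|_ e1]; last by rewrite -e1 eqxx in t1.
  by move: ij; rewrite ik jk ltnn.
- by move=> /andP[_ /implyP h] _ /h /andP[/negPf s1 _] _ /ffunP/(_ i);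
    rewrite !ffunE eqxx => /eqP; rewrite s1.
- move=> /andP[ij /implyP h] _ /h /andP[s1 t1] _ /ffunP ed.
  have := ed i; rewrite !ffunE eqxx; case: (eqVneq i k') => [ik _|_ e1];
    last by rewrite e1 eqxx in s1.
  have := ed j; rewrite !ffunE eqxx (_ : (j == i) = false);
    last by rewrite -val_eqE gtn_eqF.
  case: (eqVneq j k') => [jk _|_ e1]; last by rewrite e1 eqxx in t1.
  by move: ij; rewrite ik jk ltnn.
move=> /andP[ij /implyP h] /andP[ij' /implyP h'] e1 e1'.
have /andP[s1 t1] := h e1; have /andP[s1' t1'] := h' e1'; move=> /ffunP ed.
have ji : (j == i) = false by rewrite -val_eqE gtn_eqF.
have ji' : (j' == i') = false by rewrite -val_eqE gtn_eqF.
have ei := ed i; have ej := ed j; have ei' := ed i'; have ej' := ed j'.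
rewrite !ffunE !eqxx in ei ej ei' ej'; rewrite ?ji ?ji' in ei ej ei' ej'.
have ii : i = i'.
  case: (eqVneq i i') ei => // ii; case: (eqVneq i j') => [ij2 _|_ e2];
    last by rewrite e2 eqxx in s1.
  case: (eqVneq j i') ej => [ji2 _|_]; first by move: ij ij';
    rewrite ij2 ji2 => /ltn_trans /[apply]; rewrite ltnn.
  case: (eqVneq j j') => [jj _|_ e2]; last by rewrite e2 eqxx in t1.
  by move: ij; rewrite ij2 jj ltnn.
subst i'; rewrite eqxx in ei; subst s'.
have jj : j = j'.
  rewrite ji in ej; case: (eqVneq j j') ej => // _ e2; by rewrite e2 eqxx in t1.
subst j'; rewrite eqxx ji in ej; subst t'.
by rewrite !eqxx ji e1 e1'.
Qed.

(** The [bpoly] with a fixed assignment of types form a family dual to the functionals, so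
    coefficients can be read off by applying [ell]. *)
Lemma ell_bpoly o o' : bvalid o -> bvalid o' -> bdeg o = bdeg o' ->
  ell (bsgn o) (bi o) (bj o) (bpoly o') = (o == o')%:R.
Proof.
move=> vo vo' deg; rewrite ell_scale.
have uL := iota_uniq 0 n; have wfo' := wf_bpoly vo'.
have [se|se] := eqVneq (bsgn o) (bsgn o'); last first.
  have -> : bsgn o = ~~ bsgn o' by move: se; case: (bsgn o); case: (bsgn o').
  rewrite ell_spoly_neq mulr0; case: eqP => // e; by rewrite e eqxx in se.
have uo' : uniq [:: val (bi o'),
  val (bj o') & rem (val (bj o')) (rem (val (bi o')) (iota 0 n))].
  by rewrite -(perm_uniq (bpoly_perm vo')).
have iL (x : 'I_n) : nat_of_ord x \in iota 0 n by rewrite mem_iota /=.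
have [st|st] : bsgn o = true \/ bsgn o = false by case: (bsgn o); [left | right].
  have eqo : o = o' by apply: btrue_inj => //; rewrite -?se st.
  by rewrite -eqo eqxx ell_spoly ?mulVf ?four_neq0 // eqo.
have [eqo|no] := eqVneq o o'.
  by rewrite eqo ell_spoly ?mulVf ?four_neq0.
have st' : bsgn o' = false by rewrite -se.
rewrite st st' ell_spoly_false ?mulr0 //; first exact: bval_neq.
  apply: contra no => /eqP[/val_inj e1 /val_inj e2].
  case: o o' vo vo' deg st st' e1 e2 {se wfo' uo'} => [[u|[k t]]|[[i j] [[s t] e]]];
    case=> [[u'|[k' t']]|[[i' j'] [[s' t'] e']]] //=.
  rewrite /bsgn /bi /bj /bdeg /= => /andP[ij _] _ /ffunP ed -> -> ei ej.
  subst i' j'; have ei := ed i; have ej := ed j; rewrite !ffunE !eqxx in ei ej.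
  rewrite (_ : (j == i) = false) in ej; last by rewrite -val_eqE gtn_eqF.
  by rewrite ei ej eqxx.
apply: contra no => /eqP[/val_inj e1 /val_inj e2].
case: o o' vo vo' deg st st' e1 e2 {se wfo' uo'} => [[u|[k t]]|[[i j] [[s t] e]]];
  case=> [[u'|[k' t']]|[[i' j'] [[s' t'] e']]] //=.
rewrite /bsgn /bi /bj /bdeg /= => /andP[ij _] /andP[ij' _] _ _ _ ei ej.
by move: ij; rewrite ei ej => /(ltn_trans ij'); rewrite ltnn.
Qed.

(** The indices removed by [bvalid] lose nothing: an unordered pair is enough by [ell_sym], and a
    functional of sign + involving a letter of type [one_t] is the sum of the coefficients, already
    given by an index of the first two kinds. *)
Lemma ell_complete (d : {ffun 'I_n -> G * bool}) (i j : nat) e :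
  i \in iota 0 n -> j \in iota 0 n -> i != j ->
  nonunit_in (dfun d) (iota 0 n) i j ->
  exists o, [/\ bvalid o, bdeg o = d, bsgn o = e
    & forall p, wf (iota 0 n) p -> ell e (bi o) (bj o) p = 0 -> ell e i j p = 0].
Proof.
move=> iL jL; have := iL; have := jL; rewrite !mem_iota !add0n => /andP[_ jn] /andP[_ i_n].
pose i' := Ordinal i_n; pose j' := Ordinal jn.
rewrite -[i]/(nat_of_ord i') -[j]/(nat_of_ord j') => ij' dij.
have ij : i' != j' by rewrite -val_eqE.
have ji : (j' == i') = false by rewrite eq_sym (negPf ij).
have d1 x : x != i' -> x != j' -> d x = one_t.
  move=> xi xj; apply/eqP/negP => /negP dx.
  have xL : nat_of_ord x \in iota 0 n by rewrite mem_iota /=.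
  case: (dij x xL); rewrite ?dfunE // => /val_inj e1.
    by rewrite e1 eqxx in xi.
  by rewrite e1 eqxx in xj.
have uL := iota_uniq 0 n.
have dd : d = [ffun x => if x == i' then d i' else if x == j' then d j' else one_t].
  apply/ffunP => x; rewrite ffunE; case: (eqVneq x i') => [->|xi] //.
  by case: (eqVneq x j') => [->|xj] //; rewrite d1.
have dd' : d = [ffun x => if x == j' then d j' else if x == i' then d i' else one_t].
  apply/ffunP => x; rewrite ffunE; case: (eqVneq x j') => [->|xj] //.
  by case: (eqVneq x i') => [->|xi] //; rewrite d1.
have tot o p : bvalid o -> wf (iota 0 n) p -> ell true (bi o) (bj o) p = 0 -> ell true
  i' j' p = 0.
  move=> vo wfp; rewrite (ell_true uL wfp _ _ (bval_neq vo)) ?mem_iota //= => e0.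
  by rewrite (ell_true uL wfp iL jL ij').
have pairs : e ==> (d i' != one_t) && (d j' != one_t) -> exists o,
    [/\ bvalid o, bdeg o = d, bsgn o = e
     & forall p, wf (iota 0 n) p -> ell e (bi o) (bj o) p = 0 -> ell e i' j' p = 0].
  move=> he; have [lt|lt|e0] := ltngtP i' j'; last by case/eqP: ij'.
    by exists (inr ((i', j'), (d i', d j', e))); split; rewrite /bdeg /= -?dd ?lt.
  exists (inr ((j', i'), (d j', d i', e))); split; rewrite /bdeg /= -?dd' //.
    by rewrite lt; move: he; rewrite andbC.
  by move=> p _ e0; rewrite ell_sym e0 mulr0.
case: e pairs => [|pairs]; last exact: pairs.
have [di|di] := eqVneq (d i') one_t; have [dj|dj] := eqVneq (d j') one_t.
- move=> _; exists (inl (inl tt)); split=> //; last by move=> p;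
  exact: (tot (inl (inl tt))).
  by apply/ffunP => x; rewrite dd !ffunE di dj !if_same.
- move=> _; exists (inl (inr (j', d j'))); split=> //; last by move=> p;
  exact: (tot (inl (inr (j', d j')))).
  by rewrite [RHS]dd' di; apply/ffunP => x; rewrite !ffunE if_same.
- move=> _; exists (inl (inr (i', d i'))); split=> //; last by move=> p;
  exact: (tot (inl (inr (i', d i')))).
  by rewrite [RHS]dd dj; apply/ffunP => x; rewrite !ffunE if_same.
by apply.
Qed.

Definition bsum (c : bindex -> F) (Q : pred bindex) : mpol F :=
  flatten [seq scalep (c o) (bpoly o) | o <- enum Q].

Lemma wf_bsum c (Q : pred bindex) : (forall o, Q o -> bvalid o) ->
  wf (iota 0 n) (bsum c Q).
Proof.
move=> vQ; rewrite wf_flatten all_map; apply/allP => o; rewrite mem_enum => /vQ vo.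
by change (is_true (wf (iota 0 n) (scalep (c o) (bpoly o)))); rewrite wf_scale wf_bpoly.
Qed.

Lemma fr_bsum (d : nat -> G * bool) c (Q : pred bindex) :
  fr d (bsum c Q) = \sum_(o | Q o) c o *: fr d (bpoly o).
Proof.
rewrite fr_flatten big_map big_enum; apply: eq_bigr => o _; exact: fr_scale.
Qed.

Lemma ell_bsum e i j c (Q : pred bindex) :
  ell e i j (bsum c Q) = \sum_(o | Q o) c o * ell e i j (bpoly o).
Proof.
rewrite ell_flatten big_map big_enum; apply: eq_bigr => o _; exact: ell_scale.
Qed.

Definition belt o : freealg F G := fr (dfun (bdeg o)) (bpoly o).

Lemma belt_sum c (Q : pred bindex) :
  \sum_(o | Q o) c o *: belt o =
  \sum_d fr (dfun d) (bsum c [pred o | Q o && (bdeg o == d)]).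
Proof.
rewrite (partition_big bdeg xpredT) //=; apply: eq_bigr => d _.
by rewrite fr_bsum; apply: eq_bigr => o /andP[_ /eqP <-].
Qed.

Lemma ell_bsum_code c (Q : pred bindex) o : (forall o, Q o -> bvalid o) -> bvalid o ->
  ell (bsgn o) (bi o) (bj o) (bsum c [pred o' | Q o' && (bdeg o' == bdeg o)]) =
  if Q o then c o else 0.
Proof.
move=> vQ vo; rewrite ell_bsum.
have E o' : Q o' && (bdeg o' == bdeg o) ->
    c o' * ell (bsgn o) (bi o) (bj o) (bpoly o') = if o' == o then c o' else 0.
  move=> /andP[/vQ vo' /eqP deg]; rewrite ell_bpoly // eq_sym.
  by case: eqP; rewrite ?mulr1 ?mulr0.
rewrite (eq_bigr _ E) -big_mkcondr /=; case: ifP => Qo.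
  rewrite (big_pred1 o) // => o' /=; case: (eqVneq o' o) => [->|_].
    by rewrite Qo eqxx.
  by rewrite andbF.
rewrite big_pred0 // => o'; case: (eqVneq o' o) => [->|_]; last by rewrite andbF.
by rewrite /= Qo.
Qed.

Section Codimension.
Variables (B C : gsalg F G).
Hypotheses (uC : unitary C) (QC : proper3_trivial C) (CB : var C B).
Hypothesis nullB : forall s t e, nullat B s t e -> sident B m s t e.

Definition alive B s t e : bool := ~~ `[< @nullat F G B s t e >].

Definition bset : pred bindex := fun o =>
  bvalid o && alive B (bdeg o (bi o)) (bdeg o (bj o)) (bsgn o).

(** Independence: a nonzero coefficient at an alive index would be a nonzero functional on an
    identity, which [detect] forbids. Generation: subtracting the interpolation by all [bpoly]
    leaves a polynomial without functionals, an identity; the dead terms vanish in this very degree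
    by [nullB]. *)
Lemma codim_card_bset : codim B n = #|bset|.
Proof.
have vset o : bset o -> bvalid o by case/andP.
apply: codim_eq; apply: (is_quot_dim_pred (b := belt)).
- by move=> o bo; apply: multilin_fr; apply: wf_bpoly; apply: vset.
- move=> c Ic o bo; apply/eqP/negP => /negP co.
  have vo := vset _ bo.
  rewrite belt_sum in Ic.
  have wfc d : wf (iota 0 n) (bsum c [pred o | bset o && (bdeg o == d)]).
    by apply: wf_bsum => o' /andP[/vset].
  have Io : ident B (dfun (bdeg o))
      (bsum c [pred o' | bset o' && (bdeg o' == bdeg o)]).
    exact: (ident_component (ltn0Sn _) wfc Ic).
  have iL (x : 'I_n) : nat_of_ord x \in iota 0 n by rewrite mem_iota /=.
  have := detect charF QC CB (iota_uniq 0 n) (wfc _) (iL (bi o))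
    (iL (bj o)) (bval_neq vo) (@bdeg_nonunit _) Io.
  move/(_ (bsgn o)); rewrite ell_bsum_code // bo => /(_ co).
  rewrite !dfunE => nul; have /andP[_] := bo; rewrite /alive => /negP; apply.
  exact/asboolP.
move=> v /multilinP[p [wfp ->]].
(* Since the family is dual to the functionals, the coordinate at [o] is the functional of [o] on
   the component of the same types. *)
pose c o := ell (bsgn o) (bi o) (bj o) (p (bdeg o)).
exists c; rewrite (sum_scale_split _ _ vset).
rewrite (belt_sum (fun o => - c o) bvalid) addrA -big_split /=.
apply: IdD.
  apply: Id_sum => d _; rewrite -fr_cat.
  have wfr : wf (iota 0 n) (p d ++ bsum (fun o => - c o) [pred o | bvalid o && (bdeg o
    == d)]).
    by rewrite wf_cat wfp wf_bsum // => o /andP[].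
  apply/Id_fr; first by apply: (wf_nonempty _ wfr); rewrite size_iota.
  apply: (ident_ell0 charF QC CB (iota_uniq 0 n) wfr); first by rewrite size_iota.
  move=> i j e iL jL ij dij.
  have [oc [vo od <- oE]] := ell_complete e iL jL ij dij.
  apply: oE => //; rewrite ell_cat -od ell_bsum_code // vo.
  by rewrite /c subrr.
apply: Id_sum => o /andP[vo nbo]; apply: IdZ.
apply/Id_fr; first by apply: (wf_nonempty _ (wf_bpoly vo)); rewrite size_iota.
apply: ident_scale.
have nul : nullat B (bdeg o (bi o)) (bdeg o (bj o)) (bsgn o).
  by move: nbo; rewrite /bset vo /= /alive negbK => /asboolP.
have pe := bpoly_perm vo.
have uo := perm_uniq pe; rewrite iota_uniq in uo.
rewrite -(sident_spoly B _ (esym uo)); last first.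
  move=> k kX; case: (eqVneq (dfun (bdeg o) k) one_t) => // dk.
  have kL : k \in iota 0 n by rewrite (perm_mem pe) !inE kX !orbT.
  have := esym uo; rewrite /= inE negb_or => /and3P[/andP[_ iX] jX _].
  by case: (bdeg_nonunit kL dk) => e; rewrite e in kX; rewrite kX in iX jX.
rewrite !dfunE; have := perm_size pe; rewrite size_iota /= => -[<-].
exact: nullB.
Qed.

End Codimension.
End Index.
End CodimensionFormula.

Lemma sum_ord_lt n k : (k <= n)%N -> (\sum_(i < n) (i < k) = k)%N.
Proof.
move=> kn; transitivity (\sum_(i < n | (i < k)%N) 1)%N.
  by rewrite [RHS]big_mkcond; apply: eq_bigr => i _; case: ltnP.
by rewrite -(big_ord_widen n (fun=> 1%N)) // sum1_card card_ord.
Qed.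

(** * Codimensions as a polynomial in n *)

Section Growth.
Variables (F : fieldType) (G : finGroupType).
Hypothesis charF : [pchar F] =i pred0.
Implicit Types (B C : gsalg F G) (s t : G * bool) (e : bool).

Lemma alive_sym B s t e : alive B s t e = alive B t s e.
Proof. by congr (~~ _); apply/asboolP/asboolP; exact: nullat_sym. Qed.

Definition alive0 B : nat := alive B one_t one_t true.
Definition alive1 B : pred (G * bool) :=
  fun t => (t != one_t) && alive B t one_t true.
(** The condition on the sign + excludes the functionals already counted by [alive0] and
    [alive1]. *)
Definition alive2 B : pred ((G * bool) * (G * bool) * bool) :=
  fun x => alive B x.1.1 x.1.2 x.2 && (x.2 ==> (x.1.1 != one_t) && (x.1.2 != one_t)).

Lemma card_bset B m :
  #|@bset F G m B| = (alive0 B + m.+2 * #|alive1 B| + 'C(m.+2, 2) * #|alive2 B|)%N.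
Proof.
pose n := m.+2.
rewrite -sum1_card big_mkcond big_sumType big_sumType /=.
congr (_ + _ + _)%N.
- rewrite (big_pred1 tt) => [|[]//];
  rewrite unfold_in /bset /alive0 /bi /bj /bdeg /bsgn /= !ffunE.
  by case: alive.
- transitivity (\sum_(k < n) \sum_t
    if (inl (inr (k, t)) : bindex G m) \in @bset F G m B then 1 else 0)%N.
    by rewrite pair_big; apply: eq_bigr => -[].
  rewrite (eq_bigr (fun=> #|alive1 B|)) => [|k _].
    by rewrite sum_nat_const card_ord.
  rewrite -sum1_card [RHS]big_mkcond; apply: eq_bigr => t _.
  rewrite !unfold_in /bset /alive1 /bi /bj /bdeg /bsgn /= !ffunE eqxx.
  by case: (eqVneq k ord0) => [->|k0]; rewrite /= ?[ord0 == k]eq_sym ?(negPf k0).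
transitivity (\sum_(ij : 'I_n * 'I_n) \sum_x
    if (inr (ij, x) : bindex G m) \in @bset F G m B then 1 else 0)%N.
  by rewrite pair_big; apply: eq_bigr => -[].
rewrite (eq_bigr (fun ij : 'I_n * 'I_n => (ij.1 < ij.2)%N * #|alive2 B|)%N) => [|[i j] _].
  rewrite -big_distrl /=; congr (_ * _)%N.
  transitivity (\sum_(i < n) \sum_(j < n) (i < j))%N; first by rewrite pair_big.
  rewrite exchange_big /=.
  rewrite -bin2_sum big_mkord; apply: eq_bigr => j _.
  by rewrite sum_ord_lt // ltnW.
rewrite -sum1_card [X in (_ * X)%N]big_mkcond big_distrr; apply: eq_bigr => -[[s t] e] _.
rewrite !unfold_in /bset /alive2 /bi /bj /bdeg /bsgn /= !ffunE eqxx.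
case: (ltnP i j) => [ij|_] /=; last by rewrite mul0n.
rewrite (_ : (j == i) = false) ?eqxx; last by rewrite -val_eqE gtn_eqF.
by rewrite mul1n andbC.
Qed.

(** There are finitely many triples of types and sign, and padding can be increased ([sident_le]),
    so one length serves all of them. *)
Lemma nullat_bound B C : proper3_trivial C -> var C B ->
  exists m0, forall m s t e, (m0 <= m)%N -> nullat B s t e -> sident B m s t e.
Proof.
move=> QC CB.
have /choice[f fP] : forall x : (G * bool) * (G * bool) * bool, exists m,
    nullat B x.1.1 x.1.2 x.2 -> sident B m x.1.1 x.1.2 x.2.
  move=> x; have [[m I]|no] := pselect (nullat B x.1.1 x.1.2 x.2); first by exists m.
  by exists 0%N.
exists (\max_x f x) => m s t e fm /(fP (s, t, e)) /=.
by apply: (sident_le charF QC CB); apply: leq_trans fm; exact: (leq_bigmax (s, t, e)).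
Qed.

Lemma codim_formula B C : proper3_trivial C -> var C B ->
  exists n0, forall n, (n0 <= n)%N ->
    codim B n = (alive0 B + n * #|alive1 B| + 'C(n, 2) * #|alive2 B|)%N.
Proof.
move=> QC CB; have [m0 m0P] := nullat_bound QC CB.
(* The shift by 2 accounts for the two letters that stand beside the m padding letters. *)
exists m0.+2 => -[|[|m]] // mm0.
rewrite -card_bset; apply: (codim_card_bset charF QC CB) => s t e.
exact: m0P.
Qed.

End Growth.

(** * Asymptotic behaviour of the codimensions *)

Section Asymptotics.
Variables (R : realType).
Local Open Scope classical_set_scope.
Import numFieldNormedType.Exports.

Lemma near_equiv (f g : nat -> R^o) : (forall eps : R, 0 < eps ->
  exists n0, forall n, (n0 <= n)%N -> `|f n - g n| <= eps * `|g n|) -> f ~_\oo g.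
Proof.
move=> H.
apply/eqaddoP => eps eps0.
have [n0 n0P] := H _ eps0.
by exists n0 => // n /= n0n; exact: n0P.
Qed.

End Asymptotics.

Section GrowthOfCodimensions.
Variables (R : realType) (F : fieldType) (G : finGroupType).
Implicit Types (B : gsalg F G).

Lemma bin2_natr n : 'C(n, 2)%:R * 2 = n%:R * (n%:R - 1) :> R.
Proof.
case: n => [|n]; first by rewrite bin0n mul0r mul0r.
have := bin_ffact n.+1 2; rewrite ffactnS ffactn1 => /(congr1 (fun k => k%:R : R)).
rewrite !natrM => ->; congr (_ * _).
by rewrite /= -natr1 addrK.
Qed.

Definition eventually_poly B a0 a1 a2 := exists n0, forall n, (n0 <= n)%N ->
  codim B n = (a0 + n * a1 + 'C(n, 2) * a2)%N.

Lemma large_nat (x : R) : exists n0, forall n, (n0 <= n)%N -> x <= n%:R.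
Proof.
have [|x0] := leP x 0; first by move=> x0; exists 0%N => n _; apply: le_trans x0 _.
exists (Num.bound x) => n bn; apply: ltW; apply: lt_le_trans (archi_boundP (ltW x0)) _.
by rewrite ler_nat.
Qed.

Lemma growth2 B a0 a1 a2 : (0 < a2)%N -> eventually_poly B a0 a1 a2 ->
  codim_growth B (a2%:R / 2 : R) 2.
Proof.
move=> a2p [n0 n0P]; apply: near_equiv => eps eps0.
have A2 : 0 < a2%:R :> R by rewrite ltr0n.
(* The error is linear in n, at most n (a0 + a1 + a2); from [n1] on, n eps a2 / 2 exceeds the second
   factor. The successor in the next line ensures n >= 1. *)
have [n1 n1P] := large_nat ((a0%:R + a1%:R + a2%:R) / (eps * (a2%:R / 2))).
exists (maxn n0 n1).+1 => n nn; have n0n : (n0 <= n)%N by lia.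
have /n1P : (n1 <= n)%N by lia.
have E2 : 0 < eps * (a2%:R / 2) by apply: mulr_gt0 => //; apply: divr_gt0.
rewrite ler_pdivrMr // => h.
have y0 : 0 <= a2%:R / 2 * n%:R ^+ 2 :> R.
  by apply: mulr_ge0; [apply: divr_ge0 | apply: exprn_ge0].
rewrite (ger0_norm y0) (n0P n n0n) !natrD !natrM.
have c2 := bin2_natr n; set c : R := 'C(n, 2)%:R in c2 *.
have N1 : 1 <= n%:R :> R by rewrite ler1n; lia.
have A0 : 0 <= a0%:R :> R by rewrite ler0n.
have A1 : 0 <= a1%:R :> R by rewrite ler0n.
move: (n%:R : R) (a0%:R : R) (a1%:R : R) (a2%:R : R) c c2 h N1 A0 A1 A2 => N b0 b1 b2 c
  c2 h N1 A0 A1 A2.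
have -> : c = N * (N - 1) / 2 by rewrite -c2 mulfK ?pnatr_eq0.
have -> : b0 + N * b1 + N * (N - 1) / 2 * b2 - b2 / 2 * N ^+ 2 = b0 + N * b1 - N * b2 / 2.
  by field.
apply: (@le_trans _ _ (N * (b0 + b1 + b2))).
  by rewrite ler_norml; apply/andP; split; nra.
have -> : eps * (b2 / 2 * N ^+ 2) = N * (N * (eps * (b2 / 2))) by ring.
by rewrite ler_pM2l //; lra.
Qed.

Lemma growth1 B a0 a1 : (0 < a1)%N -> eventually_poly B a0 a1 0 ->
  codim_growth B (a1%:R : R) 1.
Proof.
move=> a1p [n0 n0P]; apply: near_equiv => eps eps0.
have A1 : 0 < a1%:R :> R by rewrite ltr0n.
have [n1 n1P] := large_nat (a0%:R / (eps * a1%:R)).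
exists (maxn n0 n1) => n nn; have n0n : (n0 <= n)%N by lia.
have /n1P : (n1 <= n)%N by lia.
rewrite ler_pdivrMr ?mulr_gt0 // => h.
rewrite (n0P n n0n) muln0 addn0 natrD natrM expr1 [n%:R * _]mulrC addrK.
rewrite !normrM !ger0_norm ?ler0n //.
by rewrite mulrA mulrC.
Qed.

Lemma growth0 B a0 : eventually_poly B a0 0 0 -> codim_growth B (a0%:R : R) 0.
Proof.
move=> [n0 n0P]; apply: near_equiv => eps eps0; exists n0 => n n0n.
rewrite (n0P n n0n) !muln0 !addn0 expr0 mulr1 subrr normr0.
by rewrite mulr_ge0 // ltW.
Qed.

Lemma codim_growth_bound B (q : R) t : (t <= 2)%N -> codim_growth B q t ->
  exists alpha : R, 0 <= alpha /\ forall n,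
    (1 <= n)%N -> (codim B n)%:R <= alpha * n%:R ^+ 2.
Proof.
move=> t2 /eqaddoP/(_ 1 ltr01)[n0 _ n0P].
(* With eps = 1 the codimensions are at most 2 |q| n^t from [n0] on; [M] bounds the finitely many
   earlier ones. *)
pose M := (\sum_(k < n0) codim B k)%N.
exists (2 * `|q| + M%:R); split; first by rewrite addr_ge0 // mulr_ge0.
move=> n n1; have N1 : 1 <= n%:R :> R by rewrite ler1n.
have N2 : 1 <= n%:R ^+ 2 :> R by rewrite exprn_ege1.
have [nn0|nn0] := ltnP n n0.
  have : (codim B n)%:R <= M%:R :> R.
    by rewrite ler_nat /M (bigD1 (Ordinal nn0)) //= leq_addr.
  have q0 : 0 <= `|q| by [].
  have M0 : 0 <= M%:R :> R by rewrite ler0n.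
  by nra.
have := n0P n nn0; rewrite /= mul1r => h.
have : `|(codim B n)%:R : R| <= `|q * n%:R ^+ t| + `|q * n%:R ^+ t|.
  rewrite -[X in `|X| <= _](subrK (q * n%:R ^+ t)); apply: le_trans (ler_normD _ _) _.
  by rewrite lerD2r.
have e0 : 0 <= n%:R ^+ t :> R by rewrite exprn_ge0.
rewrite ger0_norm // normrM (ger0_norm e0) => h1; apply: le_trans h1 _.
have Nt : n%:R ^+ t <= n%:R ^+ 2 :> R by rewrite ler_weXn2l.
have q0 : 0 <= `|q| by [].
have M0 : 0 <= M%:R :> R by rewrite ler0n.
by nra.
Qed.

End GrowthOfCodimensions.

(** * The algebras with basis 1, u, v, w *)

Section MinimalAlgebra.
Variables (F : fieldType) (G : finGroupType).
Hypothesis charF : [pchar F] =i pred0.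
Variables (kappa : F) (eta : bool) (tu tv tw : G * bool).
(** The type of w has to be that of u v. For kappa = 0 the types are unconstrained, which provides
    the algebras of growth 0 and 1. *)
Hypothesis grading : kappa != 0 ->
  [/\ (tu.1 * tv.1)%g = tw.1, (tv.1 * tu.1)%g = tw.1
    & sgn tw.2 = sgn eta * (sgn tu.2 * sgn tv.2) :> F].

(* The algebra with basis 1, u, v, w, where u v = kappa w = eta (v u) and all
   other products of u, v, w vanish. *)
Definition mini : lmodType F := (F^o * F^o * F^o * F^o)%type.
Implicit Types x y z : mini.

Definition cone x : F := x.1.1.1.
Definition cu x : F := x.1.1.2.
Definition cv x : F := x.1.2.
Definition cw x : F := x.2.
Definition mk (a b c d : F) : mini := (a, b, c, d).

Lemma mini_eq x y :
  cone x = cone y -> cu x = cu y -> cv x = cv y -> cw x = cw y -> x = y.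
Proof.
by case: x y => [[[a b] c] d] [[[a' b'] c'] d'];
  rewrite /cone /cu /cv /cw /= => -> -> -> ->.
Qed.

Lemma mini_lin k x y :
  [/\ cone (k *: x + y) = k * cone x + cone y, cu (k *: x + y) = k * cu x + cu y,
      cv (k *: x + y) = k * cv x + cv y & cw (k *: x + y) = k * cw x + cw y].
Proof. by case: x y => [[[a b] c] d] [[[a' b'] c'] d']; split. Qed.

Lemma miniZ k x : k *: x = mk (k * cone x) (k * cu x) (k * cv x) (k * cw x).
Proof. by case: x => [[[a b] c] d]. Qed.

Definition mini_mul x y : mini :=
  mk (cone x * cone y) (cone x * cu y + cu x * cone y)
     (cone x * cv y + cv x * cone y)
     (cone x * cw y + cw x * cone y +
      kappa * (cu x * cv y + sgn eta * (cv x * cu y))).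

Definition mini_star x : mini :=
  mk (cone x) (sgn tu.2 * cu x) (sgn tv.2 * cv x) (sgn tw.2 * cw x).

Definition mini_comp (g : G) : set mini := [set x |
  [/\ cone x = 0 \/ g = 1%g, cu x = 0 \/ g = tu.1, cv x = 0 \/ g = tv.1
    & cw x = 0 \/ g = tw.1]].

Lemma mini_axioms : gsalg_axioms mini_mul mini_star mini_comp.
Proof.
split.
- move=> x y z; apply: mini_eq; rewrite /mini_mul /cone /cu /cv /cw /=; ring.
- move=> x y z; apply: mini_eq; rewrite /mini_mul /cone /cu /cv /cw /=; ring.
- move=> x y z; apply: mini_eq; rewrite /mini_mul /cone /cu /cv /cw /=; ring.
- move=> c x y; apply: mini_eq;
  rewrite /mini_mul /cone /cu /cv /cw /= /GRing.scale /=; ring.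
- move=> c x y; apply: mini_eq;
  rewrite /mini_mul /cone /cu /cv /cw /= /GRing.scale /=; ring.
- by move=> g; split; left.
- move=> g c x y [x1 x2 x3 x4] [y1 y2 y3 y4]; have [e1 e2 e3 e4] := mini_lin c x y.
  have aux (a b : F) (P : Prop) : a = 0 \/ P -> b = 0 \/ P -> c * a + b = 0 \/ P.
    by case=> [->|]; [case=> [->|]; [left; rewrite mulr0 addr0 | right] | right].
  by split; rewrite ?e1 ?e2 ?e3 ?e4; apply: (@aux).
- move=> x; exists (fun g => mk (if g == 1%g then cone x else 0)
    (if g == tu.1 then cu x else 0) (if g == tv.1 then cv x else 0)
    (if g == tw.1 then cw x else 0)).
    move=> g; split; rewrite /cone /cu /cv /cw /=;
      by case: eqP => [->|_]; [right | left].
  have sumE (f : mini -> F) (h : G -> mini) : {morph f : u v / u + v} -> f 0 = 0 ->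
      f (\sum_g h g) = \sum_g f (h g) by move=> fD f0; apply: (big_morph f).
  by apply: mini_eq; rewrite sumE // -big_mkcond big_pred1_eq.
- move=> f fP f0 g.
  have sumE (h : mini -> F) (k : G) : {morph h : u v / u + v} -> h 0 = 0 ->
      (forall g, h (f g) = 0 \/ g = k) -> forall g, h (f g) = 0.
    move=> hD h0 hk g'; case: (hk g') => // ->.
    have := congr1 h f0; rewrite h0 (big_morph h hD h0) (bigD1 k) //= big1 ?addr0 //.
    by move=> g2 g2k; case: (hk g2) => // e; rewrite e eqxx in g2k.
  by apply: mini_eq;
    [apply: (sumE cone 1%g) | apply: (sumE cu tu.1)
    | apply: (sumE cv tv.1) | apply: (sumE cw tw.1)] => // g'; case: (fP g').
- move=> g h x y [x1 x2 x3 x4] [y1 y2 y3 y4].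
  have m0 (a b : F) (P Q P' : Prop) : (a = 0 \/ P) -> (b = 0 \/ Q) -> (P -> Q -> P') ->
      a * b = 0 \/ P'.
    by move=> [->|p] [->|q] H; rewrite ?mulr0 ?mul0r; [left|left|left|right; exact: H].
  have a0 (a b : F) (P : Prop) : a = 0 \/ P -> b = 0 \/ P -> a + b = 0 \/ P.
    by case=> [->|]; [case=> [->|]; [left; rewrite addr0 | right] | right].
  split; rewrite /cone /cu /cv /cw /=.
  + by apply: (m0 _ _ _ _ _ x1 y1) => -> ->; rewrite mulg1.
  + by apply: (@a0); [apply: (m0 _ _ _ _ _ x1 y2) => -> ->;
    rewrite mul1g | apply: (m0 _ _ _ _ _ x2 y1) => -> ->; rewrite mulg1].
  + by apply: (@a0); [apply: (m0 _ _ _ _ _ x1 y3) => -> ->;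
    rewrite mul1g | apply: (m0 _ _ _ _ _ x3 y1) => -> ->; rewrite mulg1].
  + apply: (@a0); first by apply: (@a0); [apply: (m0 _ _ _ _ _ x1 y4) => -> ->;
    rewrite mul1g | apply: (m0 _ _ _ _ _ x4 y1) => -> ->; rewrite mulg1].
    have [->|k0] := eqVneq kappa 0; first by left; rewrite mul0r.
    have [g1 g2 _] := grading k0.
    apply: (@m0 _ _ True); [by right | | by move=> _; exact].
    apply: (@a0); first by apply: (m0 _ _ _ _ _ x2 y3) => -> ->.
    apply: (@m0 _ _ True); [by right | | by move=> _; exact].
    by apply: (m0 _ _ _ _ _ x3 y2) => -> ->.
- by move=> c x y; apply: mini_eq;
  rewrite /mini_star /cone /cu /cv /cw /= /GRing.scale /=; ring.
- by move=> x; apply: mini_eq; rewrite /mini_star /cone /cu /cv /cw /= ?mulrA ?sgn_sqr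
  ?mul1r.
- move=> x y; apply: mini_eq; rewrite /mini_star /mini_mul /cone /cu /cv /cw /=; try ring.
  have [->|k0] := eqVneq kappa 0; first by ring.
  have [_ _ ->] := grading k0.
  by case: (eta) => /=; ring.
- have sP g x : mini_comp g x -> mini_comp g (mini_star x).
    move=> [x1 x2 x3 x4]; have aux (s a : F) (P : Prop) : a = 0 \/ P -> s * a = 0 \/ P.
      by case=> [->|]; [left; rewrite mulr0 | right].
    by split=> //; apply: (@aux).
  move=> g; apply/seteqP; split=> [_ [x xg <-]|x xg]; first exact: sP.
  exists (mini_star x); first exact: sP.
  by apply: mini_eq; rewrite /mini_star /cone /cu /cv /cw /= ?mulrA ?sgn_sqr ?mul1r.
Qed.

Definition minialg : gsalg F G := GSAlg mini_axioms.

Lemma mini_unitary : unitary minialg.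
Proof.
exists (mk 1 0 0 0 : minialg) => x; split;
  by apply: mini_eq; rewrite /gs_mul /= /mini_mul /cone /cu /cv /cw /=; ring.
Qed.

Lemma sgn_inj (a b : bool) (x : F) : sgn a * x = sgn b * x -> x = 0 \/ a = b.
Proof.
case: a b => [] [] /=; rewrite ?mul1r ?mulN1r; try by right.
  move=> e; left; apply/eqP; have : 2 * x == 0 by rewrite mulr_natl mulr2n {1}e addNr.
  by rewrite mulf_eq0 (negPf (two_neq0 charF)).
move=> e; left; apply/eqP; have : 2 * x == 0 by rewrite mulr_natl mulr2n -{1}e addNr.
by rewrite mulf_eq0 (negPf (two_neq0 charF)).
Qed.

Lemma mini_ghom (s : G * bool) (x : minialg) : ghom s x ->
  [/\ cone x = 0 \/ s = one_t, cu x = 0 \/ s = tu, cv x = 0 \/ s = tv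
    & cw x = 0 \/ s = tw].
Proof.
move=> hx; have [[x1 x2 x3 x4] _] := hx; have sx := ghom_star hx.
have aux (t : G * bool) (a : F) : a = 0 \/ s.1 = t.1 -> sgn t.2 * a = sgn s.2 * a ->
    a = 0 \/ s = t.
  move=> [->|e1]; first by left.
  move=> /sgn_inj[->|e2]; first by left.
  by right; case: s t e1 e2 {hx x1 x2 x3 x4 sx} => [s1 s2] [t1 t2] /= -> ->.
split; apply: aux => //.
- by have := congr1 cone sx; rewrite /= mul1r.
- exact: (congr1 cu sx).
- exact: (congr1 cv sx).
- exact: (congr1 cw sx).
Qed.

Lemma mini_ghomP (s : G * bool) (x : minialg) :
  [/\ cone x = 0 \/ s = one_t, cu x = 0 \/ s = tu, cv x = 0 \/ s = tv
    & cw x = 0 \/ s = tw] -> ghom s x.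
Proof.
move=> [x1 x2 x3 x4]; split.
  by split; [case: x1 | case: x2 | case: x3 | case: x4] => ->;
    [left|right|left|right|left|right|left|right].
have -> : (if s.2 then x else - x) = sgn s.2 *: x.
  by case: s.2; rewrite /= ?scale1r ?scaleN1r.
have aux (t : G * bool) (a : F) : a = 0 \/ s = t -> sgn t.2 * a = sgn s.2 * a.
  by case=> ->; rewrite ?mulr0.
rewrite miniZ; change (mini_star x = mk (sgn s.2 * cone x) (sgn s.2 * cu x)
  (sgn s.2 * cv x) (sgn s.2 * cw x)).
by rewrite /mini_star -(aux _ _ x1) -(aux _ _ x2) -(aux _ _ x3) -(aux _ _ x4) /= mul1r.
Qed.

(** Among basis elements only products with 1 and the products of u and v are nonzero. Products with
    1 commute, so they obstruct only the sign +, and those of u and v only the sign [eta]. Types of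
    basis elements may coincide, whence the disjunction. *)
Lemma mini_bident_or (s t : G * bool) e : bident minialg s t e \/
  (e /\ ((s = one_t /\ [\/ t = one_t, t = tu, t = tv | t = tw]) \/
         (t = one_t /\ [\/ s = one_t, s = tu, s = tv | s = tw]))) \/
  [/\ kappa != 0, e = eta & (s = tu /\ t = tv) \/ (s = tv /\ t = tu)].
Proof.
apply: contrapT => /not_orP[nb /not_orP[n1 n2]]; apply: nb => x y hx hy.
have [x1 x2 x3 x4] := mini_ghom hx; have [y1 y2 y3 y4] := mini_ghom hy.
have E1 (a b : F) (t' : G * bool) : (a = 0 \/ s = one_t) -> (b = 0 \/ t = t') ->
    [\/ t' = one_t, t' = tu, t' = tv | t' = tw] -> a * b + sgn e * (b * a) = 0.
  move=> [->|ss] [->|tt] ht; rewrite ?(mul0r, mulr0, addr0) //.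
  case: (boolP e) => [ee|_] /=; last by rewrite mulN1r mulrC subrr.
  by case: n1; split=> //; left; split=> //; rewrite tt.
have E2 (a b : F) (t' : G * bool) : (a = 0 \/ s = t') -> (b = 0 \/ t = one_t) ->
    [\/ t' = one_t, t' = tu, t' = tv | t' = tw] -> a * b + sgn e * (b * a) = 0.
  move=> [->|ss] [->|tt] ht; rewrite ?(mul0r, mulr0, addr0) //.
  case: (boolP e) => [ee|_] /=; last by rewrite mulN1r mulrC subrr.
  by case: n1; split=> //; right; split=> //; rewrite ss.
have E3 : kappa * (cu x * cv y + sgn eta * (cv x * cu y)) +
    sgn e * (kappa * (cu y * cv x + sgn eta * (cv y * cu x))) = 0.
  have [->|k0] := eqVneq kappa 0; first by rewrite !mul0r mulr0 addr0.
  have [ee|ne] := eqVneq e eta; last first.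
    by case: (e) (eta) ne => [] [] //= _; ring.
  have Z1 : cu x * cv y = 0.
    case: x2 y3 => [->|ss] [->|tt]; rewrite ?(mul0r, mulr0) //.
    by case: n2; split=> //; left.
  have Z2 : cv x * cu y = 0.
    case: x3 y2 => [->|ss] [->|tt]; rewrite ?(mul0r, mulr0) //.
    by case: n2; split=> //; right.
  by rewrite Z1 Z2 [cu y * _]mulrC Z2 [cv y * _]mulrC Z1 !(mulr0, addr0).
apply: mini_eq.
- exact: E1 x1 y1 (Or41 _ _ _ erefl).
- have := E1 _ _ _ x1 y2 (Or42 _ _ _ erefl); have := E2 _ _ _ x2 y1 (Or42 _ _ _ erefl).
  rewrite /cone /cu /cv /cw /= /GRing.scale /= => e1 e2;
    rewrite -[RHS](addr0 0) -{1}e1 -e2; ring.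
- have := E1 _ _ _ x1 y3 (Or43 _ _ _ erefl); have := E2 _ _ _ x3 y1 (Or43 _ _ _ erefl).
  rewrite /cone /cu /cv /cw /= /GRing.scale /= => e1 e2;
    rewrite -[RHS](addr0 0) -{1}e1 -e2; ring.
have := E1 _ _ _ x1 y4 (Or44 _ _ _ erefl); have := E2 _ _ _ x4 y1 (Or44 _ _ _ erefl).
move: E3; rewrite /cone /cu /cv /cw /= /GRing.scale /= => e0 e1 e2.
rewrite -[RHS](addr0 0) -{1}e1 -[in RHS](addr0 0) -{1}e2 -e0; ring.
Qed.

End MinimalAlgebra.

Section MinimalAlgebraTheory.
Variables (F : fieldType) (G : finGroupType).
Hypothesis charF : [pchar F] =i pred0.
Variables (kappa : F) (eta : bool) (tu tv tw : G * bool).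
Hypothesis grading : kappa != 0 ->
  [/\ (tu.1 * tv.1)%g = tw.1, (tv.1 * tu.1)%g = tw.1
    & sgn tw.2 = sgn eta * (sgn tu.2 * sgn tv.2) :> F].
Local Notation M := (minialg grading).
Implicit Types x y z : M.

Lemma mini_nil3 x y z : cone x = 0 -> cone y = 0 -> cone z = 0 ->
  gs_mul (gs_mul x y) z = 0.
Proof.
move=> x0 y0 z0; apply: mini_eq; rewrite /gs_mul /= /mini_mul;
  rewrite ![cone (mk _ _ _ _)]/= ![cu (mk _ _ _ _)]/= ![cv (mk _ _ _ _)]/= x0 y0 z0 ;
  rewrite /cone /cu /cv /cw /= ; ring.
Qed.

Definition nilp x : M := mk 0 (cu x) (cv x) (cw x).

Lemma mini_split x : x = cone x *: (mk 1 0 0 0 : M) + nilp x.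
Proof.
case: x => [[[a b] c] d]; apply: mini_eq;
  rewrite /nilp /mk /cone /cu /cv /cw /= /GRing.scale /=; ring.
Qed.

Lemma nilp_ghom (s : G * bool) x : ghom s x -> ghom s (nilp x).
Proof.
by move=> /(mini_ghom charF)[x1 x2 x3 x4]; apply: mini_ghomP; split=> //; left.
Qed.

(** Each value is a scalar plus an element of the ideal spanned by u, v, w. The scalars contribute
    nothing because the specializations to 1 are identities, and products of three elements of the
    ideal vanish. *)
Lemma mini_proper3 : proper3_trivial M.
Proof.
move=> d L p uL wfp L3 H b hb.
pose e : M := mk 1 0 0 0.
have eP x : gs_mul e x = x /\ gs_mul x e = x.
  by split; apply: mini_eq; rewrite /gs_mul /= /mini_mul /cone /cu /cv /cw /=; ring.
pose bs (S : seq nat) k := if k \in S then nilp (b k) else b k.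
have hbs S k : ghom (d k) (bs S k).
  by rewrite /bs; case: ifP => // _; apply: nilp_ghom.
(* The values are replaced by their nilpotent parts one letter at a time, [S] being the set of
   letters already treated. *)
have step (S : seq nat) : {subset S <= L} -> uniq S ->
    pev (fun k => emb (b k)) p = pev (fun k => emb (bs S k)) p.
  elim: S => [//|i S IH] SL /= /andP[iS uS].
  rewrite IH //; last by move=> k kS; apply: SL; rewrite inE kS orbT.
  have iL : i \in L by apply: SL; rewrite inE eqxx.
  have -> : (fun k => emb (bs S k)) =
      upd (fun k => emb (bs S k)) i (cone (b i) *: emb e + emb (nilp (b i))).
    rewrite -linearP -mini_split; apply/funext => k; rewrite /upd.
    by case: eqP => // ->; rewrite /bs (negPf iS).
  rewrite (pev_lin _ _ _ _ uL iL wfp).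
  have -> : upd (fun k => emb (bs S k)) i (emb (nilp (b i))) =
      (fun k => emb (bs (i :: S) k)).
    apply/funext => k; rewrite /upd /bs inE.
    by case: (eqVneq k i) => [->|].
  suff -> : cone (b i) *: pev (upd (fun k => emb (bs S k)) i (emb e)) p = 0 by rewrite
    add0r.
  have [di|di] := eqVneq (d i) one_t; last first.
    have [[->|/eqP e1] _ _ _] := mini_ghom charF (hb i); first by rewrite scale0r.
    by rewrite (negPf di) in e1.
  rewrite (_ : pev _ p = 0) ?scaler0 //.
  have -> : upd (fun k => emb (bs S k)) i (emb e) = (fun k => emb (upd (bs S) i e k)).
    by apply/funext => k; rewrite /upd; case: eqP.
  rewrite (pev_unit (e := e) (S := predC1 i)) //.
  - rewrite -[mapw _ p]/(delp i p) -(H i iL di (bs S)) //.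
    apply: pev_ext (wf_del i uL wfp) _ => k; rewrite mem_rem_uniq // => /andP[ki _].
    by rewrite upd_neq.
  - by move=> k; rewrite /= negbK => /eqP ->; rewrite upd_eq.
  apply/allP => cw /(allP wfp) pe; rewrite has_predC; apply/negP => /all_pred1P al.
  have : uniq (nseq (size cw.2) i) by rewrite -al (perm_uniq pe).
  rewrite (perm_size pe); case: (size L) L3 => [|[|m]] //= _.
  by rewrite inE eqxx.
rewrite (step L) //; rewrite /pev big1_seq // => cw /andP[_ /(allP wfp) pe].
have : (2 < size cw.2)%N by rewrite (perm_size pe).
have : all (fun k => k \in L) cw.2 by apply/allP => k; rewrite (perm_mem pe).
case: cw.2 => [|i [|j [|k w]]] //= /and4P[iL jL kL _] _.
rewrite !big_cons !mulrA -!embM mini_nil3 ?linear0 ?mul0r ?scaler0 //.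
- by rewrite /bs iL.
- by rewrite /bs jL.
- by rewrite /bs kL.
Qed.

Lemma mini_not_bident_prod : kappa != 0 -> ~ bident M tu tv eta.
Proof.
move=> k0 /(_ (mk 0 1 0 0) (mk 0 0 1 0)) H.
have hu : ghom tu (mk 0 1 0 0 : M).
  by apply: mini_ghomP; split; [left|right|left|left].
have hv : ghom tv (mk 0 0 1 0 : M).
  by apply: mini_ghomP; split; [left|left|right|left].
have := congr1 (@cw F) (H hu hv).
rewrite /gs_mul /= /mini_mul /cw /= /GRing.scale /= /cone /cu /cv /=.
rewrite !mul0r !mulr0 !mulr1 !add0r addr0 mulrCA sgn_sqr mulr1 -mulr2n -mulr_natl.
by move/eqP; rewrite mulf_eq0 (negPf (two_neq0 charF)) (negPf k0).
Qed.

Lemma mini_not_bident_w : ~ bident M tw one_t true.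
Proof.
move=> /(_ (mk 0 0 0 1) (mk 1 0 0 0)) H.
have hw : ghom tw (mk 0 0 0 1 : M).
  by apply: mini_ghomP; split; [left|left|left|right].
have h1 : ghom one_t (mk 1 0 0 0 : M).
  by apply: mini_ghomP; split; [right|left|left|left].
have := congr1 (@cw F) (H hw h1).
rewrite /gs_mul /= /mini_mul /cw /= /GRing.scale /= /cone /cu /cv /=.
rewrite !mul0r !mulr0 !mul1r !add0r !addr0 -mulr2n.
rewrite mulr0 addr0 => /eqP; rewrite (negPf (two_neq0 charF)) //.
Qed.

End MinimalAlgebraTheory.

(** * Multilinearization *)

Section Multilinearization.
Variables (F : fieldType) (G : finGroupType).
Hypothesis charF : [pchar F] =i pred0.

Definition sgset n (T : {ffun 'I_n -> bool}) : F := \prod_i (if T i then 1 else -1).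

(** The sum over [T] factors over i. The factor at i is 1 if [h] takes the value i, and otherwise
    the contributions of [T i] true and false cancel. *)
Lemma inclusion_exclusion n k (h : {ffun 'I_k -> 'I_n}) :
  \sum_T sgset T * \prod_j (T (h j))%:R = [forall i, [exists j, h j == i]]%:R :> F.
Proof.
pose u i (t : bool) : F := (if t then 1 else -1) * \prod_(j | h j == i) t%:R.
transitivity (\sum_(T : {ffun 'I_n -> bool}) \prod_i u i (T i)).
  apply: eq_bigr => T _; rewrite /u big_split /=; congr (_ * _).
  rewrite (partition_big h xpredT) //=; apply: eq_bigr => i _.
  by apply: eq_bigr => j /eqP ->.
rewrite -(bigA_distr_bigA u) /=.
have uE i : \sum_(t : bool) u i t = [exists j, h j == i]%:R.
  rewrite big_bool /= /u big1 // mul1r mulN1r.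
  case: (boolP [exists j, h j == i]) => [/existsP[j hj]|/existsPn hj].
    by rewrite (bigD1 j) //= mul0r subr0.
  by rewrite big_pred0 ?subrr // => j; apply: negPf; exact: hj.
under eq_bigr do rewrite uE.
case: (boolP [forall i, _]) => [/forallP al|].
  by rewrite big1 // => i _; rewrite al.
by case/forallPn => i /negPf ni; rewrite (bigD1 i) //= ni mul0r.
Qed.

Lemma scaler_prod_ord (R : algType F) k (a : 'I_k -> F) (x : 'I_k -> R) :
  \prod_j (a j *: x j) = (\prod_j a j) *: \prod_j x j.
Proof.
elim: k a x => [|k IH] a x; first by rewrite !big_ord0 scale1r.
by rewrite !big_ord_recl IH -scalerAl -scalerAr scalerA.
Qed.

(* By inclusion-exclusion, only the words in which every letter occurs survive. *)
Lemma polarize_word (R : algType F) (K : eqType) n k (beta : 'I_n -> R)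
  (v : 'I_n -> K) (t : 'I_k -> K) :
  \sum_(T : {ffun 'I_n -> bool})
    sgset T *: \prod_(j < k) (\sum_(i | T i && (v i == t j)) beta i) =
  \sum_(h : {ffun 'I_k -> 'I_n} | [forall i, [exists j, h j == i]] &&
     [forall j, v (h j) == t j]) \prod_j beta (h j).
Proof.
have E (T : {ffun 'I_n -> bool}) :
    \prod_(j < k) (\sum_(i | T i && (v i == t j)) beta i) =
    \sum_(h : {ffun 'I_k -> 'I_n})
      ((\prod_j (T (h j))%:R) * [forall j, v (h j) == t j]%:R) *: \prod_j beta (h j).
  transitivity (\prod_(j < k) \sum_i (((T i)%:R * (v i == t j)%:R) *: beta i)).
    apply: eq_bigr => j _; rewrite big_mkcond; apply: eq_bigr => i _.
    by case: (T i); case: eqP; rewrite /= ?mulr1 ?mulr0 ?mul0r ?scale1r ?scale0r.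
  rewrite bigA_distr_bigA; apply: eq_bigr => h _.
  rewrite scaler_prod_ord big_split /=; congr (_ * _ *: _).
  case: (boolP [forall j, _]) => [/forallP al|].
    by rewrite big1 // => j _; rewrite al.
  by case/forallPn => j /negPf nj; rewrite (bigD1 j) //= nj mul0r.
under eq_bigr do rewrite E scaler_sumr.
rewrite exchange_big [RHS]big_mkcond; apply: eq_bigr => h _ /=.
under eq_bigr do rewrite scalerA mulrA.
rewrite -scaler_suml -mulr_suml inclusion_exclusion.
by case: [forall i, _]; case: [forall j, _]; rewrite ?mulr1 ?mulr0 ?scale1r ?scale0r.
Qed.

(** A surjection of a finite set onto itself is a permutation. *)
Lemma polarize_word_perm (R : algType F) (K : eqType) n (beta : 'I_n -> R)
  (v : 'I_n -> K) (t : 'I_n -> K) :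
  \sum_(T : {ffun 'I_n -> bool})
    sgset T *: \prod_(j < n) (\sum_(i | T i && (v i == t j)) beta i) =
  \sum_(s : 'S_n | [forall j, v (s j) == t j]) \prod_j beta (s j).
Proof.
rewrite polarize_word.
rewrite (reindex (fun s : 'S_n => [ffun j => s j])) /=; last first.
  exists (fun h : {ffun 'I_n -> 'I_n} => insubd (1%g : 'S_n) h).
    move=> s _; apply: val_inj; rewrite val_insubd.
    have -> : [ffun j => s j] = val s by apply/ffunP => j; rewrite ffunE -pvalE.
    by rewrite (valP s).
  move=> h /andP[/forallP sh _].
  have hinj : injectiveb h.
    have /image_injP hI : #|[seq h x | x in 'I_n]| == #|'I_n|.
      have iP i : i \in [seq h x | x in 'I_n].
        by have /existsP[j /eqP <-] := sh i; apply: map_f; rewrite mem_enum.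
      by apply/eqP/eq_card => i; rewrite iP.
    by apply/injectiveP => x y; apply: hI.
  apply/ffunP => j; rewrite ffunE -pvalE; congr (fun_of_fin _ j).
  by rewrite -[pval _]/(val _) val_insubd hinj.
apply: eq_big => s.
  have -> /= : [forall i, [exists j, [ffun j => s j] j == i]].
    by apply/forallP => i; apply/existsP; exists ((s^-1)%g i); rewrite ffunE permKV.
  by apply: eq_forallb => j; rewrite ffunE.
by move=> _; apply: eq_bigr => j _; rewrite ffunE.
Qed.

Lemma polarize_word_lt (R : algType F) (K : eqType) n k (beta : 'I_n -> R)
  (v : 'I_n -> K) (t : 'I_k -> K) : (k < n)%N ->
  \sum_(T : {ffun 'I_n -> bool})
    sgset T *: \prod_(j < k) (\sum_(i | T i && (v i == t j)) beta i) = 0.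
Proof.
move=> kn; rewrite polarize_word big_pred0 // => h; apply/negP => /andP[/forallP sh _].
suff : (#|'I_n| <= #|'I_k|)%N by rewrite !card_ord leqNgt kn.
apply: leq_trans (leq_image_card h 'I_k); apply/subset_leq_card/fintype.subsetP => i _.
by have /existsP[j /eqP <-] := sh i; apply: map_f; rewrite mem_enum.
Qed.

Lemma mcoeff_fmonE (w : fmonom (gsvar G)) v :
  mcoeff w (fmon F v) = (FMonom v == w)%:R.
Proof. exact: mcoeffU. Qed.

Section Homogeneous.
Variables (f : freealg F G) (n m : nat) (V : m.-tuple (gsvar G)).
Hypothesis n_gt0 : (0 < n)%N.
Hypothesis uV : uniq V.
Hypothesis Vf : forall w, w \in msupp f -> {subset fmonom_val w <= V}.
Hypothesis nf : forall w, w \in msupp f -> (size (fmonom_val w) <= n)%N.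
Implicit Types (h : {ffun 'I_n -> 'I_m}) (s : 'S_n).

Definition hword h : seq (gsvar G) := [seq tnth V (h i) | i <- enum 'I_n].
Definition hcoef h : F := mcoeff (FMonom (hword h)) f.
Definition hcomp h s : {ffun 'I_n -> 'I_m} := [ffun i => h (s i)].
(** The complete linearization of the part of degree n of [f]: the new letter i stands for an
    occurrence of the variable [tnth V (h i)]. *)
Definition hpoly h : mpol F := [seq (hcoef (hcomp h s), wperm s) | s <- enum 'S_n].
Definition hdeg h k : G * bool :=
  if insub k is Some i then (tnth V (h (i : 'I_n))).2 else one_t.

Lemma wf_hpoly h : wf (iota 0 n) (hpoly h).
Proof. by rewrite /wf all_map; apply/allP => s _; exact: wperm_perm. Qed.

Lemma pev_hpoly (R : algType F) (b : nat -> R) h :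
  pev b (hpoly h) = \sum_s hcoef (hcomp h s) *: \prod_i b (s i).
Proof.
rewrite /pev big_map big_enum; apply: eq_bigr => s _ /=.
by rewrite /wperm big_map enumT [index_enum _]unlock.
Qed.

(** Each variable is replaced by the sum of those [b i], i in [T], whose letter stands for it. The
    alternating sum over [T] kills the words of degree less than n and turns those of degree n into
    their linearizations. *)
Lemma ident_hpoly (B : gsalg F G) h : Id B f -> ident B (hdeg h) (hpoly h).
Proof.
move=> /IdP[_ If] b hb.
pose phi (T : {ffun 'I_n -> bool}) (x : gsvar G) : B :=
  \sum_(i | T i && (tnth V (h i) == x)) b (nat_of_ord i).
have aphi T : admissible (phi T).
  move=> l g e; apply: (@ghom_sum _ _ B (g, e)) => i /andP[_ /eqP Vi].
  by have := hb i; rewrite /hdeg valK Vi.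
have : \sum_T sgset T *: evalu (phi T) f = 0.
  by apply: big1 => T _; rewrite If // scaler0.
rewrite (eq_bigr (fun T => \sum_(w <- msupp f)
    mcoeff w f *: (sgset T *: \prod_(x <- fmonom_val w) emb (phi T x)))); last first.
  move=> T _; rewrite evaluE scaler_sumr; apply: eq_bigr => w _.
  by rewrite !scalerA mulrC.
rewrite exchange_big /= => <-.
transitivity (\sum_(w <- msupp f) mcoeff w f *:
    \sum_(s : 'S_n) ((w == FMonom (hword (hcomp h s)))%:R : F) *:
      \prod_i emb (b (s i))); last first.
  apply: eq_big_seq => w wf; rewrite -scaler_sumr; congr (_ *: _).
  have embphi T x : emb (phi T x) =
      \sum_(i | T i && (tnth V (h i) == x)) emb (b (nat_of_ord i)) by rewrite linear_sum.
  under [RHS]eq_bigr do under eq_bigr do rewrite embphi.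
  have := nf wf; rewrite leq_eqVlt => /orP[/eqP sw|sw].
    have [t wE] : exists t : 'I_n -> gsvar G, fmonom_val w = [seq t i | i <- enum 'I_n].
      have [x0 _] : exists x0 : gsvar G, true by exists (0%N, one_t).
      exists (fun i => nth x0 (fmonom_val w) i).
      apply: (@eq_from_nth _ x0); first by rewrite size_map size_enum_ord sw.
      move=> k; rewrite sw => kn.
      by rewrite (nth_map (Ordinal kn)) ?size_enum_ord // nth_enum_ord.
    under [RHS]eq_bigr do rewrite wE big_map.
    have := polarize_word_perm (fun i : 'I_n => emb (b i)) (fun i => tnth V (h i)) t.
    rewrite enumT [index_enum _]unlock => ->.
    rewrite [RHS]big_mkcond; apply: eq_bigr => s _.
    have -> : (w == FMonom (hword (hcomp h s))) = [forall j, tnth V (h (s j)) == t j].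
      rewrite -(inj_eq val_inj) /= wE /hword; apply/eqP/forallP => [e j|e].
        have /eq_in_map/(_ j) := e; rewrite mem_enum ffunE => /(_ isT) ->.
        exact: eqxx.
      by apply/eq_in_map => j _; rewrite ffunE (eqP (e j)).
    by case: [forall j, _]; rewrite ?scale1r ?scale0r.
  rewrite big1 => [|s _]; last first.
    case: eqP => [e|_]; last by rewrite scale0r.
    by move: sw; rewrite e /= size_map size_enum_ord ltnn.
  symmetry; under eq_bigr do rewrite big_tnth.
  exact: polarize_word_lt.
rewrite pev_hpoly; symmetry.
under eq_bigr do rewrite scaler_sumr.
rewrite exchange_big /=; apply: eq_bigr => s _.
under eq_bigr do rewrite scalerA.
rewrite -scaler_suml; congr (_ *: _).
case: (boolP (FMonom (hword (hcomp h s)) \in msupp f)) => [us|ns].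
  rewrite (bigD1_seq _ us) ?fset_uniq //= eqxx mulr1 big1 ?addr0 // => w /negPf wu.
  by rewrite wu mulr0.
rewrite /hcoef (mcoeff_outdom ns) big1_seq // => w /andP[_ wf].
by case: eqP => [e|_]; rewrite ?mulr0 // -e wf in ns *.
Qed.

Definition hpart : freealg F G := \sum_h hcoef h *: fmon F (hword h).

(** Identifying the letters again undoes the linearization. Each of the n! permutations contributes
    the whole homogeneous part, after reindexing [h] by composition with it. *)
Lemma evalu_hpart (B : gsalg F G) (phi : gsvar G -> B) :
  (n`!)%:R *: evalu phi hpart = \sum_(h : {ffun 'I_n -> 'I_m})
    pev (fun k => emb (if insub k is Some i then phi (tnth V (h (i : 'I_n))) else 0))
      (hpoly h).
Proof.
under [RHS]eq_bigr do rewrite pev_hpoly.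
rewrite exchange_big /=.
rewrite (eq_bigr (fun=> evalu phi hpart)) => [|s _].
  by rewrite sumr_const scaler_nat card_Sn.
rewrite /hpart (big_morph _ (evaluD phi) (evalu0 phi)).
have rinj : injective (fun h => hcomp h s).
  move=> h h' /ffunP e; apply/ffunP => i; have := e ((s^-1)%g i).
  by rewrite !ffunE permKV.
rewrite [RHS](reindex_inj rinj) /=; apply: eq_bigr => h _.
rewrite evaluZ evalu_fmon /hword big_map enumT [index_enum _]unlock.
by congr (_ *: _); apply: eq_bigr => i _; rewrite valK ffunE.
Qed.

Lemma mcoeff_hpart_out (w : fmonom (gsvar G)) : w \notin msupp f ->
  mcoeff w hpart = 0.
Proof.
move=> wf; rewrite raddf_sum big1 //= => h _; rewrite mcoeffZ mcoeff_fmonE.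
case: (eqVneq (FMonom (hword h)) w) => [e|_]; last by rewrite mulr0.
by rewrite /hcoef e (mcoeff_outdom wf) mul0r.
Qed.

Lemma mcoeff_hpart (w : fmonom (gsvar G)) : size (fmonom_val w) = n ->
  mcoeff w hpart = mcoeff w f.
Proof.
move=> sw; case: (boolP (w \in msupp f)) => wf; last first.
  by rewrite mcoeff_hpart_out // mcoeff_outdom.
have [x0 _] : exists x0 : gsvar G, true by exists (0%N, one_t).
have idx (i : 'I_n) : (index (nth x0 (fmonom_val w) i) V < m)%N.
  by rewrite -[X in (_ < X)%N](size_tuple V) index_mem; apply: (Vf wf);
    rewrite mem_nth // sw.
pose h0 : {ffun 'I_n -> 'I_m} := [ffun i => Ordinal (idx i)].
have wh0 : w = FMonom (hword h0).
  apply: val_inj; rewrite /= /hword; apply: (@eq_from_nth _ x0).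
    by rewrite size_map size_enum_ord sw.
  move=> k; rewrite sw => kn.
  rewrite (nth_map (Ordinal kn)) ?size_enum_ord // ffunE (tnth_nth x0) /=.
  rewrite nth_index ?nth_enum_ord //; apply: (Vf wf).
  by rewrite mem_nth // sw.
have -> : mcoeff w hpart = \sum_h hcoef h * (FMonom (hword h) == w)%:R.
  rewrite raddf_sum; apply: eq_bigr => h _.
  by rewrite /= mcoeffZ mcoeff_fmonE.
have c0 : hcoef h0 = mcoeff w f by rewrite /hcoef -wh0.
have e0 : FMonom (hword h0) == w by rewrite -wh0.
rewrite (bigD1 h0) //= e0 mulr1 c0.
rewrite big1 => [|h hh0]; first by rewrite addr0.
case: eqP => [e|_]; last by rewrite mulr0.
case/eqP: hh0; apply/ffunP => i.
have : hword h = hword h0 by rewrite wh0 in e; case: e.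
move=> /eq_in_map/(_ i); rewrite mem_enum => /(_ isT) /eqP.
by rewrite !(tnth_nth x0) nth_uniq ?size_tuple // => /eqP /val_inj.
Qed.

Lemma mcoeff_hpart_size (w : fmonom (gsvar G)) : size (fmonom_val w) != n ->
  mcoeff w hpart = 0.
Proof.
move=> sw; rewrite raddf_sum big1 //= => h _; rewrite mcoeffZ mcoeff_fmonE.
case: eqP => [e|_]; last by rewrite mulr0.
by rewrite -e /= size_map size_enum_ord eqxx in sw.
Qed.

Lemma Id_hpart (B : gsalg F G) : (forall h, ident B (hdeg h) (hpoly h)) ->
  Id B hpart.
Proof.
move=> IB; apply/IdP; split=> [|phi aphi].
  by apply: mcoeff_hpart_size; rewrite fm1 /= eq_sym -lt0n.
apply/eqP; have : (n`!)%:R *: evalu phi hpart == 0.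
  rewrite evalu_hpart big1 // => h _.
  rewrite (IB h (fun k => if insub k is Some i then phi (tnth V (h i)) else 0)) // => k.
  rewrite /hdeg; case: insubP => [i _ _|_]; last exact: ghom0.
  by case: (tnth V (h i)) => l [g e]; exact: aphi.
rewrite scaler_eq0 => /orP[|//].
by rewrite ((pcharf0P F).1 charF) -[X in X == _]prednK ?fact_gt0.
Qed.

End Homogeneous.

(** Induction on a bound for the degree: the top homogeneous part is an identity of both algebras,
    since its linearizations are, and can be subtracted. Characteristic zero lets n! be inverted in
    [Id_hpart]. *)
Lemma Id_multilin (B C : gsalg F G) :
  (forall n (d : nat -> G * bool) p, (0 < n)%N -> wf (iota 0 n) p ->
    ident B d p -> ident C d p) ->
  forall f, Id B f -> Id C f.
Proof.
move=> BC f; suff : forall N (g : freealg F G),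
    (forall w, w \in msupp g -> (size (fmonom_val w) <= N)%N) -> Id B g -> Id C g.
  move=> /(_ (\max_(w <- msupp f) size (fmonom_val w)) f); apply=> w wf.
  exact: (leq_bigmax_seq w).
elim=> [|N IH] g sg Ig.
  suff -> : g = 0 by exact: Id0.
  apply/malgP => w; rewrite mcoeff0; case: msuppP => // wg.
  have := sg w wg; rewrite leqn0 size_eq0 => /eqP w0.
  have -> : w = mone by apply/val_inj; rewrite /= w0 fm1.
  by case: Ig.
pose V := undup (flatten [seq fmonom_val w | w <- msupp g]).
have Vg w : w \in msupp g -> {subset fmonom_val w <= in_tuple V}.
  move=> wg x xw; rewrite /= mem_undup; apply/flattenP; exists (fmonom_val w) => //.
  by apply: map_f.
have uV : uniq (in_tuple V) by rewrite /= undup_uniq.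
have IB (h : {ffun 'I_N.+1 -> 'I_(size V)}) : ident B (hdeg (in_tuple V) h) (hpoly g
  (in_tuple V) h).
  exact: (ident_hpoly sg Ig).
have IC (h : {ffun 'I_N.+1 -> 'I_(size V)}) : ident C (hdeg (in_tuple V) h) (hpoly g
  (in_tuple V) h).
  by apply: (BC N.+1) => //; exact: wf_hpoly.
have HB := Id_hpart (ltn0Sn N) IB.
have HC := Id_hpart (ltn0Sn N) IC.
rewrite -(subrK (hpart g N.+1 (in_tuple V)) g); apply: IdD => //.
apply: IH; last by apply: IdD => //; rewrite -scaleN1r; exact: IdZ.
move=> w; rewrite -mcoeff_neq0 mcoeffB; apply: contraR; rewrite -ltnNge => sw.
have [e|ne] := eqVneq (size (fmonom_val w)) N.+1.
  by rewrite (mcoeff_hpart uV Vg e) subrr.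
rewrite mcoeff_hpart_size // subr0 mcoeff_eq0.
apply/negP => /sg; rewrite leqNgt ltn_neqAle eq_sym ne /=.
by rewrite sw.
Qed.

End Multilinearization.

(** * Minimal varieties *)

Section Subvarieties.
Variables (F : fieldType) (G : finGroupType).
Hypothesis charF : [pchar F] =i pred0.
Implicit Types (B C : gsalg F G) (s t r : G * bool) (e : bool) (p : mpol F).

(** The unit can be substituted for the padding letters, so over [C] eventual vanishing is
    vanishing. *)
Lemma nullat_bident C s t e : unitary C -> proper3_trivial C ->
  nullat C s t e <-> bident C s t e.
Proof.
move=> uC QC; split=> [[m I]|bI].
  have uX : uniq [:: 0, 1 & iota 2 m]%N by rewrite /= !inE !mem_iota iota_uniq.
  apply: (ident_bident uC uX (wf_spoly F _ _ _ _) (i := 0%N) (j := 1%N) _ _ _ _ I) => //.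
    by move=> [|[|k]] // _; [left | right | rewrite /dtwo /= eqxx].
  by rewrite ell_spoly // ((pcharf0P F).1 charF).
exists 0%N; apply: (bident_ident charF QC (L := [:: 0; 1]%N)) => //.
move=> i j e'; rewrite !inE => /orP[] /eqP -> /orP[] /eqP -> // _ _ nz;
  have [ee|ne] := eqVneq e' e; subst.
- exact: bI.
- have e1 : e' = ~~ e by move: ne; case: (e'); case: (e).
  by rewrite e1 ell_spoly_neq eqxx in nz.
- move=> x y hx hy; have := bI y x hy hx => H.
  have : sgn e *: (gs_mul y x + sgn e *: gs_mul x y) = 0 by rewrite H scaler0.
  by rewrite scalerDr scalerA sgn_sqr scale1r addrC.
have e1 : e' = ~~ e by move: ne; case: (e'); case: (e).
by rewrite e1 ell_spoly_neq eqxx in nz.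
Qed.

Lemma alive_bident C s t e : unitary C -> proper3_trivial C ->
  alive C s t e <-> ~ bident C s t e.
Proof.
move=> uC QC; rewrite -(nullat_bident s t e uC QC) /alive.
by split=> [/negP H /asboolP //|H]; apply/negP => /asboolP.
Qed.

Lemma alive_var B C s t e : var C B -> alive B s t e -> alive C s t e.
Proof.
move=> CB; apply: contra => /asboolP[m I]; apply/asboolP; exists m.
by apply: (var_ident _ (wf_spoly F _ _ _ _) CB I).
Qed.

Lemma dead_nullat B s t e : ~~ alive B s t e <-> nullat B s t e.
Proof. by rewrite negbK; split=> /asboolP. Qed.

Lemma ident_unit1 C d p : unitary C -> wf [:: 0%N] p ->
  ident C (upd d 1%N one_t) (mapw (cat^~ [:: 1%N]) p) -> ident C d p.
Proof.
move=> /unit_ghom[e [eh eP]] wfp I b hb.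
have := I (upd b 1%N e); rewrite pev_mulr big_seq1 => H.
have -> : pev (fun i => emb (b i)) p = pev (fun i => emb (upd b 1%N e i)) p * emb e.
  rewrite /pev mulr_suml; apply: eq_big_seq => cw /(allP wfp) pe.
  have /perm_small_eq : (size [:: 0%N] <= 1)%N by [].
  move=> /(_ _ pe) ->; rewrite !big_seq1 -scalerAl -embM (eP _).2.
  by rewrite upd_neq.
rewrite -[X in _ * emb X](upd_eq b 1%N e); apply: H => i.
by rewrite /upd; case: eqP.
Qed.

(** The functionals need two letters. An identity of degree 1 is multiplied by a letter of type
    [one_t], which is set to 1 in [C] afterwards. *)
Lemma ident_wf1 B C : unitary C ->
  (forall n d p, (1 < n)%N -> wf (iota 0 n) p -> ident B d p -> ident C d p) ->
  forall n d p, (0 < n)%N -> wf (iota 0 n) p -> ident B d p -> ident C d p.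
Proof.
move=> uC key [|[|n]] d p // _ wfp Ip; last exact: (key n.+2).
apply: ident_unit1 => //; apply: (key 2) => //.
  apply: wf_mapw wfp => w pe; rewrite perm_catC /= perm_sym.
  by rewrite (perm_catCA [:: 0%N] [:: 1%N] [::]) perm_cons perm_sym.
apply: ident_mulr; apply: ident_ext wfp _ Ip => k.
by rewrite inE => /eqP ->.
Qed.

Lemma alive_ident B C : proper3_trivial C -> unitary C -> var C B ->
  (forall s t e, alive C s t e -> alive B s t e) -> forall f, Id B f -> Id C f.
Proof.
move=> QC uC CB al; apply: (Id_multilin charF); apply: ident_wf1 => // n d p n1 wfp Ip.
apply: (bident_ident charF QC (iota_uniq 0 n) wfp); first by rewrite size_iota.
move=> i j e iL jL ij dij nz; apply/(nullat_bident _ _ _ uC QC)/dead_nullat.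
apply: (contra (@al _ _ _)); apply/dead_nullat.
exact: (detect charF QC CB (iota_uniq 0 n) wfp iL jL ij dij Ip nz).
Qed.

(** By [alive_ident], a subvariety in which all functionals of [C] stay alive is the whole
    variety. *)
Lemma proper_dead B C : proper3_trivial C -> unitary C -> proper_subvar B C ->
  var C B /\ exists s t e, alive C s t e /\ ~~ alive B s t e.
Proof.
move=> QC uC [BC nCB]; have CB : var C B by apply: BC.
split=> //; apply: contrapT => no; apply: nCB => D CD f Bf; apply: CD.
apply: (alive_ident QC uC CB) Bf => s t e al.
by case: (boolP (alive B s t e)) => // nal; case: no; exists s, t, e.
Qed.

Lemma before_lastF i j w : i != j -> before j i (w ++ [:: j]) = false.
Proof.
move=> ij; rewrite /before filter_cat /= eqxx /=; apply/eqP => /(congr1 (last i)).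
by rewrite last_cat /= => e; rewrite e eqxx in ij.
Qed.

(** A dead pair of [t] and [one_t] gives an identity in one letter of type [t] and padding. After
    multiplication by a last letter of type [s], only one order of the two letters occurs, so the
    functionals of both signs equal the sum of the coefficients, 4. *)
Lemma absorb1 B C t s e : proper3_trivial C -> var C B ->
  ~~ alive B t one_t true -> ~~ alive B t s e.
Proof.
move=> QC CB /dead_nullat[m I]; apply/dead_nullat.
pose X := iota 3 m; pose L := [:: 0, 1 & X]%N.
pose d k := if k == 0%N then t else if k == 2%N then s else @one_t G.
have uL : uniq L by rewrite /= !inE !mem_iota iota_uniq.
have L2 : 2%N \notin L by rewrite !inE mem_iota.
have dX k : k \in X -> d k = one_t by rewrite mem_iota; case: k => [|[|[|k]]].
pose p := spoly F X 0 1 true; have wfp : wf L p := wf_spoly F _ _ _ _.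
have Ip : ident B d p.
  by apply/(sident_spoly B true uL dX); rewrite size_iota.
pose q := mapw (cat^~ [:: 2%N]) p.
have wfq : wf (2%N :: L) q.
  by apply: wf_mapw wfp => w pe; rewrite perm_catC /= perm_cons.
have uL' : uniq (2%N :: L) by rewrite cons_uniq L2.
have Iq : ident B d q by exact: ident_mulr.
have tot : \sum_(cw <- q) cw.1 = 4.
  by rewrite big_map -(@ell_spoly F X 0 1 true uL) (ell_true uL wfp).
have p20 : pij 2 0 q = 0.
  rewrite /pij big_map big1 // => cw _ /=.
  by rewrite (@before_lastF 0%N 2%N).
have nz : ell e 0 2 q != 0.
  have := ell_true uL' wfq (i := 0%N) (j := 2%N);
    rewrite tot /ell p20 !mulr0 !addr0 => -> //.
  by rewrite ((pcharf0P F).1 charF).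
have := detect charF QC CB uL' wfq (i := 0%N) (j := 2%N) (d := d) (eta := e).
apply=> //.
by move=> [|[|[|k]]] // _; [left | rewrite /d /= eqxx | right | rewrite /d /= eqxx].
Qed.

Lemma filter_subw_pair j z x y u w : uniq w -> j \in w -> z \notin w ->
  x \in [:: j; z] -> y \in [:: j; z] -> 
  seq.filter (pred2 x y) (subw j u w) = seq.filter (pred2 x y) u.
Proof.
move=> uw jw zw; case/splitPr: jw uw zw => w1 w2 uw.
rewrite mem_cat inE !negb_or subw_split // => /and3P[z1 _ z2].
move: uw; rewrite cat_uniq /= => /and3P[_ /norP[j1 _] /andP[j2 _]].
by rewrite !inE => /orP[] /eqP -> /orP[] /eqP ->;
  rewrite !filter_cat [seq.filter _ w1]filter_notin2 // [seq.filter _ w2]filter_notin2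
    // cats0.
Qed.

(** The element xy + e yx, with x of type [s] and y of type [t], has type [r] and may be substituted
    for the letter of type [r]. The functional of sign [e] at x and y then takes the value 4 + 4. *)
Lemma absorb2 B C s t r e : proper3_trivial C -> var C B ->
  (s.1 * t.1)%g = r.1 -> (t.1 * s.1)%g = r.1 ->
  sgn r.2 = sgn e * (sgn s.2 * sgn t.2) :> F ->
  ~~ alive B r one_t true -> ~~ alive B s t e.
Proof.
move=> QC CB st ts sg /dead_nullat[m I]; apply/dead_nullat.
pose X := iota 3 m; pose L := [:: 0, 1 & X]%N.
pose d0 k := if k == 0%N then r else @one_t G.
pose d k := if k == 0%N then s else if k == 2%N then t else @one_t G.
have uL : uniq L by rewrite /= !inE !mem_iota iota_uniq.
have L2 : 2%N \notin L by rewrite !inE mem_iota.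
have dX k : k \in X -> d0 k = one_t by rewrite mem_iota; case: k => [|[|[|k]]].
pose p := spoly F X 0 1 true; have wfp : wf L p := wf_spoly F _ _ _ _.
have Ip : ident B d0 p.
  by apply/(sident_spoly B true uL dX); rewrite size_iota.
pose q := mapw (subw 0 [:: 0; 2]%N) p ++ scalep (sgn e) (mapw (subw 0 [:: 2; 0]%N) p).
have L0 : 0%N \in L by [].
have wfq : wf (2%N :: L) q.
  rewrite wf_cat wf_scale; apply/andP; split; apply: wf_mapw wfp => w;
    exact: perm_subw.
have uL' : uniq (2%N :: L) by rewrite cons_uniq L2.
have Iq : ident B d q.
  move=> b hb; pose y : B := gs_mul (b 0%N) (b 2%N) + sgn e *: gs_mul (b 2%N) (b 0%N).
  have hy : ghom r y.
    have h0 : ghom s (b 0%N) := hb 0%N; have h2 : ghom t (b 2%N) := hb 2%N.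
    split.
      rewrite /y addrC; apply: gs_compP (gsalgP B) _ _ _ _ _ _.
        by rewrite -ts; exact: (gs_compM (gsalgP B) (proj1 h2) (proj1 h0)).
      by rewrite -st; exact: (gs_compM (gsalgP B) (proj1 h0) (proj1 h2)).
    have -> : (if r.2 then y else - y) = sgn r.2 *: y.
      by case: r.2; rewrite /= ?scale1r ?scaleN1r.
    rewrite /y addrC (gs_star_linear (gsalgP B)) !(gs_starM (gsalgP B)).
    rewrite (ghom_star h0) (ghom_star h2) !(gs_mulZl (gsalgP B), gs_mulZr (gsalgP B)).
    rewrite !scalerA sg scalerDr !scalerA addrC; congr (_ *: _ + _).
    by rewrite mulrAC sgn_sqr mul1r mulrC.
  have := identL (b := upd b 0%N y) wfp Ip.
  have -> : (fun i => emb (upd b 0%N y i)) = upd (fun i => emb (b i)) 0%N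
    (sgn e *: (emb (b 2%N) * emb (b 0%N)) + emb (b 0%N) * emb (b 2%N)).
    apply/funext => i; rewrite /upd; case: eqP => // _.
    by rewrite /y linearD linearZ /= !embM addrC.
  rewrite (pev_lin _ _ _ _ uL L0 wfp) => H.
  rewrite pev_cat pev_scale !(pev_subw _ _ uL L0 wfp) addrC.
  rewrite !big_cons !big_nil !mulr1; apply: H => i iL; rewrite /upd /d0.
  case: eqP => // i0; have := hb i; rewrite /d.
  case: eqP => // _; case: eqP => // i2; by rewrite i2 (negPf L2) in iL.
have tot : \sum_(cw <- p) cw.1 = 4.
  by rewrite -(@ell_spoly F X 0 1 true uL) (ell_true uL wfp).
have fs x y u w : perm_eq w L -> x \in [:: 0; 2]%N -> y \in [:: 0; 2]%N ->
    before x y (subw 0 u w) = (seq.filter (pred2 x y) u == [:: x; y]).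
  move=> pe xin yin; rewrite /before (filter_subw_pair (z := 2%N)) //.
  - by rewrite (perm_uniq pe).
  - by rewrite (perm_mem pe).
  - by rewrite (perm_mem pe).
have nz : ell e 0 2 q != 0.
  rewrite ell_cat ell_scale /ell.
  rewrite (@pij_const _ L _ wfp 0 2 (subw 0 [:: 0; 2]%N) true); last by move=> w pe;
    rewrite fs.
  rewrite (@pij_const _ L _ wfp 2 0 (subw 0 [:: 0; 2]%N) false); last by move=> w pe;
    rewrite fs.
  rewrite (@pij_const _ L _ wfp 0 2 (subw 0 [:: 2; 0]%N) false); last by move=> w pe;
    rewrite fs.
  rewrite (@pij_const _ L _ wfp 2 0 (subw 0 [:: 2; 0]%N) true); last by move=> w pe;
    rewrite fs.
  rewrite tot !mulr0n !mulr1n mulr0 addr0 add0r mulrA sgn_sqr mul1r -natrD.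
  by rewrite ((pcharf0P F).1 charF).
have := detect charF QC CB uL' wfq (i := 0%N) (j := 2%N) (d := d) (eta := e).
apply=> //.
by move=> [|[|[|k]]] // _; [left | rewrite /d /= eqxx | right | rewrite /d /= eqxx].
Qed.

End Subvarieties.

(** * The algebras with basis 1, u, v, w generate minimal varieties *)

Section MinimalGrowth.
Variables (R : realType) (F : fieldType) (G : finGroupType).
Hypothesis charF : [pchar F] =i pred0.
Variables (kappa : F) (eta : bool) (tu tv tw : G * bool).
Hypothesis grading : kappa != 0 ->
  [/\ (tu.1 * tv.1)%g = tw.1, (tv.1 * tu.1)%g = tw.1
    & sgn tw.2 = sgn eta * (sgn tu.2 * sgn tv.2) :> F].
Local Notation M := (minialg grading).
Implicit Types (s t : G * bool) (e : bool) (B : gsalg F G).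

Let uM : unitary M := mini_unitary grading.
Let QM : proper3_trivial M. Proof. exact: mini_proper3. Qed.
Let varMM : var M M. Proof. by []. Qed.

Definition mini_type t := [\/ t = one_t, t = tu, t = tv | t = tw].

Lemma mini_alive s t e : alive M s t e ->
  (e /\ ((s = one_t /\ mini_type t) \/ (t = one_t /\ mini_type s))) \/
  [/\ kappa != 0, e = eta & (s = tu /\ t = tv) \/ (s = tv /\ t = tu)].
Proof.
move=> /(alive_bident charF _ _ _ uM QM) nb.
by case: (mini_bident_or charF grading s t e).
Qed.

Lemma mini_alive2 B s t e : var M B -> alive2 B (s, t, e) ->
  [/\ kappa != 0, e = eta & (s = tu /\ t = tv) \/ (s = tv /\ t = tu)].
Proof.
move=> MB /andP[/(alive_var MB)/mini_alive[[ee st]|//] /implyP/(_ ee)/andP[/= s1 t1]].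
by case: st => -[/= e1 _]; rewrite e1 eqxx in s1 t1.
Qed.

Lemma mini_alive1 B t : var M B -> alive1 B t -> t <> one_t /\ (mini_type t \/ kappa != 0).
Proof.
move=> MB /andP[/eqP t1 /(alive_var MB)/mini_alive al]; split=> //.
by case: al => [[_ [[]|[_ ht]]]|[k0 _ _]]; [|left|right].
Qed.

Lemma mini_dead B : var M B ->
  (exists s t e, alive M s t e /\ ~~ alive B s t e) ->
  (exists2 x, mini_type x & ~~ alive B x one_t true) \/
  kappa != 0 /\ ~~ alive B tu tv eta.
Proof.
move=> MB [s [t [e [/mini_alive al de]]]].
case: al => [[ee [[s1 ht]|[t1 hs]]]|[k0 ee [[su tv']|[sv tu']]]]; subst.
- by left; exists t => //; rewrite alive_sym; case: e ee de.
- by left; exists s => //; case: e ee de.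
- by right.
- by right; split=> //; rewrite alive_sym.
Qed.

Lemma eventually_mini B : var M B ->
  eventually_poly B (alive0 B) #|alive1 B| #|alive2 B|.
Proof. by move=> MB; exact: (codim_formula charF QM MB). Qed.

Lemma card_alive2_0 B : alive2 B =1 pred0 -> #|alive2 B| = 0%N.
Proof. by move=> e; apply: eq_card0 => x; exact: e. Qed.

Lemma card_alive1_0 B : alive1 B =1 pred0 -> #|alive1 B| = 0%N.
Proof. by move=> e; apply: eq_card0 => x; exact: e. Qed.

(** The pair (u, v) is the only source of the quadratic term, and it dies in every proper
    subvariety: directly, by [absorb1] when the type of 1, u or v dies, or by [absorb2] when that of
    w does. The condition on [eta] places it in [alive2]. *)
Lemma mini_growth2 : kappa != 0 ->
  (eta ==> (tu != one_t) && (tv != one_t)) -> minimal_growth R M 2.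
Proof.
move=> k0 het; split.
  have a2 : (0 < #|alive2 M|)%N.
    apply/card_gt0P; exists (tu, tv, eta); rewrite unfold_in /alive2 /= het andbT.
    apply/(alive_bident charF _ _ _ uM QM).
    exact: mini_not_bident_prod.
  exists (#|alive2 M|%:R / 2); first by apply: divr_gt0; rewrite ltr0n.
  exact: (growth2 R a2 (eventually_mini varMM)).
move=> B /(proper_dead charF QM uM)[MB /(mini_dead MB) dead].
have D : ~~ alive B tu tv eta.
  case: dead => [[x hx dx]|[]//].
  have a1 t s e : ~~ alive B t one_t true -> ~~ alive B t s e by exact: (absorb1 charF
    _ _ QM MB).
  case: hx => ex; subst x.
  - by apply: (a1); rewrite alive_sym; exact: a1.
  - exact: a1.
  - by rewrite alive_sym; exact: a1.
  have [g1 g2 g3] := grading k0.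
  exact: (absorb2 charF QM MB g1 g2 g3).
have al2 : #|alive2 B| = 0%N.
  apply: card_alive2_0 => -[[s t] e]; apply/negP => al.
  have [_ ee st] := mini_alive2 MB al; have /andP[al' _] := al; move: al'; rewrite /= ee.
  by case: st => -[-> ->]; rewrite ?[alive B tv _ _]alive_sym (negPf D).
have := eventually_mini MB; rewrite al2.
case: (posnP #|alive1 B|) => [->|a1] ev.
  by exists (alive0 B)%:R, 0%N; split=> //; exact: (growth0 R ev).
by exists #|alive1 B|%:R, 1%N; split=> //; exact: (growth1 R a1 ev).
Qed.

(** All of u, v, w have one type, the only one counted by the linear term; [absorb1] covers the
    death of the type of 1. *)
Lemma mini_growth1 : kappa = 0 -> tu = tw -> tv = tw -> tw != one_t ->
  minimal_growth R M 1.
Proof.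
move=> k0 euw evw w1.
have al2 B : var M B -> #|alive2 B| = 0%N.
  move=> MB; apply: card_alive2_0 => -[[s t] e]; apply/negP => al.
  by have [] := mini_alive2 MB al; rewrite k0 eqxx.
split.
  have a1 : (0 < #|alive1 M|)%N.
    apply/card_gt0P; exists tw; rewrite unfold_in /alive1 w1 /=.
    by apply/(alive_bident charF _ _ _ uM QM); exact: mini_not_bident_w.
  exists #|alive1 M|%:R; first by rewrite ltr0n.
  by apply: (growth1 R a1 (a0 := alive0 M)); rewrite -(al2 _ varMM); exact: eventually_mini.
move=> B /(proper_dead charF QM uM)[MB /(mini_dead MB) dead].
have D : ~~ alive B tw one_t true.
  case: dead => [[x hx dx]|[]]; last by rewrite k0 eqxx.
  case: hx dx => ex; rewrite ex ?euw ?evw // => dx.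
  by rewrite alive_sym; exact: (absorb1 charF _ _ QM MB).
have al1 : #|alive1 B| = 0%N.
  apply: card_alive1_0 => t; apply/negP => al.
  have [t1] := mini_alive1 MB al; rewrite k0 eqxx => -[ht|//].
  have tE : t = tw by case: ht => e; rewrite ?e ?euw ?evw //; case: (t1 e).
  by move: al; rewrite tE /alive1 (negPf D) andbF.
exists (alive0 B)%:R, 0%N; split=> //; apply: growth0.
by have := eventually_mini MB; rewrite al1 al2.
Qed.

Lemma mini_growth0 : kappa = 0 -> tu = one_t -> tv = one_t -> tw = one_t ->
  minimal_growth R M 0.
Proof.
move=> k0 eu ev ew.
have al2 B : var M B -> #|alive2 B| = 0%N.
  move=> MB; apply: card_alive2_0 => -[[s t] e]; apply/negP => al.
  by have [] := mini_alive2 MB al; rewrite k0 eqxx.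
have al1 B : var M B -> #|alive1 B| = 0%N.
  move=> MB; apply: card_alive1_0 => t; apply/negP => al.
  have [t1] := mini_alive1 MB al; rewrite k0 eqxx => -[ht|//].
  by apply: t1; case: ht => ->.
split.
  exists 1 => //.
  have -> : 1 = (alive0 M)%:R :> R.
    rewrite /alive0 (_ : alive M one_t one_t true) //.
    apply/(alive_bident charF _ _ _ uM QM) => bI.
    apply: (@mini_not_bident_w F G charF kappa eta tu tv tw grading) => x y hx hy.
    by apply: bI => //; rewrite -ew.
  apply: growth0; have := eventually_mini varMM.
  by rewrite al1 // al2.
move=> B /(proper_dead charF QM uM)[MB /(mini_dead MB) dead].
have D : alive0 B = 0%N.
  case: dead => [[x hx dx]|[]]; last by rewrite k0 eqxx.
  have ex : x = one_t by case: hx => ->.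
  by rewrite /alive0 -{1}ex (negPf dx).
have [n0 n0P] := eventually_mini MB.
exists n0 => // n /= nn0; rewrite n0P // D al1 // al2 //.
by rewrite !muln0.
Qed.

End MinimalGrowth.

(** * Proper polynomials and growth *)

Section ProperPolynomials.
Variables (F : fieldType) (G : finGroupType).

Lemma indep_codim_pred (A : gsalg F G) n (T : finType) (Q : pred T)
  (b : T -> freealg F G) : (forall x, Q x -> @multilin F G n (b x)) ->
  (forall c : T -> F, Id A (\sum_(x | Q x) c x *: b x) ->
    forall x, Q x -> c x = 0) ->
  (#|Q| <= codim A n)%N.
Proof.
move=> bP bf; apply: (indep_codim (b := fun k : 'I_#|Q| => b (enum_val k))).
  by move=> k; exact: bP (enum_valP k).
move=> c Ic k; pose c' x := \sum_(l < #|Q| | enum_val l == x) c l.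
have cval l : c' (enum_val l) = c l.
  by rewrite /c' (big_pred1 l) // => l'; rewrite (inj_eq enum_val_inj).
rewrite -cval; apply: bf (enum_valP k).
rewrite (big_enum_val (fun x => c' x *: b x)).
by under eq_bigr do rewrite cval.
Qed.

Variables (A : gsalg F G) (d : nat -> G * bool) (L : seq nat) (p : mpol F).
Hypotheses (uA : unitary A) (uL : uniq L) (wfp : wf L p) (L0 : (0 < size L)%N).
Hypothesis L1 : (1 < size L)%N.
Hypothesis Hdel : forall i, i \in L -> d i = one_t -> ident A d (delp i p).
Local Notation k := (size L).

Section Embedding.
Variable n : nat.
Implicit Types (S : {set 'I_n}).

Definition sseq S : seq nat := [seq nat_of_ord i | i <- enum S].
Definition sren S (l : nat) := nth 0%N (sseq S) (index l L).
Definition sdeg S (i : nat) : G * bool :=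
  if i \in sseq S then d (nth 0%N L (index i (sseq S))) else one_t.
Definition scompl S : seq nat := [seq i <- iota 0 n | i \notin sseq S].
(** A copy of [p] in the letters of [S], multiplied on the left by the remaining letters, all of
    type [one_t], to reach degree n. *)
Definition spol S : mpol F := mapw (cat (scompl S)) (mapw (map (sren S)) p).

Lemma uniq_sseq S : uniq (sseq S).
Proof. by rewrite map_inj_uniq ?enum_uniq //; exact: val_inj. Qed.

Lemma size_sseq S : size (sseq S) = #|S|.
Proof. by rewrite size_map -cardE. Qed.

Lemma mem_sseq S (i : 'I_n) : (nat_of_ord i \in sseq S) = (i \in S).
Proof. by rewrite mem_map ?mem_enum //; exact: val_inj. Qed.

Lemma map_sren S : #|S| = k -> map (sren S) L = sseq S.
Proof.
move=> Sk; apply: (@eq_from_nth _ 0%N); first by rewrite size_map size_sseq.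
rewrite size_map => i iL; rewrite (nth_map 0%N) // /sren index_uniq //.
Qed.

Lemma sren_in S l : #|S| = k -> l \in L -> sren S l \in sseq S.
Proof. by move=> Sk lL; rewrite -map_sren // map_f. Qed.

Lemma sdeg_sren S l : #|S| = k -> l \in L -> sdeg S (sren S l) = d l.
Proof.
move=> Sk lL; rewrite /sdeg sren_in // /sren index_uniq ?uniq_sseq ?nth_index //.
by rewrite size_sseq Sk index_mem.
Qed.

Lemma wf_spol S : #|S| = k -> wf (iota 0 n) (spol S).
Proof.
move=> Sk; apply: (wf_mapw (L := sseq S)).
  move=> w pe; apply: (@perm_trans _ (scompl S ++ sseq S)).
    by rewrite perm_cat2l.
  apply: uniq_perm; rewrite ?iota_uniq //.
    rewrite cat_uniq uniq_sseq filter_uniq ?iota_uniq // andbT.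
    by apply/hasPn => i iS; rewrite mem_filter iS.
  move=> i; rewrite mem_cat mem_filter; case: (boolP (i \in sseq S)) => //= iS.
    by case/mapP: iS => j _ ->; rewrite mem_iota /= ltn_ord.
  by rewrite orbF.
by apply: wf_mapw wfp => w pe; rewrite -map_sren // perm_map.
Qed.

Lemma pev_spol (R : algType F) (b : nat -> R) S :
  pev b (spol S) = \prod_(i <- scompl S) b i * pev (fun l => b (sren S l)) p.
Proof.
rewrite pev_mull; congr (_ * _); rewrite /pev big_map.
by apply: eq_bigr => cw _; rewrite big_map.
Qed.

Variables (b0 : nat -> A) (e : A).
Hypothesis hb0 : forall i, ghom (d i) (b0 i).
Hypothesis he : ghom one_t e.
Hypothesis eP : forall x : A, gs_mul e x = x /\ gs_mul x e = x.

Definition sphi S (x : gsvar G) : A :=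
  if x.2 == sdeg S x.1 then
    if x.1 \in sseq S then b0 (nth 0%N L (index x.1 (sseq S))) else e
  else 0.

Lemma adm_sphi S : admissible (sphi S).
Proof.
move=> i g eps; change (ghom (g, eps) (sphi S (i, (g, eps)))).
rewrite /sphi /=; case: eqP => [->|_]; last exact: ghom0.
by rewrite /sdeg; case: ifP.
Qed.

Lemma evalu_spol_eq S : #|S| = k ->
  evalu (sphi S) (fr (sdeg S) (spol S)) = pev (fun i => emb (b0 i)) p.
Proof.
move=> Sk; rewrite evalu_fr pev_spol.
have E1 x : emb e * emb x = emb x by rewrite -embM (eP x).1.
have -> : pev (fun l => emb (sphi S (sren S l, sdeg S (sren S l)))) p =
    pev (fun i => emb (b0 i)) p.
  apply: pev_ext wfp _ => l lL; rewrite /sphi /= eqxx sren_in //.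
  by rewrite /sren index_uniq ?uniq_sseq ?nth_index // size_sseq Sk index_mem.
have : all (fun i => i \notin sseq S) (scompl S).
  by apply/allP => i; rewrite mem_filter => /andP[].
elim: (scompl S) => [|i r IH] /=; first by rewrite big_nil mul1r.
move=> /andP[iS /IH IHr]; rewrite big_cons -mulrA IHr /sphi /= eqxx (negPf iS).
rewrite /pev mulr_sumr; apply: eq_big_seq => cw /(allP wfp) pe.
have : cw.2 != [::] by rewrite -size_eq0 (perm_size pe) -lt0n.
case: cw.2 => // j w _; rewrite big_cons -scalerAr mulrA E1.
by [].
Qed.

Lemma evalu_spol_neq S S' : #|S| = k -> #|S'| = k -> S' != S ->
  evalu (sphi S) (fr (sdeg S') (spol S')) = 0.
Proof.
move=> Sk Sk' ne; rewrite evalu_fr pev_spol.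
have [i iS' iS] : exists2 i, i \in S' & i \notin S.
  have : ~~ (S' \subset S).
    by apply: contra ne => sub; rewrite eqEcard sub Sk Sk' leqnn.
  by case/fintype.subsetPn => i iS' iS; exists i.
have iL : nat_of_ord i \in map (sren S') L by rewrite map_sren // mem_sseq.
case/mapP: iL => l lL il.
pose b l' := sphi S (sren S' l', sdeg S' (sren S' l')).
suff -> : pev (fun l' => emb (b l')) p = 0 by rewrite mulr0.
have hb l' : l' \in L -> ghom (d l') (b l').
  move=> lL'; rewrite -(sdeg_sren Sk' lL').
  have := @adm_sphi S (sren S' l') (sdeg S' (sren S' l')).1 (sdeg S' (sren S' l')).2.
  by rewrite -surjective_pairing.
(* The letter lies outside [S]: it receives the unit if its type there is [one_t], so that [Hdel]
   applies, and 0 otherwise. *)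
have bl : b l = if d l == one_t then e else 0.
  rewrite /b /sphi /= -il /sdeg mem_sseq iS' mem_sseq (negPf iS).
  rewrite il /sren index_uniq ?uniq_sseq ?nth_index //.
  by rewrite size_sseq Sk' index_mem.
have [dl|dl] := eqVneq (d l) one_t; last first.
  rewrite /pev big1_seq // => cw /andP[_ /(allP wfp) pe].
  have lw : l \in cw.2 by rewrite (perm_mem pe).
  case/splitPr: lw => w1 w2; rewrite big_cat big_cons /= bl (negPf dl).
  by rewrite linear0 mul0r mulr0 scaler0.
rewrite (pev_unit (e := e) (S := predC1 l)) //.
- rewrite -[mapw _ p]/(delp l p); apply: (identL (wf_del l uL wfp) (Hdel lL dl)).
  by move=> l' /mem_rem; exact: hb.
- by move=> l'; rewrite /= negbK => /eqP ->; rewrite bl dl eqxx.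
apply/allP => cw /(allP wfp) pe; rewrite has_predC; apply/negP => /all_pred1P al.
have : uniq (nseq (size cw.2) l) by rewrite -al (perm_uniq pe).
by rewrite (perm_size pe); case: (size L) L1 => [|[|m]] //= _; rewrite inE eqxx.
Qed.

(* The specialization [sphi S] is 1 outside [S], hence kills the polynomials of
   the other subsets of the same cardinality. *)
Lemma codim_binomial : pev (fun i => emb (b0 i)) p != 0 -> ('C(n, k) <= codim A n)%N.
Proof.
move=> nz; have <- : #|[set S : {set 'I_n} | #|S| == k]| = 'C(n, k).
  by rewrite card_draws card_ord.
rewrite cardsE.
apply: (indep_codim_pred (b := fun S => fr (sdeg S) (spol S))).
  by move=> S /eqP Sk; apply: multilin_fr; exact: wf_spol.
move=> c /IdP[_ Ic] S SQ; have Sk : #|S| = k by apply/eqP.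
have := Ic (sphi S) (adm_sphi S).
rewrite (big_morph _ (evaluD _) (evalu0 _)) (bigD1 S) //= big1 => [|S' /andP[/eqP Sk' ne]].
  rewrite addr0 evaluZ evalu_spol_eq // => /eqP.
  by rewrite scaler_eq0 (negPf nz) orbF => /eqP.
by rewrite evaluZ evalu_spol_neq // scaler0.
Qed.

End Embedding.
End ProperPolynomials.

Lemma leq_bin_shift N j i : ('C(N, i) <= 'C(N + j, i + j))%N.
Proof.
elim: j => [|j IH]; first by rewrite !addn0.
by rewrite !addnS binS; apply: leq_trans IH (leq_addl _ _).
Qed.

(** At n = N + (k - 3) the binomial coefficient is at least binomial(N, 3), which is cubic in N,
    while n stays below 2 N. *)
Lemma bin_not_quadratic (R : realType) k (alpha : R) : (2 < k)%N ->
  ~ (forall n, (1 <= n)%N -> ('C(n, k))%:R <= alpha * n%:R ^+ 2).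
Proof.
move=> k2 H.
(* N^3 <= 24 binomial(N, 3) for N >= 4, and n^2 <= 4 N^2; the product 24 * 4 gives N <= 96 |alpha|,
   which the choice of [N0] contradicts. *)
have [N0 N0P] := large_nat (96 * `|alpha| + 1).
have [N [NN0 Nk]] : exists N, (N0 <= N)%N /\ (k + 4 <= N)%N.
  by exists (maxn N0 (k + 4)); rewrite leq_maxl leq_maxr.
have h1 := N0P N NN0.
have h2 : ('C(N, 3))%:R <= alpha * (N + (k - 3))%:R ^+ 2.
  apply: le_trans (H (N + (k - 3))%N _); last by lia.
  rewrite ler_nat; have := leq_bin_shift N (k - 3) 3.
  by rewrite (_ : (3 + (k - 3) = k)%N) //; lia.
have h3 : 'C(N, 3)%:R * 6 = N%:R * (N%:R - 1) * (N%:R - 2) :> R.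
  have e6 : ('C(N, 3) * 6 = N * ((N - 1) * (N - 2)))%N.
    by rewrite -[6%N]/(3`!) bin_ffact !ffactnS ffactn0 muln1; congr (_ * (_ * _))%N; lia.
  rewrite -natrM e6 !natrM !natrB ?mulrA //; lia.
have h4 : (N + (k - 3))%:R <= 2 * N%:R :> R.
  by rewrite -natrM ler_nat; lia.
have h5 : 4 <= N%:R :> R by rewrite ler_nat; lia.
have h6 : 0 <= (N + (k - 3))%:R :> R by rewrite ler0n.
have h7 : alpha <= `|alpha| by exact: ler_norm.
have h8 : 0 <= `|alpha| by [].
move: (N%:R : R) ((N + (k - 3))%:R : R) ('C(N,
  3)%:R : R) (`|alpha| : R) h1 h2 h3 h4 h5 h6 h7 h8.
move=> x y c a h1 h2 h3 h4 h5 h6 h7 h8.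
have y2 : y ^+ 2 <= 4 * x ^+ 2 by rewrite !expr2; nra.
have c2 : c <= a * (4 * x ^+ 2).
  apply: le_trans h2 _; apply: le_trans (_ : a * y ^+ 2 <= _).
    by rewrite ler_wpM2r // exprn_ge0.
  by rewrite ler_wpM2l.
have c3 : x ^+ 3 <= 24 * c.
  have -> : 24 * c = 4 * (c * 6) by ring.
  rewrite h3; have -> : 4 * (x * (x - 1) * (x - 2)) = x ^+ 3 + x * (3 * x * (x - 4) +
    8) by ring.
  by rewrite lerDl mulr_ge0 //; nra.
have c4 : x ^+ 3 <= 96 * a * x ^+ 2.
  apply: le_trans c3 _; apply: le_trans (_ : 24 * (a * (4 * x ^+ 2)) <= _).
    by rewrite ler_pM2l.
  by rewrite (_ : 24 * (a * (4 * x ^+ 2)) = 96 * a * x ^+ 2) //; ring.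
have x2 : 0 < x ^+ 2 by rewrite exprn_gt0 //; lra.
rewrite exprSr mulrC ler_pM2r // in c4.
by lra.
Qed.

Lemma quadratic_proper3 (R : realType) (F : fieldType) (G : finGroupType)
  (A : gsalg F G) (alpha : R) : unitary A ->
  (forall n, (1 <= n)%N -> (codim A n)%:R <= alpha * n%:R ^+ 2) ->
  proper3_trivial A.
Proof.
move=> /unit_ghom[e [he eP]] bound d L p uL wfp L3 Hdel b0 hb0.
apply/eqP/negP => /negP nz.
apply: (@bin_not_quadratic R (size L) alpha L3) => n n1.
apply: le_trans (bound n n1); rewrite ler_nat.
apply: (codim_binomial uL wfp _ _ Hdel n hb0 he eP nz);
  [exact: (ltnW (ltnW L3)) | exact: ltnW].
Qed.

(** * Decomposition into minimal varieties *)

Section DirectSums.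
Variables (F : fieldType) (G : finGroupType) (I : finType) (B : I -> gsalg F G).

Lemma eval_free_dsum (phi : gsvar G -> direct_sum B) (f : freealg F G) i :
  (eval_free phi f : dsum B) i = eval_free (fun x => (phi x : dsum B) i) f.
Proof.
rewrite /eval_free (big_morph (fun x : dsum B => x i) (id1 := 0) (op1 := +%R)).
- apply: eq_bigr => w _; rewrite [LHS]ffunE; congr (_ *: _).
  case: (fmonom_val w) => [|x r] /=; first by rewrite ffunE.
  elim: r (phi x) => //= y r IH a; rewrite IH; congr foldl.
  by rewrite ffunE.
- by move=> x y; rewrite ffunE.
- by rewrite ffunE.
Qed.

Lemma dsum_ghom t (x : direct_sum B) :
  ghom t x <-> forall i, ghom t ((x : dsum B) i).
Proof.
have sE i : ((if t.2 then x else - x : direct_sum B) : dsum B) i =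
    if t.2 then (x : dsum B) i else - (x : dsum B) i.
  by case: t.2; rewrite // ffunE.
split=> [[xg xs] i|H].
  split; first exact: xg.
  by have /ffunP/(_ i) := xs; rewrite [X in X = _ -> _]ffunE sE.
split; first by move=> i; case: (H i).
apply/ffunP => i; rewrite [LHS]ffunE [RHS]sE.
by case: (H i).
Qed.

Lemma Id_dsum (f : freealg F G) : mcoeff mone f = 0 ->
  Id (direct_sum B) f <-> forall i, Id (B i) f.
Proof.
move=> f0; split=> [[_ If] i|If]; split=> // phi aphi.
  (* An evaluation in one summand is extended by 0 in the others. *)
  pose psi x : direct_sum B := finfun (dfwith (fun j => 0 : B j) (phi x)).
  have apsi : admissible psi.
    move=> l g e; change (ghom (g, e) (psi (l, (g, e))));
      apply: (dsum_ghom (g, e) _).2 => j.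
    rewrite ffunE; case: (eqVneq i j) => [ij|ij].
      by subst j; rewrite dfwith_in; exact: aphi.
    by rewrite dfwith_out //; exact: ghom0.
  have /ffunP/(_ i) := If psi apsi; rewrite eval_free_dsum [RHS in _ = RHS -> _]ffunE => <-.
  by congr (eval_free _ f); apply/funext => x; rewrite ffunE dfwith_in.
apply/ffunP => i; rewrite eval_free_dsum [RHS]ffunE.
have [_] := If i; apply=> l g e.
have h : ghom (g, e) (phi (l, (g, e))) := aphi l g e.
exact: ((dsum_ghom (g, e) _).1 h i).
Qed.

End DirectSums.

Section Decomposition.
Variables (R : realType) (F : fieldType) (G : finGroupType).
Hypothesis charF : [pchar F] =i pred0.
Implicit Types (A B C : gsalg F G) (s t : G * bool) (e : bool).

Lemma bident_sym A s t e : bident A s t e -> bident A t s e.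
Proof.
move=> bI x y hx hy; have H := bI y x hy hx.
have : sgn e *: (gs_mul y x + sgn e *: gs_mul x y) = 0 by rewrite H scaler0.
by rewrite scalerDr scalerA sgn_sqr scale1r addrC.
Qed.

Lemma not_bident_one A t (z : A) : unitary A -> ghom t z -> z != 0 ->
  ~ bident A one_t t true.
Proof.
move=> /unit_ghom[u [hu uP]] hz z0 /(_ u z hu hz).
rewrite (uP z).1 (uP z).2 /= scale1r -mulr2n -scaler_nat => /eqP.
by rewrite scaler_eq0 (negPf (two_neq0 charF)) (negPf z0).
Qed.

Lemma not_bidentP A s t e : ~ bident A s t e -> exists x y : A,
  [/\ ghom s x, ghom t y & gs_mul x y + sgn e *: gs_mul y x != 0].
Proof.
move=> nb; apply: contrapT => no; apply: nb => x y hx hy.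
by apply/eqP/negP => /negP nz; apply: no; exists x, y.
Qed.

(* The involution preserves A_gh and maps x y to y x, up to sign, which lies in
   A_hg; both products vanish unless g h = h g. *)
Lemma bident_comm A s t e (x y : A) : ghom s x -> ghom t y ->
  gs_mul x y + sgn e *: gs_mul y x != 0 -> (s.1 * t.1)%g = (t.1 * s.1)%g.
Proof.
move=> hx hy; apply: contra_neq_eq => st.
have key (s' t' : G * bool) (x' y' : A) : (s'.1 * t'.1 != t'.1 * s'.1)%g ->
    ghom s' x' -> ghom t' y' -> gs_mul y' x' = 0.
  move=> ne hx' hy'; apply: (gs_comp_uniq ne); last first.
    exact: (gs_compM (gsalgP A) (proj1 hy') (proj1 hx')).
  have xy : gs_comp (s'.1 * t'.1)%g (gs_mul x' y').
    exact: (gs_compM (gsalgP A) (proj1 hx') (proj1 hy')).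
  have : gs_comp (s'.1 * t'.1)%g (gs_star (gs_mul x' y')).
    by rewrite -(gs_star_comp (gsalgP A)); exists (gs_mul x' y').
  rewrite (gs_starM (gsalgP A)) (ghom_star hx') (ghom_star hy').
  rewrite (gs_mulZl (gsalgP A)) (gs_mulZr (gsalgP A)) scalerA => H.
  have /(gs_compP (gsalgP A) (sgn t'.2 * sgn s'.2)) := H.
  move=> /(_ _ (gs_comp0 (gsalgP A) _)); rewrite addr0 scalerA.
  by rewrite mulrACA !sgn_sqr mul1r scale1r.
by rewrite (key s t x y) // (key t s y x) 1?eq_sym // scaler0 addr0.
Qed.

Lemma bident_ghom A s t e (x y : A) : ghom s x -> ghom t y ->
  (s.1 * t.1)%g = (t.1 * s.1)%g ->
  ghom ((s.1 * t.1)%g, (s.2 == t.2) == e) (gs_mul x y + sgn e *: gs_mul y x).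
Proof.
move=> hx hy st; rewrite addrC; split.
  apply: gs_compP (gsalgP A) _ _ _ _ _ _.
    by rewrite /= st; exact: (gs_compM (gsalgP A) (proj1 hy) (proj1 hx)).
  exact: (gs_compM (gsalgP A) (proj1 hx) (proj1 hy)).
rewrite (gs_star_linear (gsalgP A)) !(gs_starM (gsalgP A)).
rewrite (ghom_star hx) (ghom_star hy) !(gs_mulZl (gsalgP A), gs_mulZr (gsalgP A)).
rewrite !scalerA /=; case: s.2; case: t.2; case: e => /=;
  rewrite ?(mulr1, mul1r, mulrN1, mulN1r, opprK, scale1r, scaleN1r) //;
  by rewrite ?opprD ?opprK addrC.
Qed.

(** If the triple counts for the quadratic term, u, v, w imitate x, y and x y + e y x in [A], with
    kappa = 1. Otherwise e is + and one type is [one_t]; then kappa = 0 and u, v, w all take the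
    other type. Every type used belongs to a nonzero element of [A], which is why the identities of
    [A] persist. *)
Lemma atom_algebra A s t e : unitary A -> ~ bident A s t e ->
  exists C : gsalg F G, [/\ unitary C, proper3_trivial C,
    exists2 d, (d <= 2)%N & minimal_growth R C d, ~ bident C s t e
    & forall s' t' e', bident A s' t' e' -> bident C s' t' e'].
Proof.
move=> uA nb; have [x [y [hx hy nz]]] := not_bidentP nb.
have [u [hu uP]] := unit_ghom uA.
have x0 : x != 0 by apply: contraNneq nz => ->; rewrite gs_mul0l gs_mul0r scaler0 addr0.
have y0 : y != 0 by apply: contraNneq nz => ->; rewrite gs_mul0l gs_mul0r scaler0 addr0.
have u0 : u != 0 by apply: contraNneq x0 => u0; rewrite -(uP x).1 u0 gs_mul0l.
have [het|] := boolP (e ==> (s != one_t) && (t != one_t)).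
  have st := bident_comm hx hy nz.
  (* The involution sends xy to yx times both signs, so xy + e yx is symmetric exactly when the
     product of the two signs is e. *)
  pose r : G * bool := ((s.1 * t.1)%g, (s.2 == t.2) == e).
  have grading : (1 : F) != 0 -> [/\ (s.1 * t.1)%g = r.1, (t.1 * s.1)%g = r.1
      & sgn r.2 = sgn e * (sgn s.2 * sgn t.2) :> F].
    move=> _; split=> //; rewrite /r /=; case: s.2; case: t.2; case: (e) => /=;
      by rewrite ?(mulr1, mul1r, mulrN1, mulN1r, opprK).
  have hr : ghom r (gs_mul x y + sgn e *: gs_mul y x) := bident_ghom e hx hy st.
  exists (minialg grading); split.
  - exact: mini_unitary.
  - exact: mini_proper3.
  - by exists 2%N => //; apply: mini_growth2 => //; exact: oner_neq0.
  - by apply: mini_not_bident_prod => //; exact: oner_neq0.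
  have ty w : mini_type s t r w -> ~ bident A one_t w true.
    by case=> ->; [exact: not_bident_one uA hu u0 | exact: not_bident_one uA hx x0
      | exact: not_bident_one uA hy y0 | exact: not_bident_one uA hr nz].
  move=> s' t' e' bA; case: (mini_bident_or charF grading s' t' e') => // -[].
    case=> ee []; case=> e1 tw; subst; case: (ty _ tw).
      by case: (e') ee bA.
    by apply: bident_sym; case: (e') ee bA.
  case=> _ ee; rewrite ee in bA => -[] [e1 e2]; subst; case: nb => //; exact: bident_sym.
rewrite negb_imply negb_and !negbK => /andP[ee st1].
(* At least one of the two types is [one_t]; [r] is the other one. *)
pose r := if s == one_t then t else s.
have grading : (0 : F) != 0 -> [/\ (r.1 * r.1)%g = r.1, (r.1 * r.1)%g = r.1
    & sgn r.2 = sgn true * (sgn r.2 * sgn r.2) :> F] by rewrite eqxx.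
have [z [hz z0]] : exists z : A, ghom r z /\ z != 0.
  by rewrite /r; case: eqP => _; [exists y | exists x].
have srt : (s = one_t /\ t = r) \/ (s = r /\ t = one_t).
  rewrite /r; case: (eqVneq s one_t) st1 => [->|_ /= /eqP ->]; by [left | right].
exists (minialg grading); split.
- exact: mini_unitary.
- exact: mini_proper3.
- have [r1|r1] := eqVneq r one_t.
    by exists 0%N => //; apply: mini_growth0.
  by exists 1%N => //; apply: mini_growth1.
- have nw := @mini_not_bident_w _ _ charF _ _ _ _ _ grading.
  rewrite (_ : e = true) //; case: srt => -[-> ->] //.
  by move=> /bident_sym.
have ty w : mini_type r r r w -> ~ bident A one_t w true.
  by case=> ->; [exact: not_bident_one uA hu u0 | exact: not_bident_one uA hz z0
    | exact: not_bident_one uA hz z0 | exact: not_bident_one uA hz z0].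
move=> s' t' e' bA; case: (mini_bident_or charF grading s' t' e') => // -[].
  case=> ee' []; case=> e1 tw; subst; case: (ty _ tw).
    by case: (e') ee' bA.
  by apply: bident_sym; case: (e') ee' bA.
by case; rewrite eqxx.
Qed.

End Decomposition.

(** * The two implications *)

Section MainProof.
Variables (R : realType) (F : fieldType) (G : finGroupType).
Hypothesis charF : [pchar F] =i pred0.
Implicit Types (A B C : gsalg F G) (s t : G * bool) (e : bool).

Lemma bident_Id A C : unitary A -> unitary C -> proper3_trivial C ->
  (forall s t e, bident A s t e -> bident C s t e) ->
  forall f, Id A f -> Id C f.
Proof.
move=> uA uC QC AC; apply: (Id_multilin charF); apply: ident_wf1 => // n d p n1 wfp Ip.
apply: (bident_ident charF QC (iota_uniq 0 n) wfp); first by rewrite size_iota.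
move=> i j e iL jL ij dij nz; apply: AC.
exact: (ident_bident uA (iota_uniq 0 n) wfp iL jL ij dij Ip nz).
Qed.

Lemma dsum_Id A (I : finType) (B : I -> gsalg F G) : unitary A -> proper3_trivial A ->
  (forall i, unitary (B i)) ->
  (forall s t e, ~ bident A s t e -> exists i, ~ bident (B i) s t e) ->
  forall f, Id (direct_sum B) f -> Id A f.
Proof.
move=> uA QA uB AB; apply: (Id_multilin charF); apply: ident_wf1 => // n d p n1 wfp Ip.
apply: (bident_ident charF QA (iota_uniq 0 n) wfp); first by rewrite size_iota.
move=> i j e iL jL ij dij nz; apply: contrapT => /AB[x []].
have pn : all (fun cw => cw.2 != [::]) p.
  by apply: wf_nonempty wfp; rewrite size_iota ltnW.
apply: (ident_bident (uB x) (iota_uniq 0 n) wfp iL jL ij dij _ nz).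
apply: (Id_fr (B x) d pn).1.
have If := (Id_fr (direct_sum B) d pn).2 Ip.
have [f0 _] := If; exact: (Id_dsum B f0).1 If x.
Qed.

Lemma quadratic_decomposition A : unitary A -> proper3_trivial A ->
  exists (k : nat) (B : 'I_k -> gsalg F G),
     (forall i, exists2 t : nat, (t <= 2)%N & minimal_growth R (B i) t) /\
     T_equiv A (direct_sum B).
Proof.
move=> uA QA.
(* One summand for each triple whose binary polynomial does not vanish on [A]; there are finitely
   many as [G] is finite. *)
pose S := [pred x : (G * bool) * (G * bool) * bool | `[< ~ bident A x.1.1 x.1.2 x.2 >]].
have nbS (i : 'I_#|S|) : ~ bident A (enum_val i).1.1 (enum_val i).1.2 (enum_val i).2.
  by have /asboolP := enum_valP i.
have /choice[B BP] := fun i => atom_algebra R charF uA (nbS i).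
exists #|S|, B; split=> [i|]; first by case: (BP i).
apply/seteqP; split=> f Af.
  have f0 : mcoeff mone f = 0 by case: Af.
  by apply: (Id_dsum B f0).2 => i; case: (BP i) => uB QB _ _ AB;
    exact: (bident_Id uA uB QB AB).
apply: (dsum_Id uA QA _ _ Af) => [i|s t e nb]; first by case: (BP i).
have xS : (s, t, e) \in S by apply/asboolP.
exists (enum_rank_in xS (s, t, e)); case: (BP (enum_rank_in xS (s, t, e))) => _ _ _.
by rewrite enum_rankK_in.
Qed.

Lemma quadratic_dsum A (k : nat) (B : 'I_k -> gsalg F G) :
  (forall i, exists2 t : nat, (t <= 2)%N & minimal_growth R (B i) t) ->
  T_equiv A (direct_sum B) ->
  exists alpha : R, forall n : nat, (1 <= n)%N ->
    (codim A n)%:R <= alpha * n%:R ^+ 2.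
Proof.
move=> BP AB.
have /choice[alpha aP] i : exists a : R, forall n, (1 <= n)%N ->
    (codim (B i) n)%:R <= a * n%:R ^+ 2.
  have [t t2 [[q _ gq] _]] := BP i.
  by have [a [_ aP]] := codim_growth_bound t2 gq; exists a.
exists (\sum_i alpha i) => n n1; rewrite mulr_suml.
apply: le_trans (ler_sum _ (fun i _ => aP i n n1)); rewrite -natr_sum ler_nat.
apply: codim_sub => // f f0 Bf; rewrite AB.
exact: (Id_dsum B f0).2.
Qed.

End MainProof.

Theorem corollary4p11 (R : realType) (F : fieldType)
    (charF : [pchar F] =i pred0) (G : finGroupType) (A : gsalg F G)
    (fdA : finite_dimensional A) (uA : unitary A) :
  (exists alpha : R, forall n : nat, (1 <= n)%N ->
     (codim A n)%:R <= alpha * n%:R ^+ 2)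
  <->
  (exists (k : nat) (B : 'I_k -> gsalg F G),
     (forall i, exists2 t : nat, (t <= 2)%N & minimal_growth R (B i) t) /\
     T_equiv A (direct_sum B)).
Proof.
split=> [[alpha bound]|[k [B [BP AB]]]]; last exact: quadratic_dsum BP AB.
exact: quadratic_decomposition (quadratic_proper3 uA bound).
Qed.
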